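(* Let $u\in C([0,1];H^{4}(\mathbb{R}^{2}))\cap C^{1}([0,1];L^{2}(\mathbb{R}^{2}))$ be a real-valued solution of the Zakharov-Kuznetsov equation \[ \partial_{t}u+\partial_{x}^{3}u+\partial_{x}\partial_{y}^{2}u+u\,\partial_{x}u=0,\qquad (x,y)\in\mathbb{R}^2,\ t\in[0,1], \] such that for all $\beta>0$, $u(0)\in L^{2}(e^{2\beta x}e^{2\beta|y|}\,dx\,dy)$ and $u(1)\in L^{2}(e^{-2\beta x}e^{2\beta|y|}\,dx\,dy)$. Then $u$ is a bounded function from $[0,1]$ with values in $H^{3}(e^{2\beta|x|}e^{2\beta|y|}\,dx\,dy)$ for all $\beta>0$.
   Context: $u(t)$ denotes the function $(x,y)\mapsto u(x,y,t)$. For $u\in C([0,1];H^{4}(\mathbb{R}^{2}))\cap C^{1}([0,1];L^{2}(\mathbb{R}^{2}))$, being a solution means that the equation holds in $L^2(\mathbb{R}^2)$ for every $t\in[0,1]$, with $\partial_t u$ the derivative of the $C^1$ map $t\mapsto u(t)\in L^2(\mathbb{R}^2)$ (one-sided at the endpoints). For a positive weight $\omega(x,y)$, $L^2(\omega\,dx\,dy)$ is the space of measurable $f$ on $\mathbb{R}^2$ with $\int_{\mathbb{R}^2}|f|^2\omega\,dx\,dy<\infty$, and $f\in H^k(\omega\,dx\,dy)$ means that $\partial^\alpha f\in L^2(\omega\,dx\,dy)$ for all multi-indices $\alpha=(\alpha_1,\alpha_2)$ with $|\alpha|\le k$. ''$u$ is bounded from $[0,1]$ with values in $H^k(\omega\,dx\,dy)$''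 means that $u(t)\in H^k(\omega\,dx\,dy)$ for every $t\in[0,1]$ and $\sup_{t\in[0,1]}\sum_{|\alpha|\le k}\|\partial^\alpha u(t)\|_{L^2(\omega\,dx\,dy)}<\infty$. *)

(* Defs.v *)
From HB Require Import structures.
From mathcomp Require Import all_boot all_order all_algebra.
From mathcomp Require Import all_classical all_reals all_analysis.

Set Implicit Arguments.
Unset Strict Implicit.
Unset Printing Implicit Defensive.
Import Order.TTheory GRing.Theory Num.Theory.
Import numFieldNormedType.Exports.

Local Open Scope classical_set_scope.
Local Open Scope ring_scope.

(* [plane R] is convertible to [R * R]; it carries the Borel sigma-algebra
   of R^2, while [R * R] carries the normed space structure. *)
Notation plane R := (measurableTypeR R * measurableTypeR R)%type.

Definition leb2 (R : realType) : {measure set (plane R) -> \bar R} :=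
  (@lebesgue_measure R \x @lebesgue_measure R)%E.

Section weighted_L2.
Context {R : realType}.
Implicit Types (w f : plane R -> R).

Definition L2 w f : Prop :=
  measurable_fun setT f /\
  (\int[leb2 R]_z ((`|f z| ^+ 2 * w z)%:E) < +oo)%E.

Definition L2norm w f : \bar R :=
  ((\int[leb2 R]_z ((`|f z| ^+ 2 * w z)%:E)) `^ 2^-1)%E.

Lemma L2norm1E f : L2norm (cst 1) f = 'N[leb2 R]_2%:E[EFin \o f]%E.
Proof.
rewrite /L2norm unlock; congr (_ `^ _)%E; apply: eq_integral => z _ /=.
by rewrite mulr1 powR_mulrn.
Qed.

Lemma L2_1E f : L2 (cst 1) f <-> f \in Lfun (leb2 R) 2%:E.
Proof.
have E : (L2norm (cst 1%R) f < +oo)%E <->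
    (\int[leb2 R]_z ((`|f z| ^+ 2 * cst 1%R z)%:E) < +oo)%E.
  rewrite /L2norm; split => [|h]; last exact: poweR_lty.
  rewrite !ltey; apply: contra => /eqP ->.
  by rewrite poweRyr // invr_eq0.
rewrite inE; split=> [[mf If]|/andP[mf nf]].
  by apply/andP; split; rewrite inE //= /finite_norm -L2norm1E; apply/E.
split; first by move: mf; rewrite inE.
by move: nf; rewrite inE /= /finite_norm -L2norm1E => /E.
Qed.

End weighted_L2.

Section weak_derivatives.
Context {R : realType}.
Implicit Types (f g : plane R -> R) (phi : R * R -> R).

Definition pderiv (a b : nat) phi : R * R -> R :=
  iter a (fun psi z => 'D_((1, 0) : R * R) psi z)
    (iter b (fun psi z => 'D_((0, 1) : R * R) psi z) phi).

(* Frechet differentiability of every [pderiv a b phi] forces all of them to be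
   continuous, hence [phi] is of class C^oo and the partials commute. *)
Definition test_function phi : Prop :=
  (forall a b z, differentiable (pderiv a b phi) z) /\
  compact (closure [set z | phi z != 0]).

Definition loc_integrable f : Prop :=
  measurable_fun setT f /\
  forall K : set (R * R), compact K ->
    (\int[leb2 R]_(z in K) `|(f z)%:E| < +oo)%E.

Definition is_wderiv (a b : nat) f g : Prop :=
  [/\ loc_integrable f, loc_integrable g &
    forall phi, test_function phi ->
      \int[leb2 R]_z (f z * pderiv a b phi z) =
      (-1) ^+ (a + b) * \int[leb2 R]_z (g z * phi z)].

(* A representative of the weak derivative, which is unique up to
   a.e. equality (junk value 0 when there is none). *)
Definition wderiv (a b : nat) f : plane R -> R :=
  xget (cst 0) [set g | is_wderiv a b f g].

(* H^k(w dx dy); existence is required separately since [wderiv] is 0 when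
   there is no weak derivative. *)
Definition Sobolev (k : nat) (w : plane R -> R) f : Prop :=
  forall a b : nat, (a + b <= k)%N ->
    (exists g, is_wderiv a b f g) /\ L2 w (wderiv a b f).

Definition Sobolev_norm (k : nat) (w : plane R -> R) f : \bar R :=
  (\sum_(a < k.+1) \sum_(b < k.+1 | (a + b <= k)%N)
    L2norm w (wderiv a b f))%E.

End weak_derivatives.

Section evolution.
Context {R : realType}.
Implicit Types (u v : R -> plane R -> R).

(* u in C([0,1]; H^k(R^2)); only the values of u on [0,1] are meaningful. *)
Definition C0_Sobolev (k : nat) u : Prop :=
  (forall t, t \in `[0, 1] -> Sobolev k (cst 1) (u t)) /\
  (forall t, t \in `[0, 1] ->
    Sobolev_norm k (cst 1) (u s \- u t) @[s --> within `[0, 1] (nbhs t)]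
      --> 0%E).

Definition C0_L2 v : Prop :=
  (forall t, t \in `[0, 1] -> L2 (cst 1) (v t)) /\
  (forall t, t \in `[0, 1] ->
    L2norm (cst 1) (v s \- v t) @[s --> within `[0, 1] (nbhs t)] --> 0%E).

(* u in C^1([0,1]; L^2(R^2)) with derivative v, one-sided at 0 and 1. *)
Definition C1_L2 u v : Prop :=
  [/\ (forall t, t \in `[0, 1] -> L2 (cst 1) (u t)), C0_L2 v &
    forall t, t \in `[0, 1] ->
      L2norm (cst 1) (fun z => (s - t)^-1 * (u s z - u t z) - v t z)
        @[s --> within `[0, 1] t^'] --> 0%E].

(* u_t + u_xxx + u_xyy + u u_x = 0, as an equality in L^2(R^2), that is, almost everywhere. *)
Definition ZK_solution u : Prop :=
  C0_Sobolev 4 u /\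
  exists ut, C1_L2 u ut /\
    forall t, t \in `[0, 1] ->
      {ae leb2 R, forall z,
        ut t z + wderiv 3 0 (u t) z + wderiv 1 2 (u t) z
          + u t z * wderiv 1 0 (u t) z = 0}.

Definition bounded_Sobolev (k : nat) (w : plane R -> R) u : Prop :=
  (forall t, t \in `[0, 1] -> Sobolev k w (u t)) /\
  exists M : R, forall t, t \in `[0, 1] -> (Sobolev_norm k w (u t) <= M%:E)%E.

End evolution.

(* Main.v *)
Require Import Defs.
From HB Require Import structures.
From mathcomp Require Import all_boot all_order all_algebra.
From mathcomp Require Import all_classical all_reals all_analysis.
From mathcomp Require Import measurable_realfun.
From mathcomp Require Import ring lra.
Import Order.TTheory GRing.Theory Num.Theory.
Import numFieldNormedType.Exports.

Set Implicit Arguments.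
Unset Strict Implicit.
Unset Printing Implicit Defensive.

Local Open Scope classical_set_scope.
Local Open Scope ring_scope.

(* For signs s, t and c > 0 put E(r) = \int u(r)^2 w, where w = P(c (s x + t y))
   and P(v) = e^v / (1 + eps e^v).  P is bounded by e^v and by 1/eps, and its
   derivatives are polynomials in P dominated by P.  Multiplying the equation by
   u w and integrating by parts gives
     s E' <= - c \int (3 u_x^2 + u_y^2 + 2 s t u_x u_y) P' + K E,
   the quadratic form is nonnegative, and K does not depend on eps (it involves
   only c and the sup norms of u and u_x, the latter bounded in terms of the H^4
   norm).  By Gronwall, run forwards from r = 0 when s = 1 and backwards from
   r = 1 when s = -1, and eps -> 0, u(r) e^{c (s x + t y) / 2} is bounded in L^2
   uniformly in r; the four sign choices dominate e^{c|x| + c|y|}.  Derivatives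
   follow one at a time from \int g^2 w = - \int f (g' w + g w') for g = f'.
   All integrations by parts are done on difference quotients, which converge
   in L^2 at rate h because a weak derivative satisfies
     f(z + h e) - f(z) = \int_0^h f_e(z + r e) dr   for almost every z. *)

(** * Square-integrable functions *)

(** Decay to the right is assumed at time 0 only, decay to the left at time 1 only. For a weight
    increasing in x the dispersive terms have the good sign forwards in time, for a decreasing
    weight backwards: each assumption is propagated in the direction in which it can be used. Slopes
    of equal modulus make the form 3 X^2 + Y^2 + 2 s t X Y equal to 2 X^2 + (s X + t Y)^2. Nothing
    is known about the weighted size of u at intermediate times, so e^v itself is not an admissible
    multiplier. For fixed eps, P is bounded, and P' = P - eps P^2 makes each derivative of P the
    product of P and a polynomial in eps P, a number of [0, 1]; hence constants free of eps. In the
    interpolation of g = f', Cauchy-Schwarz leaves g and g' unweighted and puts the weight on f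
    alone. Each differentiation thus doubles the exponent required of f, which is harmless since
    every exponent is available, and consumes g' in L^2, which is why H^4 gives weighted H^3. Order
    4 is also what makes u and u_x bounded and lets the difference quotients reach u_xxx and
    u_xyy. *)

Section square_integrable.
Context d (T : measurableType d) (R : realType).
Variable mu : {measure set T -> \bar R}.
Implicit Types f g w : T -> R.

Definition intble f := mu.-integrable setT (EFin \o f).

Definition sqint f := measurable_fun setT f /\
  (\int[mu]_z ((f z ^+ 2)%:E) < +oo)%E.

Definition n2 f : R := Num.sqrt (\int[mu]_z (f z ^+ 2)).

Lemma intbleP f : intble f <->
  measurable_fun setT f /\ (\int[mu]_z `|f z|%:E < +oo)%E.
Proof.
split=> [/integrableP[/measurable_EFinP mf oo]|[mf oo]]; first by split.
by apply/integrableP; split => //; exact/measurable_EFinP.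
Qed.

Lemma intble_measurable f : intble f -> measurable_fun setT f.
Proof. by case/intbleP. Qed.

Lemma le_intble f g : measurable_fun setT f ->
  (forall z, `|f z| <= `|g z|) -> intble g -> intble f.
Proof.
move=> mf fg; apply: le_integrable => //; first exact/measurable_EFinP.
by move=> z _ /=; rewrite lee_fin.
Qed.

Lemma intbleD f g : intble f -> intble g -> intble (fun z => f z + g z).
Proof. by move=> mf mg; apply: (integrableD _ mf mg). Qed.

Lemma intbleB f g : intble f -> intble g -> intble (fun z => f z - g z).
Proof. by move=> mf mg; apply: (integrableB _ mf mg). Qed.

Lemma intbleZ (k : R) f : intble f -> intble (fun z => k * f z).
Proof. by move=> mf; apply: (integrableZl _ k mf). Qed.

Lemma intble_abs f : intble f -> intble (fun z => `|f z|).
Proof.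
move=> mf; apply: (le_intble _ _ mf); last by move=> z; rewrite normr_id.
by apply: measurableT_comp => //; exact: intble_measurable.
Qed.

Lemma intble_sqr f : sqint f -> intble (fun z => f z ^+ 2).
Proof.
move=> [mf oo]; apply/intbleP; split; first exact: measurable_funX.
by under eq_integral do rewrite ger0_norm ?sqr_ge0//.
Qed.

Lemma sqintP f : sqint f <->
  measurable_fun setT f /\ intble (fun z => f z ^+ 2).
Proof.
split=> [sf|[mf]]; first by split; [case: sf|exact: intble_sqr].
move=> /intbleP[_]; under eq_integral do rewrite ger0_norm ?sqr_ge0//.
by move=> oo; split.
Qed.

Lemma le_sqint f g : measurable_fun setT f ->
  (forall z, `|f z| <= `|g z|) -> sqint g -> sqint f.
Proof.
move=> mf fg /sqintP[mg ig]; apply/sqintP; split => //.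
apply: (le_intble _ _ ig); first exact: measurable_funX.
by move=> z; rewrite !normrX lerXn2r ?nnegrE.
Qed.

Lemma intbleM f g : sqint f -> sqint g -> intble (fun z => f z * g z).
Proof.
move=> /[dup] [[mf _]] /intble_sqr if2 /[dup] [[mg _]] /intble_sqr ig2.
apply: (le_intble _ _ (intbleD if2 ig2)); first exact: measurable_funM.
move=> z; rewrite (ger0_norm (addr_ge0 (sqr_ge0 _) (sqr_ge0 _))) ler_norml.
by apply/andP; split; nra.
Qed.

Lemma sqintD f g : sqint f -> sqint g -> sqint (fun z => f z + g z).
Proof.
move=> sf sg; apply/sqintP; split.
  by apply: measurable_funD; [case: sf|case: sg].
have i2 := intbleD (intbleD (intble_sqr sf) (intble_sqr sg))
                   (intbleZ 2 (intbleM sf sg)).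
apply: (le_intble _ _ i2).
  by apply/measurable_funX/measurable_funD; [case: sf|case: sg].
by move=> z; rewrite le_eqVlt; apply/orP; left; apply/eqP; congr (`|_|); ring.
Qed.

Lemma sqintZ (k : R) f : sqint f -> sqint (fun z => k * f z).
Proof.
move=> sf; apply/sqintP; split.
  by apply: measurable_funM => //; case: sf.
apply: (le_intble _ _ (intbleZ (k ^+ 2) (intble_sqr sf))).
  by apply/measurable_funX/measurable_funM => //; case: sf.
by move=> z; rewrite exprMn.
Qed.

Lemma sqintB f g : sqint f -> sqint g -> sqint (fun z => f z - g z).
Proof.
move=> sf sg; have := sqintD sf (sqintZ (-1) sg).
by congr sqint; apply/funext => z; rewrite mulN1r.
Qed.

Lemma sqint_bounded_mull w f (M : R) : measurable_fun setT w ->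
  (forall z, `|w z| <= M) -> sqint f -> sqint (fun z => w z * f z).
Proof.
move=> mw wM sf.
apply: (@le_sqint _ (fun z => M * f z)); last exact: sqintZ.
  by apply: measurable_funM => //; case: sf.
move=> z; rewrite !normrM ler_wpM2r//.
by rewrite (le_trans (wM z))// ler_norm.
Qed.

Lemma intble_bounded_mull w f (M : R) : measurable_fun setT w ->
  (forall z, `|w z| <= M) -> intble f -> intble (fun z => w z * f z).
Proof.
move=> mw wM sf.
apply: (@le_intble _ (fun z => M * f z)); last exact: intbleZ.
  by apply: measurable_funM => //; exact: intble_measurable.
move=> z; rewrite !normrM ler_wpM2r//.
by rewrite (le_trans (wM z))// ler_norm.
Qed.

Lemma int_sqr_ge0 f : 0 <= \int[mu]_z (f z ^+ 2).
Proof. by apply: Rintegral_ge0 => z _; exact: sqr_ge0. Qed.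

Lemma n2_ge0 f : 0 <= n2 f.
Proof. exact: sqrtr_ge0. Qed.

Lemma sqr_n2 f : n2 f ^+ 2 = \int[mu]_z (f z ^+ 2).
Proof. by rewrite sqr_sqrtr// int_sqr_ge0. Qed.

Lemma EFin_Rintegral f : intble f ->
  (\int[mu]_z (f z))%:E = (\int[mu]_z (f z)%:E)%E.
Proof. by move=> mf; rewrite fineK// integrable_fin_num. Qed.

Lemma intD f g : intble f -> intble g ->
  \int[mu]_z (f z + g z) = \int[mu]_z f z + \int[mu]_z g z.
Proof. by move=> mf mg; rewrite RintegralD. Qed.

Lemma intB f g : intble f -> intble g ->
  \int[mu]_z (f z - g z) = \int[mu]_z f z - \int[mu]_z g z.
Proof. by move=> mf mg; rewrite RintegralB. Qed.

Lemma intZ (k : R) f : intble f -> \int[mu]_z (k * f z) = k * \int[mu]_z f z.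
Proof. by move=> mf; rewrite RintegralZl. Qed.

Lemma eq_int f g : f =1 g -> \int[mu]_z f z = \int[mu]_z g z.
Proof. by move=> /funext ->. Qed.

Lemma le_int f g : intble f -> intble g -> (forall z, f z <= g z) ->
  \int[mu]_z f z <= \int[mu]_z g z.
Proof. by move=> mf mg fg; apply: le_Rintegral. Qed.

Lemma ae_eq_int f g : measurable_fun setT f -> measurable_fun setT g ->
  {ae mu, forall z, f z = g z} -> \int[mu]_z f z = \int[mu]_z g z.
Proof.
move=> mf mg fg; congr fine; apply: ae_eq_integral => //.
- exact/measurable_EFinP.
- exact/measurable_EFinP.
- by apply: filterS fg => z -> _.
Qed.

Lemma ae_eq_sqint f g : measurable_fun setT g ->
  {ae mu, forall z, f z = g z} -> sqint f -> sqint g.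
Proof.
move=> mg fg [mf oo]; split => //; congr (_ < _)%E : oo.
apply: ae_eq_integral => //.
- exact/measurable_EFinP/measurable_funX.
- exact/measurable_EFinP/measurable_funX.
- by apply: filterS fg => z -> _.
Qed.

Lemma ae_eq_n2 f g : measurable_fun setT f -> measurable_fun setT g ->
  {ae mu, forall z, f z = g z} -> n2 f = n2 g.
Proof.
move=> mf mg fg; congr Num.sqrt; apply: ae_eq_int.
- exact: measurable_funX.
- exact: measurable_funX.
- by apply: filterS fg => z ->.
Qed.

(** The integral of (a f + b g)^2 is a nonnegative quadratic form in (a, b); the inequality comes
    from its value at one point, chosen according to whether [n2 g] vanishes. *)
Lemma cauchy_schwarz f g : sqint f -> sqint g ->
  `|\int[mu]_z (f z * g z)| <= n2 f * n2 g.
Proof.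
move=> sf sg; set I := \int[mu]_z (f z * g z).
have key (a b : R) :
    0 <= a ^+ 2 * n2 f ^+ 2 + 2 * a * b * I + b ^+ 2 * n2 g ^+ 2.
  have -> : a ^+ 2 * n2 f ^+ 2 + 2 * a * b * I + b ^+ 2 * n2 g ^+ 2 =
      \int[mu]_z ((a * f z + b * g z) ^+ 2).
    have if2 := intble_sqr sf; have ig2 := intble_sqr sg.
    have ifg := intbleM sf sg.
    rewrite !sqr_n2 -(intZ _ if2) -(intZ _ ifg) -(intZ _ ig2).
    rewrite -intD; [|exact: intbleZ..].
    rewrite -intD; [|apply: intbleD; exact: intbleZ|exact: intbleZ].
    by apply: eq_int => z; ring.
  exact: int_sqr_ge0.
have I2 : I ^+ 2 <= (n2 f * n2 g) ^+ 2.
  have := n2_ge0 f; have := n2_ge0 g.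
  rewrite le_eqVlt => /orP[/eqP g0 f0|g0 f0].
    (* With [n2 g = 0] the form is I^2 (F - 2 (F + 1)), where F = [n2 f ^+ 2]; it is nonnegative
       only if I = 0. *)
    have := key I (- (n2 f ^+ 2 + 1)).
    rewrite -g0; have := sqr_ge0 (n2 f); have := sqr_ge0 I.
    move: (n2 f ^+ 2) (I ^+ 2) (expr2 I) => F J JE J0 F0 K; nra.
  have := key (n2 g ^+ 2) (- I).
  have g2 : 0 < n2 g ^+ 2 by rewrite exprn_gt0.
  rewrite (_ : _ + _ = n2 g ^+ 2 * ((n2 f * n2 g) ^+ 2 - I ^+ 2)); last by ring.
  by rewrite pmulr_rge0// subr_ge0.
rewrite -(ger0_norm (mulr_ge0 (n2_ge0 f) (n2_ge0 g))).
by rewrite -ler_sqr ?nnegrE// !real_normK ?num_real.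
Qed.

Lemma n2D f g : sqint f -> sqint g -> n2 (fun z => f z + g z) <= n2 f + n2 g.
Proof.
move=> sf sg; rewrite -ler_sqr ?nnegrE ?addr_ge0 ?n2_ge0//.
have if2 := intble_sqr sf; have ig2 := intble_sqr sg.
have ifg := intbleM sf sg.
have -> : n2 (fun z => f z + g z) ^+ 2 =
    n2 f ^+ 2 + 2 * \int[mu]_z (f z * g z) + n2 g ^+ 2.
  rewrite !sqr_n2 -(intZ _ ifg).
  rewrite -intD; [|exact: if2|exact: intbleZ].
  rewrite -intD; [|apply: intbleD => //; exact: intbleZ|exact: ig2].
  by apply: eq_int => z; ring.
have := le_trans (ler_norm _) (cauchy_schwarz sf sg).
by move: (n2 f) (n2 g) (\int[mu]_z _) => a b c; nra.
Qed.

Lemma n2Z (k : R) f : sqint f -> n2 (fun z => k * f z) = `|k| * n2 f.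
Proof.
move=> sf; rewrite /n2; under eq_int do rewrite exprMn.
by rewrite intZ; [rewrite sqrtrM ?sqr_ge0// sqrtr_sqr|exact: intble_sqr].
Qed.

Lemma le_n2 f g : measurable_fun setT f -> sqint g ->
  (forall z, `|f z| <= `|g z|) -> n2 f <= n2 g.
Proof.
move=> mf sg fg; rewrite ler_wsqrtr//; apply: le_int.
- by apply: intble_sqr; exact: le_sqint sg.
- exact: intble_sqr.
- move=> z; rewrite -[f z ^+ 2]ger0_norm ?sqr_ge0// -[g z ^+ 2]ger0_norm ?sqr_ge0//.
  by rewrite !normrX lerXn2r ?nnegrE.
Qed.

Lemma n2_bounded_mull w f (M : R) : 0 <= M -> measurable_fun setT w ->
  (forall z, `|w z| <= M) -> sqint f -> n2 (fun z => w z * f z) <= M * n2 f.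
Proof.
move=> M0 mw wM sf.
rewrite -[X in X * _]ger0_norm// -n2Z//; apply: le_n2.
- by apply: measurable_funM => //; case: sf.
- exact: sqintZ.
- by move=> z; rewrite !normrM ler_wpM2r// (le_trans (wM z))// ler_norm.
Qed.

Lemma n2N f : n2 (fun z => - f z) = n2 f.
Proof. by rewrite /n2; under eq_int do rewrite sqrrN. Qed.

End square_integrable.

(** * Measure-preserving maps *)

Section measure_preserving.
Context d (T : measurableType d) (R : realType).
Variable mu : {measure set T -> \bar R}.
Implicit Types (phi : T -> T) (f : T -> R).

Definition measure_preserving phi := measurable_fun setT phi /\
  forall A, measurable A -> mu (phi @^-1` A) = mu A.

Lemma mp_ge0_integral phi (f : T -> \bar R) : measure_preserving phi ->
  measurable_fun setT f -> (forall z, (0 <= f z)%E) ->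
  (\int[mu]_z f (phi z) = \int[mu]_z f z)%E.
Proof.
move=> [mphi phiE] mf f0.
pose m : {measure set T -> \bar R} :=
  measure_function_pushforward__canonical__measure_function_Measure mu mphi.
have -> : (\int[mu]_z f z = \int[m]_z f z)%E.
  by apply: eq_measure_integral => A mA _; exact/esym/phiE.
by rewrite (ge0_integral_pushforward mphi).
Qed.

(** Positive and negative parts are transported separately as extended integrals, so the identity
    holds for every measurable [f]. *)
Lemma mp_int phi f : measure_preserving phi -> measurable_fun setT f ->
  \int[mu]_z f (phi z) = \int[mu]_z f z.
Proof.
move=> mp mf; congr fine; rewrite integralE [RHS]integralE.
have mf' : measurable_fun setT (EFin \o f) by exact/measurable_EFinP.
have mp' := measurable_funepos mf'; have mn' := measurable_funeneg mf'.
rewrite -(mp_ge0_integral mp mp'); last by move=> z; exact: funepos_ge0.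
rewrite -(mp_ge0_integral mp mn'); last by move=> z; exact: funeneg_ge0.
by congr (_ - _)%E; apply: eq_integral => z _; rewrite ?funeposE ?funenegE.
Qed.

Lemma mp_measurable phi f : measure_preserving phi -> measurable_fun setT f ->
  measurable_fun setT (fun z => f (phi z)).
Proof. by move=> [mphi _] mf; exact: measurableT_comp. Qed.

Lemma mp_intble phi f : measure_preserving phi -> intble mu f ->
  intble mu (fun z => f (phi z)).
Proof.
move=> mp /intbleP[mf oo]; apply/intbleP; split; first exact: mp_measurable.
rewrite (@mp_ge0_integral phi (fun z => `|f z|%:E))//.
by apply/measurable_EFinP; exact: measurableT_comp.
Qed.

Lemma mp_sqint phi f : measure_preserving phi -> sqint mu f ->
  sqint mu (fun z => f (phi z)).
Proof.
move=> mp /sqintP[mf sf]; apply/sqintP; split; first exact: mp_measurable.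
exact: (mp_intble mp sf).
Qed.

Lemma mp_n2 phi f : measure_preserving phi -> measurable_fun setT f ->
  n2 mu (fun z => f (phi z)) = n2 mu f.
Proof.
move=> mp mf; rewrite /n2 (mp_int (f := fun z => f z ^+ 2) mp)//.
exact: measurable_funX.
Qed.

End measure_preserving.

(** * Lebesgue measure on the plane: symmetries, Tonelli and Fubini *)

Section plane.
Context (R : realType).
Notation leb1 := (@lebesgue_measure R).

Definition shift2 (v : R * R) (z : plane R) : plane R := (z.1 + v.1, z.2 + v.2).
Definition swap2 (z : plane R) : plane R := (z.2, z.1).

(** The image measure gives half-open intervals their length, which characterises Lebesgue
    measure. *)
Lemma shift1_measure_preserving (c : R) :
  measure_preserving leb1 (fun x : measurableTypeR R => (x + c : measurableTypeR R)).
Proof.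
have mc : measurable_fun setT (fun x : measurableTypeR R => (x + c : measurableTypeR R)).
  exact: measurable_funD.
split=> // A mA.
pose m : {measure set (measurableTypeR R) -> \bar R} :=
  measure_function_pushforward__canonical__measure_function_Measure leb1 mc.
apply/esym/(@lebesgue_measure_unique R m) => //.
move=> X [[a b] _ <-] /=; rewrite /pushforward/=.
have -> : (fun x => x + c) @^-1` `]a, b]%classic = `]a - c, b - c]%classic.
  by apply/seteqP; split => x /=; rewrite !in_itv/= ltrBlDr lerBrDr.
rewrite !lebesgue_measure_itv/= !lte_fin ltrD2r; case: ifPn => // _.
by rewrite -!EFinD; congr (_%:E); ring.
Qed.

Lemma reflect1_measure_preserving (c : R) :
  measure_preserving leb1 (fun x : measurableTypeR R => (c - x : measurableTypeR R)).
Proof.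
have mc : measurable_fun setT (fun x : measurableTypeR R => (c - x : measurableTypeR R)).
  exact: measurable_funB.
split=> // A mA.
pose m : {measure set (measurableTypeR R) -> \bar R} :=
  measure_function_pushforward__canonical__measure_function_Measure leb1 mc.
apply/esym/(@lebesgue_measure_unique R m) => //.
move=> X [[a b] _ <-] /=; rewrite /pushforward/=.
have -> : (fun x => c - x) @^-1` `]a, b]%classic = `[c - b, c - a[%classic.
  by apply/seteqP; split => x /=; rewrite !in_itv/= lerBlDl -lerBlDr ltrBrDl -ltrBrDr andbC.
rewrite !lebesgue_measure_itv/= !lte_fin ltrD2l ltrN2; case: ifPn => // _.
by rewrite -!EFinD; congr (_%:E); ring.
Qed.

(** Serves to compare the average of a function over the square z - [0, 1]^2 with its integral over
    the plane. *)
Lemma reflect2_measure_preserving (v : plane R) :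
  measure_preserving (leb2 R) (fun z : plane R => (v.1 - z.1, v.2 - z.2) : plane R).
Proof.
have mv : measurable_fun setT (fun z : plane R => (v.1 - z.1, v.2 - z.2) : plane R).
  by apply/measurable_fun_pairP; split; apply: measurable_funB.
split=> // A mA.
pose m : {measure set (plane R) -> \bar R} :=
  measure_function_pushforward__canonical__measure_function_Measure (leb2 R) mv.
apply/esym/(@product_measure_unique _ _ _ _ _ leb1 leb1 m) => //.
move=> B C mB mC.
have [m1 E1] := reflect1_measure_preserving v.1.
have [m2 E2] := reflect1_measure_preserving v.2.
suff : leb2 R (((fun x => v.1 - x) @^-1` B) `*` ((fun x => v.2 - x) @^-1` C)) =
  (leb1 B * leb1 C)%E by [].
apply: etrans (product_measure1E _ _ _ _) _.
- by rewrite -[X in measurable X]setTI; exact: m1.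
- by rewrite -[X in measurable X]setTI; exact: m2.
- by congr (_ * _)%E; [exact: E1|exact: E2].
Qed.

Lemma shift2_measure_preserving v : measure_preserving (leb2 R) (shift2 v).
Proof.
have mv : measurable_fun setT (shift2 v).
  by apply/measurable_fun_pairP; split; apply: measurable_funD.
split=> // A mA.
pose m : {measure set (plane R) -> \bar R} :=
  measure_function_pushforward__canonical__measure_function_Measure (leb2 R) mv.
apply/esym/(@product_measure_unique _ _ _ _ _ leb1 leb1 m) => //.
move=> B C mB mC.
have [m1 E1] := shift1_measure_preserving v.1.
have [m2 E2] := shift1_measure_preserving v.2.
suff : leb2 R (((fun x => x + v.1) @^-1` B) `*` ((fun x => x + v.2) @^-1` C)) =
  (leb1 B * leb1 C)%E by [].
apply: etrans (product_measure1E _ _ _ _) _.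
- by rewrite -[X in measurable X]setTI; exact: m1.
- by rewrite -[X in measurable X]setTI; exact: m2.
- by congr (_ * _)%E; [exact: E1|exact: E2].
Qed.

(** Reduces statements on y-derivatives to statements on x-derivatives. *)
Lemma swap2_measure_preserving : measure_preserving (leb2 R) swap2.
Proof.
have mv : measurable_fun setT swap2 by apply/measurable_fun_pairP; split;
  [exact: measurable_snd|exact: measurable_fst].
split=> // A mA.
pose m : {measure set (plane R) -> \bar R} :=
  measure_function_pushforward__canonical__measure_function_Measure (leb2 R) mv.
apply/esym/(@product_measure_unique _ _ _ _ _ leb1 leb1 m) => //.
move=> B C mB mC.
have E : swap2 @^-1` (B `*` C) = C `*` B.
  by apply/seteqP; split=> -[x y] /= [? ?]; split.
rewrite [LHS](_ : _ = leb2 R (swap2 @^-1` (B `*` C)))// E.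
by apply: etrans (product_measure1E _ _ _ _) _ => //; rewrite muleC.
Qed.

Lemma sigma_finite_leb2 : sigma_finite setT (leb2 R).
Proof.
have /sigma_finiteP[F [TF ndF Foo]] := sigma_finiteT leb1.
exists (fun n => F n `*` F n).
  rewrite -setXTT TF predeqE => -[x y]; split=> [[[n _ Fx] [k _ Fy]]|].
    exists (maxn n k) => //; split.
    - by have /subsetPset := ndF _ _ (leq_maxl n k); apply.
    - by have /subsetPset := ndF _ _ (leq_maxr n k); apply.
  by move=> [n _ []/= ? ?]; split; exists n.
move=> k; have [mFk Fkoo] := Foo k; split; first exact: measurableX.
apply: (@le_lt_trans _ _ (leb1 (F k) * leb1 (F k))%E).
  by rewrite -(product_measure1E _ _ mFk mFk).
by rewrite lte_mul_pinfty// ge0_fin_numE.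
Qed.

(** A copy of [leb2] carrying the sigma-finite structure that Tonelli and Fubini require for the
    product of the plane with the line. *)
Let leb2s : set (plane R) -> \bar R := (leb1 \x leb1)%E.
HB.instance Definition _ := Measure.on leb2s.
HB.instance Definition _ := Measure_isSigmaFinite.Build _ _ R leb2s sigma_finite_leb2.
Let leb2_sigma_finite : {sigma_finite_measure set (plane R) -> \bar R} := leb2s.

Lemma leb2_tonelli (f : plane R * measurableTypeR R -> \bar R) :
  measurable_fun setT f -> (forall z, (0 <= f z)%E) ->
  (\int[leb2 R]_z \int[leb1]_r f (z, r) =
   \int[leb1]_r \int[leb2 R]_z f (z, r))%E.
Proof. exact: (@fubini_tonelli _ _ _ _ _ leb2_sigma_finite leb1). Qed.

Lemma leb2_tonelli_measurableF (f : plane R * measurableTypeR R -> \bar R) :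
  measurable_fun setT f -> (forall z, (0 <= f z)%E) ->
  measurable_fun setT (fun z => \int[leb1]_r f (z, r))%E.
Proof. exact: (@measurable_fun_fubini_tonelli_F _ _ _ _ _ leb1). Qed.

Lemma leb2_tonelli_measurableG (f : plane R * measurableTypeR R -> \bar R) :
  measurable_fun setT f -> (forall z, (0 <= f z)%E) ->
  measurable_fun setT (fun r => \int[leb2 R]_z f (z, r))%E.
Proof. exact: (@measurable_fun_fubini_tonelli_G _ _ _ _ _ leb2_sigma_finite). Qed.

Lemma leb2_fubini (f : plane R * measurableTypeR R -> R) :
  measurable_fun setT f ->
  (\int[leb1]_r \int[leb2 R]_z `|f (z, r)|%:E < +oo)%E ->
  \int[leb2 R]_z \int[leb1]_r f (z, r) =
  \int[leb1]_r \int[leb2 R]_z f (z, r).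
Proof.
move=> mf oo.
have If : ((leb2_sigma_finite \x leb1)%E).-integrable setT (EFin \o f).
  by apply/integrable21ltyP => //; exact/measurable_EFinP.
(* The real inner integral agrees with the extended one where the section is integrable, that is for
   almost every z. *)
have FE : (\int[leb2 R]_z (\int[leb1]_r f (z, r))%:E =
    \int[leb2 R]_z \int[leb1]_r (f (z, r))%:E)%E.
  apply: ae_eq_integral => //.
  - apply/measurable_EFinP; apply: (measurableT_comp (fine_measurable measurableT) (measurable_fubini_F If)).
  - exact: (measurable_fubini_F If).
  - apply: filterS (ae_integrable1 If) => z Iz _.
    by rewrite EFin_Rintegral.
have GE : (\int[leb1]_r (\int[leb2 R]_z f (z, r))%:E =
    \int[leb1]_r \int[leb2 R]_z (f (z, r))%:E)%E.
  apply: ae_eq_integral => //.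
  - apply/measurable_EFinP; apply: (measurableT_comp (fine_measurable measurableT) (measurable_fubini_G If)).
  - exact: (measurable_fubini_G If).
  - apply: filterS (ae_integrable2 If) => z Iz _.
    by rewrite EFin_Rintegral.
rewrite [LHS]/Rintegral [RHS]/Rintegral; congr fine.
rewrite [LHS]FE [RHS]GE; exact: (Fubini If).
Qed.

End plane.

(** * Bump functions *)

Section smooth_functions.
Context (R : realType).
Implicit Types (f g : R -> R) (x : R).

Lemma is_deriveD_fun f g x a b : is_derive x 1 f a -> is_derive x 1 g b ->
  is_derive x 1 (fun t => f t + g t) (a + b).
Proof. by move=> df dg; exact: (is_deriveD df dg). Qed.

Lemma is_deriveN_fun f x a : is_derive x 1 f a ->
  is_derive x 1 (fun t => - f t) (- a).
Proof. by move=> df; exact: is_deriveN. Qed.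

Lemma is_deriveM_fun f g x a b : is_derive x 1 f a -> is_derive x 1 g b ->
  is_derive x 1 (fun t => f t * g t) (a * g x + f x * b).
Proof.
move=> df dg; apply: is_derive_eq (is_deriveM df dg) _.
by rewrite addrC; congr (_ + _); exact: mulrC.
Qed.

Lemma is_derive_comp_fun f g x a b :
  is_derive x 1 f a -> is_derive (f x) 1 g b ->
  is_derive x 1 (fun t => g (f t)) (b * a).
Proof.
move=> [df fE] [dg gE]; split.
  by apply/derivable1_diffP/differentiable_comp; exact/derivable1_diffP.
have := derive1_comp df dg.
by rewrite !derive1E fE gE.
Qed.

Lemma is_derive_affine (a b x : R) : is_derive x 1 (fun t => a * t + b) a.
Proof.
have -> : (fun t : R => a * t + b) = (fun t => cst a t * id t + cst b t).
  by apply/funext.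
have := is_deriveD_fun (is_deriveM_fun (is_derive_cst a x 1) (is_derive_id x 1))
  (is_derive_cst b x 1).
by move=> H; apply: is_derive_eq H _; rewrite mul0r add0r mulr1 addr0.
Qed.

(** A finite order allows induction through the product and chain rules; [smooth_upto n] asks for n
    + 1 successive derivatives. *)
Fixpoint smooth_upto (n : nat) f : Prop :=
  (forall x, derivable f x 1) /\
  if n is m.+1 then smooth_upto m (derive1 f) else True.

Definition smooth f := forall n, smooth_upto n f.

Lemma is_derive_derive1 f f' : (forall x, is_derive x 1 f (f' x)) -> derive1 f = f'.
Proof.
by move=> df; apply/funext => x; rewrite derive1E; apply: derive_val; exact: df.
Qed.

Lemma derivable_is_derive1 f x : derivable f x 1 -> is_derive x 1 f ((derive1 f) x).
Proof. by move=> df; rewrite derive1E; exact: DeriveDef. Qed.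

Lemma smooth_uptoS n f f' : (forall x, is_derive x 1 f (f' x)) ->
  smooth_upto n f' -> smooth_upto n.+1 f.
Proof.
move=> df sf'; split; first by move=> x; case: (df x).
by rewrite (is_derive_derive1 df).
Qed.

Lemma smooth_uptoW n f : smooth_upto n.+1 f -> smooth_upto n f.
Proof.
elim: n f => [f [df _]|n IH f [df sf]]; first by split.
by split => //; exact: IH.
Qed.

Lemma smooth_is_derive n f : smooth_upto n f ->
  forall x, is_derive x 1 f ((derive1 f) x).
Proof. by case: n => [|n] [df _] x; exact: derivable_is_derive1. Qed.

Lemma smooth_upto_cst n (c : R) : smooth_upto n (fun=> c).
Proof.
elim: n c => [|n IH] c; first by split => // x; exact: derivable_cst.
exact: (@smooth_uptoS _ _ (fun=> 0) (fun x => is_derive_cst c x 1) (IH 0)).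
Qed.

Lemma smooth_uptoD n f g : smooth_upto n f -> smooth_upto n g ->
  smooth_upto n (fun x => f x + g x).
Proof.
elim: n f g => [|n IH] f g sf sg.
  by split => // x; case: sf sg => df _ [dg _]; exact: derivableD.
apply: (@smooth_uptoS _ _ (fun x => derive1 f x + derive1 g x)).
  by move=> x; exact: (is_deriveD_fun (smooth_is_derive sf x) (smooth_is_derive sg x)).
by case: sf sg => _ sf [_ sg]; exact: IH.
Qed.

Lemma smooth_uptoM n f g : smooth_upto n f -> smooth_upto n g ->
  smooth_upto n (fun x => f x * g x).
Proof.
elim: n f g => [|n IH] f g sf sg.
  by split => // x; case: sf sg => df _ [dg _]; exact: derivableM.
apply: (@smooth_uptoS _ _ (fun x => derive1 f x * g x + f x * derive1 g x)).
  by move=> x; exact: (is_deriveM_fun (smooth_is_derive sf x) (smooth_is_derive sg x)).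
have [sf0 sg0] := (smooth_uptoW sf, smooth_uptoW sg).
by case: sf sg => _ sf [_ sg]; apply: smooth_uptoD; exact: IH.
Qed.

Lemma smooth_upto_affine n f (a b : R) : smooth_upto n f ->
  smooth_upto n (fun x => f (a * x + b)).
Proof.
elim: n f => [|n IH] f sf.
  split => // x; have := is_derive_comp_fun (is_derive_affine a b x)
    (smooth_is_derive sf (a * x + b)).
  by case.
apply: (@smooth_uptoS _ _ (fun x => derive1 f (a * x + b) * a)).
  move=> x; exact: (is_derive_comp_fun (is_derive_affine a b x)
    (smooth_is_derive sf (a * x + b))).
case: sf => _ sf; apply: smooth_uptoM; first exact: IH.
exact: smooth_upto_cst.
Qed.

Lemma smooth_derive1 f : smooth f -> smooth (derive1 f).
Proof. by move=> sf n; have [] := sf n.+1. Qed.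

Lemma smooth_continuous f : smooth f -> continuous f.
Proof.
move=> sf x; apply/differentiable_continuous/derivable1_diffP.
by have [] := sf 0%N.
Qed.

(* The factor [p.[1 / x]] makes the class closed under differentiation. *)
Definition flat_exp (p : {poly R}) x :=
  if 0 < x then p.[x^-1] * expR (- x^-1) else 0.

Lemma poly_expR_bound (p : {poly R}) :
  exists C, forall y, 1 <= y -> `|p.[y]| * expR (- y) <= C.
Proof.
elim/poly_ind: p => [|p c [C HC]].
  by exists 0 => y _; rewrite horner0 normr0 mul0r.
have [n [K HK]] : exists n K, forall y : R, 1 <= y -> `|p.[y]| <= K * y ^+ n.
  elim/poly_ind: p {C HC} => [|p d [n [K HK]]].
    by exists 0%N, 0 => y _; rewrite horner0 normr0 mul0r.
  exists n.+1, (K + `|d|) => y y1; rewrite !hornerE.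
  rewrite (le_trans (ler_normD _ _))// mulrDl lerD//.
    rewrite normrM exprSr mulrA (ger0_norm (le_trans ler01 y1)).
    by rewrite ler_wpM2r ?HK// (le_trans ler01).
  by rewrite ler_peMr// exprn_ege1.
have K0 : 0 <= K.
  by have := HK 1 (lexx _); rewrite expr1n mulr1; apply: le_trans.
(* By e^y >= 1 + y^(n+1) / (n+1)!, the product y^(n+1) e^(-y) is at most (n+1)!. *)
exists (K * n.+1`!%:R + `|c|) => y y1.
have y0 : 0 <= y by rewrite (le_trans ler01).
rewrite !hornerE (le_trans (ler_wpM2r (expR_ge0 _) (ler_normD _ _)))//.
rewrite mulrDl lerD//; last first.
  by rewrite ler_piMr// expR_le1 oppr_le0.
rewrite normrM (ger0_norm y0).
apply: (@le_trans _ _ (K * y ^+ n.+1 * expR (- y))).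
  by rewrite ler_wpM2r ?expR_ge0// exprSr mulrA ler_wpM2r// HK.
rewrite -mulrA ler_wpM2l// expRN ler_pdivrMr ?expR_gt0//.
have := expR_ge1Dxn n y0.
have f0 : 0 < n.+1`!%:R :> R by rewrite ltr0n fact_gt0.
move=> h; rewrite -ler_pdivrMl//; apply: le_trans h.
by rewrite mulrC lerDr.
Qed.

(** With y = 1/x, the derivative of p(y) e^(-y) in x is y^2 (p - p')(y) e^(-y). Only x = 0 requires
    a limit. *)
Lemma is_derive_flat_exp (p : {poly R}) x :
  is_derive x 1 (flat_exp p) (flat_exp ('X^2 * (p - p^`())) x).
Proof.
have [x0|x0|->] := ltgtP x 0.
- rewrite /flat_exp [in X in is_derive _ _ _ X]ltNge (ltW x0)/=.
  apply: near_eq_is_derive (is_derive_cst (0 : R) x 1).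
  near=> t; case: ifPn => // t0; exfalso; move: t0; apply/negP.
  by rewrite -leNgt ltW//; near: t; exact: lt_nbhsl.
- rewrite /flat_exp [in X in is_derive _ _ _ X]x0.
  have dV : is_derive x 1 (fun t : R => t^-1) (- x ^- 2).
    have := @is_deriveV _ id x 1 1; rewrite /GRing.scale/= mulr1.
    by apply; rewrite gt_eqF.
  have dN : is_derive x 1 (fun t : R => - t^-1) (x ^- 2).
    by have H := is_deriveN dV; apply: is_derive_eq H _; rewrite opprK.
  have d1 := is_derive_comp_fun dV (is_derive_poly p x^-1).
  have d2 := is_derive_comp_fun dN (is_derive_expR (- x^-1)).
  have d3 := is_deriveM_fun d1 d2.
  apply: near_eq_is_derive (is_derive_eq d3 _).
    near=> t; case: ifPn => // t0; exfalso; move: t0; apply/negP; rewrite negbK.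
    by near: t; exact: lt_nbhsr.
  by rewrite hornerM hornerXn hornerD hornerN exprVn; ring.
- rewrite {2}/flat_exp ltxx.
  (* For h > 0 the difference quotient at 0 is h times y^2 p(y) e^(-y) with y = 1/h, hence at most C
     h in absolute value. *)
  have [C HC] := poly_expR_bound ('X^2 * p).
  have C0 : 0 <= C.
    by apply: le_trans (HC 1 (lexx _)); rewrite mulr_ge0 ?expR_ge0.
  have cv : h^-1 *: (flat_exp p (h *: (1 : R) + 0) - flat_exp p 0)
      @[h --> 0^'] --> (0 : R).
    apply/cvgr0Pnorm_le => e e0; near=> h.
    rewrite addr0 [h *: 1]mulr1 {2}/flat_exp ltxx subr0.
    rewrite /flat_exp; case: ifPn => h0; last by rewrite scaler0 normr0 ltW.
    have h1 : 1 <= h^-1.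
      rewrite invf_ge1//; apply: le_trans (ler_norm _) _.
      by near: h; exact: dnbhs0_le.
    have /= := HC _ h1; rewrite hornerM hornerXn normrM normrX.
    rewrite (gtr0_norm (_ : 0 < h^-1)) ?invr_gt0// => Hb.
    rewrite /GRing.scale/= normrM normrM (ger0_norm (expR_ge0 _)).
    rewrite ger0_norm ?invr_ge0 ?ltW//.
    apply: (@le_lt_trans _ _ (C * h)); last first.
      have : h <= e / (C + 1).
        apply: le_trans (ler_norm _) _; near: h; apply: dnbhs0_le.
        by rewrite divr_gt0// ltr_wpDl.
      rewrite ler_pdivlMr ?ltr_wpDl// => /(lt_le_trans _); apply.
      by rewrite mulrC ltr_pM2l// ltrDl.
    rewrite -ler_pdivrMr//; apply: le_trans Hb; rewrite expr2.
    by rewrite le_eqVlt; apply/orP; left; apply/eqP; ring.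
  split; first by apply/cvg_ex; exists 0.
  exact/cvg_lim.
Unshelve. all: by end_near. Qed.

Lemma smooth_flat_exp (p : {poly R}) : smooth (flat_exp p).
Proof.
move=> n; elim: n p => [|n IH] p.
  by split => // x; have [] := is_derive_flat_exp p x.
exact: smooth_uptoS (is_derive_flat_exp p) (IH _).
Qed.

Definition bump_fun f := smooth f /\ exists M : R, forall x, M <= `|x| -> f x = 0.

Lemma bump_derive1 f : bump_fun f -> bump_fun (derive1 f).
Proof.
move=> [sf [M HM]]; split; first exact: smooth_derive1.
exists (M + 1) => x Mx; rewrite derive1E (@near_eq_derive _ _ _ f (cst 0)).
  by rewrite derive_cst.
near=> y; apply: HM.
have xy1 : `|x - y| <= 1 by near: y; exact: cvgr_dist_le.
have := lerB_dist x y; move: xy1 Mx; lra.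
Unshelve. all: by end_near. Qed.

Lemma bump_shift f (h : R) : bump_fun f -> bump_fun (fun x => f (x - h)).
Proof.
move=> [sf [M HM]]; split=> [n|].
  have := smooth_upto_affine 1 (- h) (sf n).
  by under eq_fun do rewrite mul1r.
exists (M + `|h|) => x; rewrite -lerBrDr => H; apply: HM; apply: le_trans H _.
exact: lerB_dist.
Qed.

Lemma bump_continuous f : bump_fun f -> continuous f.
Proof. by move=> [/smooth_continuous]. Qed.

Lemma bump_measurable f : bump_fun f -> measurable_fun [set: measurableTypeR R] f.
Proof. by move=> /bump_continuous; exact: continuous_measurable_fun. Qed.

Lemma bump_bounded f : bump_fun f -> exists2 K : R, 0 <= K & forall x, `|f x| <= K.
Proof.
move=> bf; have [_ [M HM]] := bf.
have cf : {within `[- M, M], continuous f}.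
  by apply: continuous_subspaceT; exact: bump_continuous.
have [N [_ HN]] := compact_bounded (continuous_compact cf (@segment_compact _ _ _)).
exists (`|N| + 1) => [|x]; first by rewrite addr_ge0.
have [Mx|xM] := leP M `|x|; first by rewrite HM// normr0 addr_ge0.
apply: (HN (`|N| + 1)); first by rewrite (le_lt_trans (ler_norm _))// ltrDl.
by exists x => //=; rewrite in_itv/= -ler_norml ltW.
Qed.

Lemma bump_intble f : bump_fun f -> intble (@lebesgue_measure R) f.
Proof.
move=> bf; have [_ [M HM]] := bf.
have : (@lebesgue_measure R).-integrable `[- M, M] (EFin \o f).
  apply: continuous_compact_integrable; first exact: segment_compact.
  by apply: continuous_subspaceT; exact: bump_continuous.
move=> /integrable_mkcond; rewrite (_ : _ \_ _ = EFin \o f); first by apply.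
apply/funext => x; rewrite patchE; case: ifPn => //=.
rewrite notin_setE/= in_itv/= -ler_norml => /negP; rewrite -ltNge => /ltW /HM ->.
by [].
Qed.

Lemma bump_primitive f : bump_fun f -> exists P, forall x, is_derive x 1 P (f x).
Proof.
move=> bf; exists (fun x => \int[@lebesgue_measure R]_(t in `]-oo, x]) f t) => x.
have xu : x < x + 1 by rewrite ltrDl.
have If : (@lebesgue_measure R).-integrable `]-oo, x + 1] (EFin \o f).
  exact: integrableS (bump_intble bf).
have cf : {for x, continuous f} by exact: bump_continuous.
have [d <-] := continuous_FTC1 xu If (ltNyr x) cf.
exact: derivable_is_derive1.
Qed.

(* Testing a weak derivative against [window h f] produces the increment over a
   segment of length [h]. *)
Definition window (h : R) f x := \int[@lebesgue_measure R]_(r in `[0, h]) f (x - r).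

(** For a primitive P of [f], the window is P(x) - P(x - h); unlike P, this difference has compact
    support. *)
Lemma is_derive_window (h : R) f x : 0 < h -> bump_fun f ->
  is_derive x 1 (window h f) (f x - f (x - h)).
Proof.
move=> h0 bf; have [P dP] := bump_primitive bf.
have dPa (y r : R) : is_derive r 1 (fun t => - P (y - t)) (f (y - r)).
  have H := is_derive_comp_fun (is_derive_affine (-1) y r) (dP (-1 * r + y)).
  have := is_deriveN_fun H; rewrite mulrN1 opprK mulN1r [- r + y]addrC.
  by under [X in is_derive _ _ X _]eq_fun do rewrite mulN1r [- _ + y]addrC.
have -> : window h f = (fun y => P y - P (y - h)).
  apply/funext => y; rewrite /window /Rintegral.
  rewrite (@continuous_FTC2 _ _ (fun t => - P (y - t)))//=.
  - by rewrite subr0 opprK addrC.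
  - apply: continuous_subspaceT => r; apply: continuous_comp.
      by apply: cvgB; [exact: cvg_cst|exact: cvg_id].
    exact: bump_continuous.
  - have dd r : derivable (fun t => - P (y - t)) r 1 by have [] := dPa y r.
    have cc r : {for r, continuous (fun t => - P (y - t))}.
      exact/differentiable_continuous/derivable1_diffP.
    split => //; first exact: cvg_at_right_filter (cc 0).
    exact: cvg_at_left_filter (cc h).
  - by move=> r _; rewrite derive1E; apply: derive_val; exact: dPa.
have := is_deriveN_fun (is_derive_comp_fun (is_derive_affine 1 (- h) x) (dP (1 * x - h))).
rewrite mulr1 mul1r => H2.
have := is_deriveD_fun (dP x) H2.
by under [X in is_derive _ _ X _]eq_fun do rewrite mul1r.
Qed.

Lemma bump_window (h : R) f : 0 < h -> bump_fun f -> bump_fun (window h f).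
Proof.
move=> h0 bf; have dw x := is_derive_window x h0 bf.
have [sf [M HM]] := bf; split=> [n|].
  have [sg _] := bump_shift h bf.
  apply/smooth_uptoW/(smooth_uptoS dw)/smooth_uptoD => //.
  have := smooth_uptoM (smooth_upto_cst n (-1)) (sg n).
  by under eq_fun do rewrite mulN1r.
exists (M + h) => x Mx; rewrite /window -[RHS](Rintegral_set0 (@lebesgue_measure R) f).
rewrite Rintegral_set0 /Rintegral integral0_eq// => r /=.
rewrite in_itv/= => /andP[r0 rh]; congr EFin; apply: HM.
move: Mx; rewrite -lerBrDr => /le_trans; apply.
apply: le_trans (lerB_dist _ _); rewrite lerB// ger0_norm//.
Qed.

(** Each factor is e^(-1/((n+1) y)) for y > 0 and 0 otherwise, with y = x - a or b - x, so the
    product tends to the indicator of ]a, b[. *)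
Definition plateau (a b : R) (n : nat) x : R :=
  flat_exp 1 (n.+1%:R * (x - a)) * flat_exp 1 (n.+1%:R * (b - x)).

Lemma flat_exp1_ge0 x : 0 <= flat_exp 1 x <= 1.
Proof.
rewrite /flat_exp; case: ifPn => [x0|_]; last by rewrite lexx ler01.
rewrite hornerC mul1r expR_ge0/= -expR0 ler_expR oppr_le0.
by rewrite invr_ge0 ltW.
Qed.

Lemma plateau_ge0 a b n x : 0 <= plateau a b n x <= 1.
Proof.
have /andP[? ?] := flat_exp1_ge0 (n.+1%:R * (x - a)).
have /andP[? ?] := flat_exp1_ge0 (n.+1%:R * (b - x)).
by rewrite mulr_ge0//= mulr_ile1.
Qed.

Lemma bump_plateau a b n : bump_fun (plateau a b n).
Proof.
split=> [m|].
  apply: smooth_uptoM.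
    have := smooth_upto_affine n.+1%:R (- (n.+1%:R * a)) (smooth_flat_exp 1 m).
    by under eq_fun do rewrite -mulrBr.
  have := smooth_upto_affine (- n.+1%:R) (n.+1%:R * b) (smooth_flat_exp 1 m).
  by under eq_fun do rewrite addrC mulNr -mulrBr.
exists (`|a| + `|b|) => x abx; rewrite /plateau /flat_exp !pmulr_rgt0 ?ltr0n//.
case: ifPn => [xa|_]; last by rewrite mul0r.
case: ifPn => [bx|_]; last by rewrite mulr0.
exfalso; move: abx xa bx; rewrite !subr_gt0.
have := ler_norm b; have := ler_norm (- a); rewrite normrN.
have := normr_ge0 a; have := normr_ge0 b.
have [x0|x0] := leP 0 x; [rewrite (ger0_norm x0)|rewrite (ltr0_norm x0)]; lra.
Qed.

Lemma flat_exp1_cvg x :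
  flat_exp 1 (n.+1%:R * x) @[n --> \oo] --> (((0 < x)%R : nat)%:R : R).
Proof.
have [x0|x0] := ltP 0 x; last first.
  apply: cvg_near_cst; apply: nearW => n.
  by rewrite /flat_exp pmulr_rgt0 ?ltr0n// ltNge x0.
rewrite (_ : (fun _ => _) = (fun n => expR (- (x^-1 * n.+1%:R^-1)))); last first.
  apply/funext => n; rewrite /flat_exp pmulr_rgt0 ?ltr0n// x0 hornerC mul1r.
  by rewrite invfM mulrC.
rewrite -[X in _ --> X](_ : expR (- (x^-1 * 0)) = _); last first.
  by rewrite mulr0 oppr0 expR0.
apply: continuous_cvg; first exact: continuous_expR.
apply: cvgN; apply: cvgM; first exact: cvg_cst.
exact: cvg_harmonic.
Qed.

Lemma plateau_cvg a b x :
  plateau a b n x @[n --> \oo] --> (\1_(`]a, b[) x : R).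
Proof.
have := cvgM (@flat_exp1_cvg (x - a)) (@flat_exp1_cvg (b - x)).
rewrite !subr_gt0 -natrM mulnb => H.
have -> : \1_(`]a, b[) x = ((a < x) && (x < b) : nat)%:R :> R; last exact: H.
rewrite indicE; congr (nat_of_bool _)%:R.
by apply/idP/idP; rewrite inE/= in_itv.
Qed.

End smooth_functions.

(** * Products of one-variable bump functions as test functions *)

Section tensor_test_functions.
Context (R : realType).
Implicit Types (f g : R -> R).

Definition tensor f g (z : R * R) : R := f z.1 * g z.2.

Lemma differentiable_tensor f g z : (forall x, derivable f x 1) ->
  (forall x, derivable g x 1) -> differentiable (tensor f g) z.
Proof.
move=> df dg.
have cfst : continuous (@fst R^o R^o) by move=> ?; exact: cvg_fst.
have csnd : continuous (@snd R^o R^o) by move=> ?; exact: cvg_snd.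
have fst_diff : differentiable (fst : R * R -> R) z.
  exact: (@linear_differentiable R (R^o * R^o)%type R^o (@fst R^o R^o) z cfst).
have snd_diff : differentiable (snd : R * R -> R) z.
  exact: (@linear_differentiable R (R^o * R^o)%type R^o (@snd R^o R^o) z csnd).
apply: differentiableM.
  by apply: (differentiable_comp fst_diff); exact/derivable1_diffP.
by apply: (differentiable_comp snd_diff); exact/derivable1_diffP.
Qed.

Lemma derive_tensor1 f g z : (forall x, derivable f x 1) ->
  'D_((1, 0) : R * R) (tensor f g) z = derive1 f z.1 * g z.2.
Proof.
move=> df; transitivity ('D_1 (fun t => f t * g z.2) z.1).
  rewrite /derive; set d := (fun h : R => _); set d' := (fun h : R => _).
  suff -> : d = d' by [].
  by apply/funext => h; rewrite /d /d' /tensor /= /GRing.scale/= mulr0 add0r.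
have := is_deriveM_fun (derivable_is_derive1 (df z.1)) (is_derive_cst (g z.2) z.1 1).
by move=> [_ ->]; rewrite mulr0 addr0.
Qed.

Lemma derive_tensor2 f g z : (forall x, derivable g x 1) ->
  'D_((0, 1) : R * R) (tensor f g) z = f z.1 * derive1 g z.2.
Proof.
move=> dg; transitivity ('D_1 (fun t => f z.1 * g t) z.2).
  rewrite /derive; set d := (fun h : R => _); set d' := (fun h : R => _).
  suff -> : d = d' by [].
  by apply/funext => h; rewrite /d /d' /tensor /= /GRing.scale/= mulr0 add0r.
have := is_deriveM_fun (is_derive_cst (f z.1) z.2 1) (derivable_is_derive1 (dg z.2)).
by move=> [_ ->]; rewrite mul0r add0r.
Qed.

Lemma smooth_derivable f x : smooth f -> derivable f x 1.
Proof. by move=> /(_ 0%N)[]. Qed.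

Lemma smooth_derive1n n f : smooth f -> smooth (iter n (@derive1 R R) f).
Proof. by move=> sf; elim: n => //= n; exact: smooth_derive1. Qed.

Lemma pderiv_tensor a b f g : smooth f -> smooth g ->
  pderiv a b (tensor f g) =
  tensor (iter a (@derive1 R R) f) (iter b (@derive1 R R) g).
Proof.
move=> sf sg; rewrite /pderiv.
have -> : iter b (fun psi z => 'D_((0, 1) : R * R) psi z) (tensor f g) =
    tensor f (iter b (@derive1 R R) g).
  elim: b => //= b ->; apply/funext => z; rewrite derive_tensor2// => x.
  exact/smooth_derivable/smooth_derive1n.
elim: a => //= a ->; apply/funext => z; rewrite derive_tensor1// => x.
exact/smooth_derivable/smooth_derive1n.
Qed.

Lemma test_function_tensor f g : bump_fun f -> bump_fun g -> test_function (tensor f g).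
Proof.
move=> [sf [M HM]] [sg [N HN]]; split=> [a b z|].
  rewrite pderiv_tensor//; apply: differentiable_tensor => x;
  exact/smooth_derivable/smooth_derive1n.
have cK : compact ((`[- M, M] `*` `[- N, N]) : set (R * R)).
  by apply: compact_setX; exact: segment_compact.
have /closure_id clK := compact_closed (@norm_hausdorff R (R * R)%type) cK.
apply: (subclosed_compact _ cK); first exact: closed_closure.
rewrite [X in _ `<=` X]clK; apply: closureS => -[x y].
rewrite /tensor/= mulf_eq0 negb_or => /andP[fx gy].
rewrite !in_itv/= -!ler_norml; split.
  by rewrite leNgt; apply: contra fx => /ltW /HM ->.
by rewrite leNgt; apply: contra gy => /ltW /HN ->.
Qed.

Lemma measurable_tensor f g : bump_fun f -> bump_fun g ->
  measurable_fun [set: plane R] (tensor f g).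
Proof.
move=> bf bg; apply: measurable_funM.
  exact: measurableT_comp (bump_measurable bf) measurable_fst.
exact: measurableT_comp (bump_measurable bg) measurable_snd.
Qed.

End tensor_test_functions.

(** * Functions determined by their integrals over rectangles *)

Section density_measure.
Context d (T : measurableType d) (R : realType).
Variables (mu : {measure set T -> \bar R}) (f : T -> \bar R).
Hypotheses (mf : measurable_fun setT f) (f0 : forall z, (0 <= f z)%E).

(** The proofs of measurability and positivity are arguments so that the measure structure can be
    attached to the resulting set function. *)
Definition density_measure of measurable_fun setT f & (forall z, (0 <= f z)%E) :=
  fun A : set T => (\int[mu]_(z in A) f z)%E.

Let density0 : density_measure mf f0 set0 = 0%E.
Proof. by rewrite /density_measure integral_set0. Qed.

Let density_ge0 A : (0 <= density_measure mf f0 A)%E.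
Proof. by rewrite /density_measure integral_ge0. Qed.

Let density_sigma_additive : semi_sigma_additive (density_measure mf f0).
Proof.
move=> /= F mF tF mUF; rewrite /density_measure; apply: cvg_toP.
  apply: ereal_nondecreasing_is_cvgn => m n mn.
  by apply: lee_sum_nneg_natr => // k _ _; exact: integral_ge0.
by rewrite ge0_integral_bigcup//; exact: measurable_funTS.
Qed.

HB.instance Definition _ := isMeasure.Build _ _ _
  (density_measure mf f0) density0 density_ge0 density_sigma_additive.

End density_measure.

Section rectangles.
Context (R : realType).

Definition rectangle (p : (R * R) * (R * R)) : set (plane R) :=
  `]p.1.1, p.1.2] `*` `]p.2.1, p.2.2].

Definition rectangles : set (set (plane R)) := range rectangle.

Lemma measurable_rectangle p : measurable (rectangle p).
Proof. by apply: measurableX; exact: measurable_itv. Qed.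

Lemma rectangles_setI : setI_closed rectangles.
Proof.
have itvI (a b c e : R) : `]a, b]%classic `&` `]c, e]%classic =
    `]Num.max a c, Num.min b e]%classic.
  apply/seteqP; split=> x /=; rewrite !in_itv/= gt_max le_min.
    by move=> [/andP[-> ->] /andP[-> ->]].
  by move=> /andP[/andP[-> ->] /andP[-> ->]].
move=> _ _ [p _ <-] [q _ <-]; rewrite /rectangle -setXI !itvI.
by exists ((Num.max p.1.1 q.1.1, Num.min p.1.2 q.1.2),
  (Num.max p.2.1 q.2.1, Num.min p.2.2 q.2.2)).
Qed.

Definition square (n : nat) : set (plane R) :=
  rectangle ((- n%:R, n%:R), (- n%:R, n%:R)).

Lemma le_nat_itv (x : R) (n : nat) : `|x| < n%:R -> `]- n%:R, n%:R]%classic x.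
Proof. by rewrite ltr_norml /= in_itv/= => /andP[-> /ltW]. Qed.

Lemma bigcup_square : \bigcup_n square n = setT.
Proof.
apply/seteqP; split=> // -[x y] _; have H :=
  archi_boundP (addr_ge0 (normr_ge0 x) (normr_ge0 y)).
exists (Num.bound (`|x| + `|y|)) => //; split; apply: le_nat_itv; apply: le_lt_trans H.
  by rewrite lerDl.
by rewrite lerDr.
Qed.

(** Both coordinates are measurable for the generated sigma-algebra, because a strip is a countable
    union of truncated rectangles. *)
Lemma measurable_rectangles : @measurable _ (plane R) `<=` <<s rectangles >>.
Proof.
pose GT := g_sigma_algebraType rectangles.
have mfst : measurable_fun setT (fst : GT -> measurableTypeR R).
  apply: (@measurability _ _ GT _ _ _ (@ocitv R)) => // _ [_ [[a b] _ <-] <-].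
  rewrite setTI (_ : _ @^-1` _ = \bigcup_n rectangle ((a, b), (- n%:R, n%:R))).
    by apply: bigcup_measurable => n _; apply: sub_sigma_algebra; eexists.
  apply/seteqP; split=> [[x y]/= xab|[x y] [n _] []//].
  exists (Num.bound `|y|) => //; split => //.
  exact/le_nat_itv/archi_boundP.
have msnd : measurable_fun setT (snd : GT -> measurableTypeR R).
  apply: (@measurability _ _ GT _ _ _ (@ocitv R)) => // _ [_ [[a b] _ <-] <-].
  rewrite setTI (_ : _ @^-1` _ = \bigcup_n rectangle ((- n%:R, n%:R), (a, b))).
    by apply: bigcup_measurable => n _; apply: sub_sigma_algebra; eexists.
  apply/seteqP; split=> [[x y]/= xab|[x y] [n _] []//].
  exists (Num.bound `|x|) => //; split => //.
  exact/le_nat_itv/archi_boundP.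
rewrite measurable_prod_measurableType.
apply: smallest_sub; first exact: smallest_sigma_algebra.
move=> _ [A mA [B mB <-]].
have -> : A `*` B = (setT `&` fst @^-1` A) `&` (setT `&` snd @^-1` B).
  by rewrite !setTI.
by apply: (@measurableI _ GT); [exact: mfst|exact: msnd].
Qed.

(** The positive and negative parts of [h] are the densities of two measures that agree on
    rectangles, an intersection-stable generating class, hence everywhere. On the set where [h] is
    positive the second measure vanishes, so the first one does too, and symmetrically. *)
Lemma rectangle_int0_ae0 (h : plane R -> R) :
  (forall p, (leb2 R).-integrable (rectangle p) (EFin \o h)) ->
  measurable_fun setT h ->
  (forall p, (\int[leb2 R]_(z in rectangle p) (h z)%:E = 0)%E) ->
  {ae leb2 R, forall z, h z = 0}.
Proof.
move=> ih mh h0; have mh' : measurable_fun setT (EFin \o h) by exact/measurable_EFinP.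
pose mp : {measure set (plane R) -> \bar R} := density_measure (leb2 R)
  (measurable_funepos mh') (funepos_ge0 (EFin \o h)).
pose mn : {measure set (plane R) -> \bar R} := density_measure (leb2 R)
  (measurable_funeneg mh') (funeneg_ge0 (EFin \o h)).
have mpn A : measurable A -> mp A = mn A.
  move=> /measurable_rectangles; apply: (@g_sigma_algebra_measure_unique _ _ _ rectangles _ square).
  - by move=> _ [p _ <-]; exact: measurable_rectangle.
  - by move=> n; eexists.
  - exact: bigcup_square.
  - exact: rectangles_setI.
  - move=> _ [p _ <-]; have := h0 p; rewrite integralE.
    have := integrable_fin_num (measurable_rectangle p) (integrable_funepos (measurable_rectangle p) (ih p)).
    have := integrable_fin_num (measurable_rectangle p) (integrable_funeneg (measurable_rectangle p) (ih p)).
    rewrite /mp /mn /= /density_measure.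
    move=> /fineK <- /fineK <-; rewrite -EFinB => -[/eqP].
    by rewrite subr_eq0 => /eqP ->.
  - move=> n; apply: integrable_lty; first exact: measurable_rectangle.
    exact: (integrable_funepos (measurable_rectangle _) (ih ((- n%:R, n%:R), (- n%:R, n%:R)))).
have E1 : (\int[leb2 R]_z ((EFin \o h)^\+ z) = 0)%E.
  have mA : measurable [set z | 0 < h z].
    rewrite -[X in measurable X]setTI (_ : [set z | _] = h @^-1` `]0, +oo[).
      by apply: mh => //; exact: measurable_itv.
    by apply/seteqP; split=> z /=; rewrite in_itv/= andbT.
  transitivity (mn [set z | 0 < h z]).
    rewrite -mpn// /mp/= /density_measure/= [RHS]integral_mkcond.
    apply: eq_integral => z _; rewrite patchE funeposE/=.
    case: ifPn => //; rewrite notin_setE/= => /negP; rewrite -leNgt => hz.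
    by rewrite max_r// lee_fin.
  apply: integral0_eq => z /= hz; rewrite funenegE/= max_r//.
  by rewrite lee_fin oppr_le0 ltW.
have E2 : (\int[leb2 R]_z ((EFin \o h)^\- z) = 0)%E.
  have mA : measurable [set z | h z < 0].
    rewrite -[X in measurable X]setTI (_ : [set z | _] = h @^-1` `]-oo, 0[).
      by apply: mh => //; exact: measurable_itv.
    by apply/seteqP; split=> z /=; rewrite in_itv/=.
  transitivity (mp [set z | h z < 0]).
    rewrite mpn// /mn/= /density_measure/= [RHS]integral_mkcond.
    apply: eq_integral => z _; rewrite patchE funenegE/=.
    case: ifPn => //; rewrite notin_setE/= => /negP; rewrite -leNgt => hz.
    by rewrite max_r// lee_fin oppr_le0.
  apply: integral0_eq => z /= hz; rewrite funeposE/= max_r//.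
  by rewrite lee_fin ltW.
have : (\int[leb2 R]_z `|(EFin \o h) z| = 0)%E.
  rewrite -[X in integral _ _ X]/(abse \o (EFin \o h)) fune_abse ge0_integralD//.
  - by rewrite E1 E2 adde0.
  - exact: measurable_funepos.
  - exact: measurable_funeneg.
move/(ae_eq_integral_abs _ measurableT mh'); apply: filterS => z.
by move=> /(_ I) /= [].
Qed.

Lemma indic_rectangle p z : \1_(rectangle p) z =
  \1_`]p.1.1, p.1.2] z.1 * \1_`]p.2.1, p.2.2] z.2 :> R.
Proof.
rewrite !indicE -natrM mulnb; congr (nat_of_bool _)%:R.
apply/idP/idP => [/set_mem[? ?]|/andP[/set_mem ? /set_mem ?]].
  by apply/andP; split; exact/mem_set.
by apply/mem_set.
Qed.

Lemma leb2_rectangle_lty p : (leb2 R (rectangle p) < +oo)%E.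
Proof.
rewrite /leb2 [X in (X < _)%E](_ : _ =
  (lebesgue_measure `]p.1.1, p.1.2]%classic * lebesgue_measure `]p.2.1, p.2.2]%classic)%E);
  last by apply: product_measure1E; exact: measurable_itv.
by rewrite !lebesgue_measure_itv/=; case: ifP; case: ifP;
  rewrite ?mul0e ?mule0 ?ltry// -EFinM ltry.
Qed.

Lemma sqint_rectangle p : sqint (leb2 R) (\1_(rectangle p) : plane R -> R).
Proof.
split; first by apply: measurable_indic; exact: measurable_rectangle.
rewrite (_ : (fun z => _) = (fun z => (\1_(rectangle p) z)%:E)); last first.
  by apply/funext => z; rewrite indicE -natrX; case: (z \in _).
by rewrite integral_indic//= ?setIT ?leb2_rectangle_lty//; exact: measurable_rectangle.
Qed.

(* Converges pointwise to the indicator of ]a, b]. *)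
Definition ocplateau (a b : R) n x := plateau a (b + 1) n x - plateau b (b + 1) n x.

Lemma plateau0 a b n (x : R) : x \notin `]a, b[ -> plateau a b n x = 0.
Proof.
rewrite in_itv/= negb_and -!leNgt /plateau /flat_exp !pmulr_rgt0 ?ltr0n// !subr_gt0.
by move=> /orP[|]; rewrite leNgt => /negbTE ->; rewrite ?mul0r ?mulr0.
Qed.

Lemma bump_ocplateau a b n : bump_fun (ocplateau a b n).
Proof.
have [sa [M HM]] := bump_plateau a (b + 1) n.
have [sb [N HN]] := bump_plateau b (b + 1) n.
split=> [m|].
  apply: smooth_uptoD => //; under eq_fun do rewrite -mulN1r.
  exact/smooth_uptoM/sb/smooth_upto_cst.
exists (Num.max M N) => x; rewrite ge_max => /andP[Mx Nx].
by rewrite /ocplateau HM// HN// subrr.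
Qed.

Lemma abs_ocplateau a b n x : a < b ->
  `|ocplateau a b n x| <= \1_(`]a, b + 1]) x :> R.
Proof.
move=> ab; rewrite indicE; case: (boolP (x \in _)) => [_|]; rewrite ?inE/=.
  have := plateau_ge0 a (b + 1) n x; have := plateau_ge0 b (b + 1) n x.
  by rewrite /ocplateau ler_norml; lra.
rewrite notin_setE/= => /negP xab; rewrite /ocplateau !plateau0 ?subrr ?normr0//.
  by apply: contra xab; rewrite !in_itv/= => /andP[/(lt_trans ab) -> /ltW].
by apply: contra xab; rewrite !in_itv/= => /andP[-> /ltW].
Qed.

Lemma ocplateau_cvg a b x : a < b ->
  ocplateau a b n x @[n --> \oo] --> (\1_(`]a, b]) x : R).
Proof.
move=> ab; rewrite (_ : \1_`]a, b] x = \1_`]a, b + 1[ x - \1_`]b, b + 1[ x :> R).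
  by apply: cvgB; exact: plateau_cvg.
rewrite !indicE !mem_setE !in_itv/=.
have [bx|xb] := ltP b x; first by rewrite (lt_trans ab bx) subrr.
by rewrite (le_lt_trans xb) ?ltrDl// !andbT subr0.
Qed.

Lemma sqint_tensor f g : bump_fun f -> bump_fun g -> sqint (leb2 R) (tensor f g).
Proof.
move=> bf bg; have [K K0 HK] := bump_bounded bf; have [L L0 HL] := bump_bounded bg.
have [[_ [M HM]] [_ [N HN]]] := (bf, bg).
pose p := ((- (`|M| + 1), `|M| + 1), (- (`|N| + 1), `|N| + 1)).
apply: (le_sqint _ _ (sqintZ (K * L) (sqint_rectangle p))).
  exact: measurable_tensor.
have out (A x : R) : x \notin `](- (`|A| + 1)), (`|A| + 1)] -> A <= `|x|.
  apply: contraR; rewrite -ltNge => xA; have := ler_norm A; have := normr_ge0 A.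
  by move: xA; rewrite in_itv/= ltr_norml => /andP[]; lra.
move=> -[x y]; rewrite /tensor/= indicE; case: (boolP (_ \in _)) => /= [_|].
  by rewrite mulr1 normrM [leRHS]ger0_norm ?mulr_ge0// ler_pM.
rewrite notin_setE /rectangle/= => /not_andP[] /negP /out; first by move/HM->;
  rewrite mul0r normr0.
by move/HN->; rewrite mulr0 normr0.
Qed.

(** Products of [ocplateau] converge to the indicator of a rectangle. Dominated convergence, with
    |h| on the rectangle enlarged by 1 as majorant, reduces the claim to integrals over
    rectangles. *)
Lemma tensor_ae0 (h : plane R -> R) : sqint (leb2 R) h ->
  (forall f g, bump_fun f -> bump_fun g ->
    \int[leb2 R]_z (h z * tensor f g z) = 0) ->
  {ae leb2 R, forall z, h z = 0}.
Proof.
move=> sh h0; have mh : measurable_fun setT h by case: sh.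
have ih p : (leb2 R).-integrable (rectangle p) (EFin \o h).
  apply/integrable_mkcond; first exact: measurable_rectangle.
  have := intbleM sh (sqint_rectangle p); congr integrable.
  apply/funext => z /=; rewrite patchE indicE.
  by case: ifPn => _; rewrite ?mulr1 ?mulr0.
apply: rectangle_int0_ae0 => // -[[a b] [c e]].
have [ab|ba] := ltP a b; last first.
  by rewrite /rectangle/= set_itv_ge ?set0X ?integral_set0// bnd_simp -leNgt.
have [ce|ec] := ltP c e; last first.
  by rewrite /rectangle/= [X in _ `*` X]set_itv_ge ?setX0 ?integral_set0// bnd_simp -leNgt.
pose F n z := (h z * tensor (ocplateau a b n) (ocplateau c e n) z)%:E.
pose G z := (`|h z| * \1_(rectangle ((a, b + 1), (c, e + 1))) z)%:E.
have iF n : (\int[leb2 R]_z F n z = 0)%E.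
  rewrite -EFin_Rintegral ?h0//; try exact: bump_ocplateau.
  by apply: intbleM => //; apply: sqint_tensor; exact: bump_ocplateau.
have mF n : measurable_fun setT (F n).
  apply/measurable_EFinP/measurable_funM => //.
  by apply: measurable_tensor; exact: bump_ocplateau.
have mP : measurable_fun setT (fun z => (h z * \1_(rectangle ((a, b), (c, e))) z)%:E).
  apply/measurable_EFinP/measurable_funM => //.
  by apply: measurable_indic; exact: measurable_rectangle.
have iG : (leb2 R).-integrable setT G.
  have := intble_abs (intbleM sh (sqint_rectangle ((a, b + 1), (c, e + 1)))).
  congr integrable; apply/funext => z; rewrite /G /= normrM; congr (_ * _)%:E.
  by rewrite ger0_norm// indicE.
have cvgF : {ae leb2 R, forall z, setT z ->
    F ^~ z @ \oo --> (h z * \1_(rectangle ((a, b), (c, e))) z)%:E}.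
  apply: aeW => -[x y] _; apply: cvg_EFin; first by apply: nearW.
  apply: cvgM; first exact: cvg_cst.
  rewrite indic_rectangle/=.
  by apply: cvgM; exact: ocplateau_cvg.
have domF : {ae leb2 R, forall z n, setT z -> (`|F n z| <= G z)%E}.
  apply: aeW => -[x y] n _; rewrite /F /G /= lee_fin normrM ler_wpM2l//.
  rewrite indic_rectangle/=.
  by rewrite /tensor/= normrM ler_pM// abs_ocplateau.
have [_ _] := @dominated_convergence _ _ _ (leb2 R) setT measurableT F _ G mF mP cvgF iG domF.
under eq_fun do rewrite iF.
move=> /cvg_lim => /(_ (@ereal_hausdorff _)); rewrite lim_cst//.
move=> E; rewrite integral_mkcond E; apply: eq_integral => z _.
by rewrite patchE indicE; case: ifPn => _; rewrite ?mulr1 ?mulr0.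
Qed.

End rectangles.

(** * Integrals along segments and their L^2 norms *)

Section segment_average.
Context (R : realType).
Notation leb1 := (@lebesgue_measure R).
Implicit Types (F : plane R * measurableTypeR R -> R) (h c : R).

Definition segint h F (z : plane R) : R := \int[leb1]_r (F (z, r) * \1_`[0, h] r).

Definition cut h F (p : plane R * measurableTypeR R) := F p * \1_`[0, h] p.2.

Lemma measurable_cut h F : measurable_fun setT F -> measurable_fun setT (cut h F).
Proof.
move=> mF; apply: measurable_funM => //.
apply: measurableT_comp; last exact: measurable_snd.
by apply: measurable_indic; exact: measurable_itv.
Qed.

Lemma measurable_segint h F : measurable_fun setT F ->
  measurable_fun setT (segint h F).
Proof.
move=> mF; have /measurable_EFinP mf := measurable_cut h mF.
apply: (measurableT_comp (fine_measurable measurableT)).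
have -> : (fun z => \int[leb1]_r (F (z, r) * \1_`[0, h] r)%:E)%E =
    (fun z => \int[leb1]_r (EFin \o cut h F)^\+ (z, r) -
              \int[leb1]_r (EFin \o cut h F)^\- (z, r))%E.
  apply/funext => z; rewrite integralE; congr (_ - _)%E;
  by apply: eq_integral => r _; rewrite ?funeposE ?funenegE.
apply: emeasurable_funB.
  exact: (@leb2_tonelli_measurableF _ _ (measurable_funepos mf) (funepos_ge0 _)).
exact: (@leb2_tonelli_measurableF _ _ (measurable_funeneg mf) (funeneg_ge0 _)).
Qed.

Lemma sqint_itv h : 0 <= h -> sqint leb1 (\1_`[0, h] : R -> R) /\
  n2 leb1 (\1_`[0, h]) ^+ 2 = h.
Proof.
move=> h0.
have E : (fun r : R => (\1_`[0, h] r : R) ^+ 2) = \1_`[0, h].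
  by apply/funext => z; rewrite indicE -natrX; case: (z \in _).
have I : (\int[leb1]_r (\1_`[0, h] r)%:E = h%:E)%E.
  rewrite integral_indic//= ?setIT//.
  rewrite lebesgue_measure_itv/= lte_fin; case: ltP => [_|]; first by rewrite sube0.
  by move=> h0'; congr EFin; apply/eqP; rewrite eq_le h0 h0'.
split; last by rewrite sqr_n2 E /Rintegral I.
split; first by apply: measurable_indic; exact: measurable_itv.
by move/funeqP : E => E; under eq_integral do rewrite E; rewrite I ltry.
Qed.

(** Cauchy-Schwarz in r against the indicator of [0, h], whose squared norm is h; the bound is
    trivial when the right-hand integral is infinite. *)
Lemma sqr_segint_le h F z : 0 < h -> measurable_fun setT F ->
  ((segint h F z ^+ 2)%:E <=
   h%:E * \int[leb1]_r (cut h F (z, r) ^+ 2)%:E)%E.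
Proof.
move=> h0 mF; have [si ni] := sqint_itv (ltW h0).
have mFz : measurable_fun setT (fun r => cut h F (z, r)).
  exact: measurableT_comp (measurable_cut h mF) (pair1_measurable z).
have [oo|] := ltP (\int[leb1]_r (cut h F (z, r) ^+ 2)%:E)%E +oo%E.
  have sf : sqint leb1 (fun r => cut h F (z, r)) by split.
  have := cauchy_schwarz sf si.
  have -> : \int[leb1]_r (cut h F (z, r) * \1_`[0, h] r) = segint h F z.
    apply: eq_int => r; rewrite /cut/= -mulrA; congr (_ * _).
    by rewrite indicE -natrM; case: (r \in _).
  rewrite -(ler_sqr (normr_ge0 _)) ?nnegrE ?mulr_ge0 ?n2_ge0//.
  rewrite real_normK ?num_real// exprMn ni sqr_n2 mulrC => H.
  apply: (@le_trans _ _ (h * \int[leb1]_r (cut h F (z, r) ^+ 2))%:E).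
    by rewrite lee_fin.
  by rewrite EFinM EFin_Rintegral//; exact: intble_sqr.
by rewrite leye_eq => /eqP ->; rewrite gt0_muley ?lte_fin// leey.
Qed.

Lemma int_cut_sqr_le h c F : 0 < h -> 0 <= c -> measurable_fun setT F ->
  (forall r, 0 <= r <= h -> sqint (leb2 R) (fun z => F (z, r)) /\
     n2 (leb2 R) (fun z => F (z, r)) <= c) ->
  (\int[leb2 R]_z \int[leb1]_r (cut h F (z, r) ^+ 2)%:E <= (h * c ^+ 2)%:E)%E.
Proof.
move=> h0 c0 mF HF.
have mc2 : measurable_fun setT (fun p => (cut h F p ^+ 2)%:E).
  by apply/measurable_EFinP; apply: measurable_funX; exact: measurable_cut.
have c20 p : (0 <= (cut h F p ^+ 2)%:E)%E by rewrite lee_fin sqr_ge0.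
have mI : measurable_fun setT (fun r : measurableTypeR R => (\1_`[0, h] r : R)%:E).
  by apply/measurable_EFinP; apply: measurable_indic; exact: measurable_itv.
have I0 r : setT r -> (0 <= (\1_`[0, h] r : R)%:E)%E by rewrite lee_fin.
have c20' : (0 <= (c ^+ 2)%:E)%E by rewrite lee_fin sqr_ge0.
rewrite (leb2_tonelli mc2 c20).
apply: (@le_trans _ _ (\int[leb1]_r ((c ^+ 2)%:E * (\1_`[0, h] r)%:E))%E).
  apply: ge0_le_integral => //.
  - by move=> r _; exact: integral_ge0.
  - exact: (leb2_tonelli_measurableG mc2 c20).
  - exact: measurable_funeM.
  - move=> r _; rewrite /cut/= indicE; case: (boolP (r \in _)) => /= [|_].
      rewrite inE/= in_itv/= => rh; have [sF nF] := HF r rh.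
      under eq_integral do rewrite mulr1.
      rewrite mule1 -EFin_Rintegral; last exact: intble_sqr.
      by rewrite -sqr_n2 lee_fin lerXn2r ?nnegrE ?n2_ge0.
    by rewrite mule0 integral0_eq// => z _; rewrite mulr0 expr0n.
rewrite (ge0_integralZl _ measurableT mI I0 c20').
rewrite integral_indic//= ?setIT// lebesgue_measure_itv/= lte_fin h0 sube0.
by rewrite -!EFinM lee_fin mulrC.
Qed.

(** A form of Minkowski's integral inequality: in the squared norm, one factor h comes from
    Cauchy-Schwarz in r and the other from Tonelli. *)
Lemma n2_segint h c F : 0 < h -> 0 <= c -> measurable_fun setT F ->
  (forall r, 0 <= r <= h -> sqint (leb2 R) (fun z => F (z, r)) /\
     n2 (leb2 R) (fun z => F (z, r)) <= c) ->
  sqint (leb2 R) (segint h F) /\ n2 (leb2 R) (segint h F) <= h * c.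
Proof.
move=> h0 c0 mF HF.
have mc2 : measurable_fun setT (fun p => (cut h F p ^+ 2)%:E).
  by apply/measurable_EFinP; apply: measurable_funX; exact: measurable_cut.
have c20 p : (0 <= (cut h F p ^+ 2)%:E)%E by rewrite lee_fin sqr_ge0.
have mS := measurable_segint h mF.
have H : (\int[leb2 R]_z (segint h F z ^+ 2)%:E <= ((h * c) ^+ 2)%:E)%E.
  apply: (@le_trans _ _ (\int[leb2 R]_z (h%:E * \int[leb1]_r (cut h F (z, r) ^+ 2)%:E))%E).
    apply: ge0_le_integral => //.
    - by move=> z _; rewrite lee_fin sqr_ge0.
    - exact/measurable_EFinP/measurable_funX.
    - by apply: measurable_funeM; exact: (leb2_tonelli_measurableF mc2 c20).
    - by move=> z _; exact: sqr_segint_le.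
  rewrite ge0_integralZl//; last 3 first.
    exact: (leb2_tonelli_measurableF mc2 c20).
    by move=> z _; exact: integral_ge0.
    by rewrite lee_fin ltW.
  rewrite exprMn expr2 -mulrA EFinM lee_pmul//; first by rewrite lee_fin ltW.
    by apply: integral_ge0 => z _; exact: integral_ge0.
  exact: int_cut_sqr_le.
have sS : sqint (leb2 R) (segint h F).
  by split=> //; rewrite (le_lt_trans H)// ltry.
split=> //; rewrite -ler_sqr ?nnegrE ?n2_ge0 ?mulr_ge0 ?(ltW h0)//.
by rewrite sqr_n2 -lee_fin EFin_Rintegral//; exact: intble_sqr.
Qed.

(** Needed to split the inner integral of a difference: almost every section is square integrable on
    [0, h], hence integrable there. *)
Lemma ae_intble_segint h c F : 0 < h -> 0 <= c -> measurable_fun setT F ->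
  (forall r, 0 <= r <= h -> sqint (leb2 R) (fun z => F (z, r)) /\
     n2 (leb2 R) (fun z => F (z, r)) <= c) ->
  {ae leb2 R, forall z, intble leb1 (fun r => F (z, r) * \1_`[0, h] r)}.
Proof.
move=> h0 c0 mF HF.
have mc2 : measurable_fun setT (fun p => (cut h F p ^+ 2)%:E).
  by apply/measurable_EFinP; apply: measurable_funX; exact: measurable_cut.
have c20 p : (0 <= (cut h F p ^+ 2)%:E)%E by rewrite lee_fin sqr_ge0.
have [si ni] := sqint_itv (ltW h0).
have Hint : (leb2 R).-integrable setT (fun z => \int[leb1]_r (cut h F (z, r) ^+ 2)%:E)%E.
  apply/integrableP; split; first exact: (leb2_tonelli_measurableF mc2 c20).
  under eq_integral do rewrite gee0_abs ?integral_ge0//.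
  by rewrite (le_lt_trans (int_cut_sqr_le h0 c0 mF HF))// ltry.
apply: filterS (integrable_ae measurableT Hint) => z /(_ I) fz.
have sf : sqint leb1 (fun r => cut h F (z, r)).
  split; first exact: measurableT_comp (measurable_cut h mF) (pair1_measurable z).
  by rewrite ltey_eq fz.
have := intbleM sf si; congr intble; apply/funext => r.
by rewrite /cut/= -mulrA indicE -natrM; case: (r \in _).
Qed.

End segment_average.

(** * Translations and the adjoint of integration along a segment *)

Section weak_derivative_segment.
Context (R : realType).
Notation leb1 := (@lebesgue_measure R).
Notation leb2 := (leb2 R).
Implicit Types (f g : plane R -> R) (e : R * R).

Definition slide e (h : R) : plane R -> plane R := shift2 (h * e.1, h * e.2).

Lemma mp_slide e h : measure_preserving leb2 (slide e h).
Proof. exact: shift2_measure_preserving. Qed.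

Lemma slideN e h z : slide e h (slide e (- h) z) = z.
Proof. by case: z => x y; rewrite /slide /shift2/= !mulNr !subrK. Qed.

Lemma int_slide_mul e h f g : measurable_fun setT f -> measurable_fun setT g ->
  \int[leb2]_z (f (slide e h z) * g z) = \int[leb2]_z (f z * g (slide e (- h) z)).
Proof.
move=> mf mg.
rewrite -(mp_int (f := fun z => f (slide e h z) * g z) (mp_slide e (- h))).
  by apply: eq_int => z; rewrite slideN.
by apply: measurable_funM => //; exact: mp_measurable (mp_slide e h) mf.
Qed.

Definition shifted e g (p : plane R * measurableTypeR R) : R := g (slide e p.2 p.1).

Lemma measurable_shifted e g : measurable_fun setT g ->
  measurable_fun setT (shifted e g).
Proof.
move=> mg; apply: measurableT_comp mg _; apply/measurable_fun_pairP; split.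
  apply: measurable_funD; first exact: measurableT_comp measurable_fst measurable_fst.
  by apply: measurable_funM => //; exact: measurable_snd.
apply: measurable_funD; first exact: measurableT_comp measurable_snd measurable_fst.
by apply: measurable_funM => //; exact: measurable_snd.
Qed.

Lemma sqint_slide e h f : sqint leb2 f -> sqint leb2 (fun z => f (slide e h z)).
Proof. by move=> sf; exact: (mp_sqint (mp_slide e h) sf). Qed.

Lemma n2_slide e h f : measurable_fun setT f ->
  n2 leb2 (fun z => f (slide e h z)) = n2 leb2 f.
Proof. by move=> mf; exact: (mp_n2 (mp_slide e h) mf). Qed.

Lemma n2_segint_shifted e h g : 0 < h -> sqint leb2 g ->
  sqint leb2 (segint h (shifted e g)) /\
  n2 leb2 (segint h (shifted e g)) <= h * n2 leb2 g.
Proof.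
move=> h0 sg; apply: n2_segint => //; first exact: n2_ge0.
  by apply: measurable_shifted; case: sg.
move=> r _; split; first exact: sqint_slide.
by rewrite (n2_slide e r)//; case: sg.
Qed.

Lemma measurable_shifted_itv e g (s : R -> R) h (k : plane R -> R) :
  measurable_fun setT g -> measurable_fun [set: measurableTypeR R] s ->
  measurable_fun setT k ->
  measurable_fun setT (fun p : plane R * measurableTypeR R =>
    g (slide e (s p.2) p.1) * \1_`[0, h] p.2 * k p.1).
Proof.
move=> mg ms mk; apply: measurable_funM; last first.
  exact: measurableT_comp mk measurable_fst.
apply: measurable_funM; last first.
  apply: measurableT_comp measurable_snd.
  by apply: measurable_indic; exact: measurable_itv.
have mq : measurable_fun setT
    (fun p : plane R * measurableTypeR R => (p.1, s p.2) : plane R * measurableTypeR R).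
  apply/measurable_fun_pairP; split; first exact: measurable_fst.
  exact: measurableT_comp ms measurable_snd.
exact: (measurableT_comp (measurable_shifted e mg) mq).
Qed.

(** The absolute convergence that Fubini requires. In the applications [s] is r or - r, the two
    sides of the adjunction. *)
Lemma shifted_itv_lty e (s : R -> R) h f g : 0 < h ->
  measurable_fun [set: measurableTypeR R] s -> sqint leb2 f -> sqint leb2 g ->
  (\int[leb1]_r \int[leb2]_z
    `|f (slide e (s r) z) * \1_`[0, h] r * g z|%:E < +oo)%E.
Proof.
move=> h0 ms sf sg; have [mf mg] : measurable_fun setT f /\ measurable_fun setT g.
  by case: sf sg => ? _ [].
have abs_sq (k : plane R -> R) : sqint leb2 k -> sqint leb2 (fun z => `|k z|) /\
    n2 leb2 (fun z => `|k z|) = n2 leb2 k.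
  move=> sk; split; last by rewrite /n2; under eq_int do rewrite real_normK ?num_real//.
  apply: (le_sqint _ _ sk) => [|z]; last by rewrite normr_id.
  by apply: measurableT_comp => //; case: sk.
set C := n2 leb2 f * n2 leb2 g.
have C0 : 0 <= C by rewrite mulr_ge0 ?n2_ge0.
have mI : measurable_fun setT (fun r : measurableTypeR R => (\1_`[0, h] r : R)%:E).
  by apply/measurable_EFinP; apply: measurable_indic; exact: measurable_itv.
have I0 r : setT r -> (0 <= (\1_`[0, h] r : R)%:E)%E by rewrite lee_fin.
apply: (@le_lt_trans _ _ (\int[leb1]_r (C%:E * (\1_`[0, h] r)%:E))%E).
  apply: ge0_le_integral => //.
  - by move=> r _; exact: integral_ge0.
  - apply: (@leb2_tonelli_measurableG R
      (fun p => `|f (slide e (s p.2) p.1) * \1_`[0, h] p.2 * g p.1|%:E)) => //.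
    apply/measurable_EFinP; apply: measurableT_comp => //.
    exact: (measurable_shifted_itv e h mf ms mg).
  - exact: measurable_funeM.
  - move=> r _; rewrite indicE; case: (r \in _) => /=; last first.
      by rewrite mule0 integral0_eq// => z _; rewrite mulr0 mul0r normr0.
    have [sf' nf'] := abs_sq _ (sqint_slide e (s r) sf).
    have [sg' ng'] := abs_sq _ sg.
    under eq_integral do rewrite mulr1 normrM.
    rewrite -EFin_Rintegral; last exact: intbleM.
    rewrite mule1 lee_fin (le_trans (ler_norm _))//.
    by rewrite (le_trans (cauchy_schwarz sf' sg'))// nf' ng' n2_slide.
rewrite (ge0_integralZl _ measurableT mI I0) ?lee_fin//.
rewrite integral_indic//= ?setIT// lebesgue_measure_itv/= lte_fin h0 sube0.
by rewrite -EFinM ltry.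
Qed.

(** For c <> 0, [F] and its multiple by c fail to be integrable together, and a real integral that
    does not converge absolutely has the default value 0. *)
Lemma int_mulr (F : R -> R) (c : R) : measurable_fun [set: measurableTypeR R] F ->
  \int[leb1]_r (F r * c) = (\int[leb1]_r F r) * c.
Proof.
move=> mF; have [->|c0] := eqVneq c 0.
  by rewrite mulr0 /Rintegral integral0_eq// => r _; rewrite mulr0.
have [iF|niF] := pselect (intble leb1 F); first by rewrite RintegralZr.
have zero (G : R -> R) : measurable_fun [set: measurableTypeR R] G ->
    ~ intble leb1 G -> \int[leb1]_r G r = 0.
  move=> mG nG; rewrite /Rintegral.
  suff : ~~ ((\int[leb1]_r (G r)%:E)%E \is a fin_num) by case: (integral _ _ _).
  apply/negP => finG; apply: nG; apply/intbleP; split=> //.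
  rewrite (_ : (fun r => _) = (fun r => `|(G r)%:E|%E))//.
  by rewrite integral_fin_num_abs//; exact/measurable_EFinP.
rewrite [LHS]zero ?[X in X * _]zero ?mul0r//; first exact: measurable_funM.
move=> /(intbleZ c^-1); under [X in intble _ X]eq_fun do rewrite mulrC mulfK//.
exact: niF.
Qed.

(** By Fubini and translation invariance, the adjoint of integration along a segment in the
    direction e is integration in the direction - e. *)
Lemma int_segint_shifted e h g (k : plane R -> R) : 0 < h ->
  sqint leb2 g -> sqint leb2 k ->
  \int[leb2]_z (segint h (shifted e g) z * k z) =
  \int[leb2]_z (g z * segint h (fun p => k (slide e (- p.2) p.1)) z).
Proof.
move=> h0 sg sk; have [mg mk] : measurable_fun setT g /\ measurable_fun setT k.
  by case: sg sk => ? _ [].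
have mN : measurable_fun [set: measurableTypeR R] (fun r : R => - r) by exact: measurable_funN.
have section_measurable (f : plane R -> R) (s : R -> R) z : measurable_fun setT f ->
    measurable_fun [set: measurableTypeR R] s ->
    measurable_fun [set: measurableTypeR R] (fun r => f (slide e (s r) z) * \1_`[0, h] r).
  move=> mf ms.
  have := measurableT_comp (measurable_shifted_itv e h mf ms (@measurable_cst _ _ _ _ setT (1 : R))) (pair1_measurable z).
  by under eq_fun do rewrite /= mulr1.
transitivity (\int[leb1]_r \int[leb2]_z (g (slide e r z) * \1_`[0, h] r * k z)).
  rewrite -(leb2_fubini (f := fun p => shifted e g p * \1_`[0, h] p.2 * k p.1)).
  - by apply: eq_int => z; rewrite /segint -int_mulr//; exact: (section_measurable _ id).
  - exact: (measurable_shifted_itv e h mg (@measurable_id _ _ setT) mk).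
  - exact: (shifted_itv_lty e h0 (@measurable_id _ _ setT) sg sk).
transitivity (\int[leb1]_r \int[leb2]_z (k (slide e (- r) z) * \1_`[0, h] r * g z)).
  apply: eq_int => r.
  under eq_int do rewrite -mulrA.
  rewrite int_slide_mul//; last exact: measurable_funM.
  by apply: eq_int => z; ring.
rewrite -(leb2_fubini (f := fun p => k (slide e (- p.2) p.1) * \1_`[0, h] p.2 * g p.1)).
- by apply: eq_int => z; rewrite mulrC /segint -int_mulr//; exact: section_measurable.
- exact: (measurable_shifted_itv e h mk mN mg).
- exact: (shifted_itv_lty e h0 mN sk sg).
Qed.

End weak_derivative_segment.

(** * Weak derivatives and difference quotients *)

Section tensor_weak_derivative.
Context (R : realType).
Notation leb1 := (@lebesgue_measure R).
Notation leb2 := (leb2 R).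
Implicit Types (f g : plane R -> R) (e : R * R).

Definition ex : R * R := (1, 0).
Definition ey : R * R := (0, 1).

(* Weak derivatives tested against products of one-variable bump functions
   only: these already determine a square-integrable function. *)
Definition tderiv e f g := forall a b : R -> R, bump_fun a -> bump_fun b ->
  \int[leb2]_z (f z * (e.1 * tensor (derive1 a) b z + e.2 * tensor a (derive1 b) z)) =
  - \int[leb2]_z (g z * tensor a b z).

Definition segment_formula e f g := forall h, 0 < h ->
  {ae leb2, forall z, f (slide e h z) - f z = segint h (shifted e g) z}.

(** Tested against a(x) b(y), the increment of [f] gives minus the integral of f (window h a)' b,
    and the segment integral of [g] gives the integral of g (window h a) b. The weak derivative,
    tested on [window h a] and b, equates the two. *)
Lemma tderiv_segment_x f g : sqint leb2 f -> sqint leb2 g ->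
  tderiv ex f g -> segment_formula ex f g.
Proof.
move=> sf sg fg h h0.
have [mf mg] : measurable_fun setT f /\ measurable_fun setT g.
  by case: sf sg => ? _ [].
have [sG _] := n2_segint_shifted ex h0 sg.
have sfh := sqint_slide ex h sf.
suff : {ae leb2, forall z, f (slide ex h z) - f z - segint h (shifted ex g) z = 0}.
  by apply: filterS => z /eqP; rewrite subr_eq0 => /eqP.
apply: tensor_ae0 => [|a b ba bb].
  by apply: sqintB => //; exact: sqintB.
have sT := sqint_tensor ba bb.
have bw := bump_window h0 ba.
have dw : derive1 (window h a) = (fun x => a x - a (x - h)).
  by apply: is_derive_derive1 => x; exact: is_derive_window.
have sTs := sqint_tensor (bump_shift h ba) bb.
under eq_int do rewrite mulrBl mulrBl.
rewrite intB; [|apply: intbleB|]; try exact: intbleM.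
rewrite intB; try exact: intbleM.
have mT := measurable_tensor ba bb.
rewrite (int_slide_mul ex h mf mT) (int_segint_shifted ex h0 sg sT).
have -> : \int[leb2]_z (f z * tensor a b (slide ex (- h) z)) =
    \int[leb2]_z (f z * tensor (fun x => a (x - h)) b z).
  by apply: eq_int => z; rewrite /tensor /slide/shift2/= mulr1 mulr0 addr0.
have -> : \int[leb2]_z (g z * segint h (fun p => tensor a b (slide ex (- p.2) p.1)) z) =
    \int[leb2]_z (g z * tensor (window h a) b z).
  apply: eq_int => z; congr (_ * _); rewrite /segint /tensor /window/=.
  rewrite [X in _ = X * _]Rintegral_mkcond -int_mulr.
    apply: eq_int => r; rewrite mulr1 mulr0 addr0 patchE indicE.
    by case: ifPn => _; rewrite ?mulr1 ?mulr0 ?mul0r.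
  apply/(measurable_restrictT _ _).1; first exact: measurable_itv.
  apply: measurable_funTS; apply: (measurableT_comp (bump_measurable ba)).
  exact: measurable_funB.
have := fg _ _ bw bb; rewrite dw.
under eq_int do rewrite mul1r mul0r addr0.
rewrite (_ : (fun z => f z * tensor (fun x => a x - a (x - h)) b z) =
   (fun z => f z * tensor a b z - f z * tensor (fun x => a (x - h)) b z)); last first.
  by apply/funext => z; rewrite /tensor; ring.
rewrite intB; try exact: intbleM.
lra.
Qed.

Lemma tderiv_segment_y f g : sqint leb2 f -> sqint leb2 g ->
  tderiv ey f g -> segment_formula ey f g.
Proof.
have mpS := @swap2_measure_preserving R.
move=> sf sg fg h h0.
have [mf mg] : measurable_fun setT f /\ measurable_fun setT g.
  by case: sf sg => ? _ [].
have H : tderiv ex (fun z => f (swap2 z)) (fun z => g (swap2 z)).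
  move=> a b ba bb; have := fg _ _ bb ba.
  rewrite -(mp_int mpS); last first.
    apply: measurable_funM => //; apply: measurable_funD.
      by apply: measurable_funM => //; apply: measurable_tensor => //; exact: bump_derive1.
    by apply: measurable_funM => //; apply: measurable_tensor => //; exact: bump_derive1.
  rewrite -(mp_int (f := fun z => g z * tensor b a z) mpS); last first.
    by apply: measurable_funM => //; exact: measurable_tensor.
  move=> E; transitivity (\int[leb2]_z (f (swap2 z) * (0 * tensor (derive1 b) a (swap2 z) +
      1 * tensor b (derive1 a) (swap2 z)))).
    by apply: eq_int => z; rewrite /tensor /=; ring.
  rewrite E; congr (- _).
  by apply: eq_int => z; rewrite /tensor /=; ring.
have /(_ h h0) := tderiv_segment_x (mp_sqint mpS sf) (mp_sqint mpS sg) H.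
move=> [N [mN N0 HN]]; exists (@swap2 R @^-1` N); split.
- by rewrite -[X in measurable X]setTI; case: mpS => + _; exact.
- by case: mpS => _ ->.
- move=> z nz; apply: HN => /= E; apply: nz.
  by case: z E.
Qed.

End tensor_weak_derivative.

Section difference_quotients.
Context (R : realType).
Notation leb1 := (@lebesgue_measure R).
Notation leb2 := (leb2 R).
Notation n2 := (n2 leb2).
Notation sqint := (sqint leb2).
Implicit Types (f g p q w : plane R -> R) (e : R * R) (h M : R).

Lemma sqint_measurable f : sqint f -> measurable_fun setT f.
Proof. by case. Qed.

Lemma n2_slide_sub e h f g : 0 < h -> sqint f -> sqint g ->
  segment_formula e f g -> n2 (fun z => f (slide e h z) - f z) <= h * n2 g.
Proof.
move=> h0 sf sg fg; have [sG nG] := n2_segint_shifted e h0 sg.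
rewrite (ae_eq_n2 _ _ (fg h h0))//.
  by apply: sqint_measurable; apply: sqintB => //; exact: sqint_slide.
exact: sqint_measurable.
Qed.

(** The remainder is the integral over [0, h] of g(z + r e) - g(z), whose norm is at most r [n2 k]:
    one power of h comes from this increment, one from the length of the segment. *)
Lemma n2_slide_sub2 e h f g k : 0 < h -> sqint f -> sqint g -> sqint k ->
  segment_formula e f g -> segment_formula e g k ->
  n2 (fun z => f (slide e h z) - f z - h * g z) <= h ^+ 2 * n2 k.
Proof.
move=> h0 sf sg sk fg gk.
pose F (x : plane R * measurableTypeR R) := shifted e g x - g x.1.
have mF : measurable_fun setT F.
  apply: measurable_funB; first by apply: measurable_shifted; exact: sqint_measurable.
  exact: (measurableT_comp (sqint_measurable sg) measurable_fst).
have c0 : 0 <= h * n2 k by rewrite mulr_ge0 ?n2_ge0// ltW.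
have HF r : 0 <= r <= h ->
    sqint (fun z => F (z, r)) /\ n2 (fun z => F (z, r)) <= h * n2 k.
  move=> /andP[r0 rh]; split; first by apply: sqintB => //; exact: sqint_slide.
  (* The value r = 0 is separate because [segment_formula] speaks of positive increments only. *)
  move: r0; rewrite le_eqVlt => /predU1P[<-|r0].
    rewrite (_ : (fun z => _) = (fun z => 0 * g z)); last first.
      by apply/funext => -[x y]; rewrite /F /shifted /slide/shift2/= !mul0r !addr0 subrr.
    by rewrite n2Z// normr0 mul0r.
  apply: le_trans (n2_slide_sub r0 sg sk gk) _.
  by rewrite ler_wpM2r// n2_ge0.
have [sS nS] := n2_segint h0 c0 mF HF.
have HG r : 0 <= r <= h -> sqint (fun z => shifted e g (z, r)) /\
    n2 (fun z => shifted e g (z, r)) <= n2 g.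
  move=> _; split; first exact: sqint_slide.
  by rewrite (n2_slide e r)//; exact: sqint_measurable.
have aeG := ae_intble_segint h0 (n2_ge0 _ _) (measurable_shifted e (sqint_measurable sg)) HG.
have [si ni] := sqint_itv (ltW h0).
have iI : intble leb1 (\1_`[0, h] : R -> R).
  by have := intble_sqr si; congr (intble _ _); apply/funext => r;
  rewrite indicE -natrX; case: (_ \in _).
rewrite expr2 -mulrA (le_trans _ nS)// (@ae_eq_n2 _ _ _ _ _ (segint h F))//.
- apply: sqint_measurable; apply: sqintB; last exact: sqintZ.
  by apply: sqintB => //; exact: sqint_slide.
- exact: sqint_measurable.
apply: filterS2 (fg h h0) aeG => z -> iz.
rewrite /segint /F/=.
under [RHS]eq_int do rewrite mulrBl.
rewrite intB//; last exact: intbleZ.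
rewrite intZ//; congr (_ - _); rewrite mulrC; congr (_ * _).
by rewrite /Rintegral integral_indic//= ?setIT// lebesgue_measure_itv/= lte_fin h0 sube0.
Qed.

Notation intble := (intble leb2).

(* Difference quotients converge at rate h; this replaces mollification. *)
Definition sderiv e f g := exists2 C : R, 0 <= C & forall h, 0 < h <= 1 ->
  n2 (fun z => f (slide e h z) - f z - h * g z) <= C * h ^+ 2.

Lemma segment_formula_sderiv e f g k : sqint f -> sqint g -> sqint k ->
  segment_formula e f g -> segment_formula e g k -> sderiv e f g.
Proof.
move=> sf sg sk fg gk; exists (n2 k); first exact: n2_ge0.
by move=> h /andP[h0 _]; rewrite mulrC; exact: n2_slide_sub2.
Qed.

Lemma sderiv_lipschitz e f g : sqint f -> sqint g -> sderiv e f g ->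
  exists2 C : R, 0 <= C & forall h, 0 < h <= 1 ->
    n2 (fun z => f (slide e h z) - f z) <= C * h.
Proof.
move=> sf sg [C C0 HC]; exists (C + n2 g); first by rewrite addr_ge0 ?n2_ge0.
move=> h h01; have := HC h h01; have /andP[h0 h1] := h01.
have sD : sqint (fun z => f (slide e h z) - f z).
  by apply: sqintB => //; exact: sqint_slide.
have := n2D (sqintB sD (sqintZ h sg)) (sqintZ h sg).
under [X in n2 X <= _ -> _]eq_fun do rewrite subrK.
rewrite n2Z// gtr0_norm//.
have Ch : C * h ^+ 2 <= C * h by rewrite expr2 mulrA ler_piMr ?mulr_ge0// ltW.
by rewrite mulrDl [n2 g * h]mulrC; lra.
Qed.

(** Boundedness of a weight and of its derivative along [e], with first and second order Taylor
    bounds uniform in z: the data consumed by a product rule on difference quotients. *)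
Definition good_weight e w w' := [/\ measurable_fun setT w, measurable_fun setT w' &
  exists2 L : R, 0 <= L & [/\ forall z, `|w z| <= L, forall z, `|w' z| <= L,
    forall h z, 0 < h <= 1 -> `|w (slide e h z) - w z| <= L * h &
    forall h z, 0 < h <= 1 -> `|w (slide e h z) - w z - h * w' z| <= L * h ^+ 2]].

Lemma intble_mul3 p q w M : sqint p -> sqint q ->
  measurable_fun setT w -> (forall z, `|w z| <= M) ->
  intble (fun z => p z * q z * w z).
Proof.
move=> sp sq mw wM; under eq_fun do rewrite mulrC.
by apply: intble_bounded_mull wM _ => //; exact: intbleM.
Qed.

Lemma int_mul3_le p q w M : 0 <= M -> sqint p -> sqint q ->
  measurable_fun setT w -> (forall z, `|w z| <= M) ->
  `|\int[leb2]_z (p z * q z * w z)| <= M * (n2 p * n2 q).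
Proof.
move=> M0 sp sq mw wM.
rewrite (_ : (fun z => _) = (fun z => p z * (w z * q z))); last first.
  by apply/funext => z; ring.
have swq := sqint_bounded_mull mw wM sq.
rewrite (le_trans (cauchy_schwarz sp swq))// mulrCA ler_wpM2l ?n2_ge0//.
exact: n2_bounded_mull.
Qed.

Lemma linear_bound_eq0 (T K : R) : (forall h, 0 < h <= 1 -> `|h * T| <= K * h ^+ 2) -> T = 0.
Proof.
move=> H; apply/eqP; rewrite -normr_le0; apply/ler_addgt0Pl => eps eps0; rewrite addr0.
have K0 : 0 <= K.
  by have := H 1; rewrite ltr01 lexx expr1n mulr1 => /(_ isT); exact: le_trans.
pose h := Num.min 1 (eps / (K + 1)).
have K1 : 0 < K + 1 by rewrite ltr_wpDl.
have h0 : 0 < h by rewrite lt_min ltr01 divr_gt0.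
have h1 : h <= 1 by rewrite ge_min lexx.
have := H h; rewrite h0 h1 => /(_ isT).
rewrite normrM gtr0_norm// expr2 mulrA [K * h]mulrC -mulrA ler_pM2l// => /le_trans; apply.
have : h <= eps / (K + 1) by rewrite ge_min lexx orbT.
by rewrite ler_pdivlMr//; nra.
Qed.

(** The integral of f g w is invariant under the shift by h e. Expanding the shifted product in
    increments, the terms of first order sum to h T, where T is the left-hand side, and the others
    are O(h^2); dividing by h gives T = 0. *)
Lemma weighted_by_parts e f f' g g' w w' :
  sqint f -> sqint f' -> sqint g -> sqint g' ->
  sderiv e f f' -> sderiv e g g' -> good_weight e w w' ->
  \int[leb2]_z (f' z * g z * w z) + \int[leb2]_z (f z * g' z * w z)
    + \int[leb2]_z (f z * g z * w' z) = 0.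
Proof.
move=> sf sf' sg sg' [A A0 HA] [B B0 HB] [mw mw' [L L0 [w1 w2 w3 w4]]].
have [A1 A10 HA1] := sderiv_lipschitz sf sf' (ex_intro2 _ _ A A0 HA).
have [B1 B10 HB1] := sderiv_lipschitz sg sg' (ex_intro2 _ _ B B0 HB).
have i1 := intble_mul3 sf' sg mw w1; have i2 := intble_mul3 sf sg' mw w1.
have i3 := intble_mul3 sf sg mw' w2.
set T := (X in X = 0).
(* One constant for each of the six error terms of [hT], in the same order. *)
pose K := L * (A * n2 g) + L * (n2 f * B) + L * (n2 f * n2 g)
  + L * (A1 * B1) + L * (A1 * n2 g) + L * (n2 f * B1).
apply: (@linear_bound_eq0 _ K) => h h01; have /andP[h0 h1] := h01.
pose f_ z := f (slide e h z); pose g_ z := g (slide e h z); pose w_ z := w (slide e h z).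
have sf_ : sqint f_ := sqint_slide e h sf.
have sg_ : sqint g_ := sqint_slide e h sg.
have mw_ : measurable_fun setT w_ := mp_measurable (mp_slide e h) mw.
pose a z := f_ z - f z; pose b z := g_ z - g z; pose c z := w_ z - w z.
pose al z := a z - h * f' z; pose be z := b z - h * g' z; pose ga z := c z - h * w' z.
have sa : sqint a by exact: sqintB.
have sb : sqint b by exact: sqintB.
have mc : measurable_fun setT c by exact: measurable_funB.
have sal : sqint al by apply: sqintB => //; exact: sqintZ.
have sbe : sqint be by apply: sqintB => //; exact: sqintZ.
have mga : measurable_fun setT ga by apply: measurable_funB => //; exact: measurable_funM.
have w_1 z : `|w_ z| <= L by exact: w1.
have c1 z : `|c z| <= L * h by exact: w3.
have ga1 z : `|ga z| <= L * h ^+ 2 by exact: w4.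
have Lh0 : 0 <= L * h by rewrite mulr_ge0// ltW.
have Lh20 : 0 <= L * h ^+ 2 by rewrite mulr_ge0// exprn_ge0// ltW.
have zero : \int[leb2]_z (f_ z * g_ z * w_ z) = \int[leb2]_z (f z * g z * w z).
  rewrite -[RHS](mp_int (mp_slide e h))//.
  exact: (intble_measurable (intble_mul3 sf sg mw w1)).
have hT : h * T = - (\int[leb2]_z (al z * g z * w z) + \int[leb2]_z (f z * be z * w z)
   + \int[leb2]_z (f z * g z * ga z) + \int[leb2]_z (a z * b z * w_ z)
   + \int[leb2]_z (a z * g z * c z) + \int[leb2]_z (f z * b z * c z)).
  have j1 := intble_mul3 sal sg mw w1; have j2 := intble_mul3 sf sbe mw w1.
  have j3 := intble_mul3 sf sg mga ga1; have j4 := intble_mul3 sa sb mw_ w_1.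
  have j5 := intble_mul3 sa sg mc c1; have j6 := intble_mul3 sf sb mc c1.
  have k1 := intble_mul3 sf_ sg_ mw_ w_1; have k2 := intble_mul3 sf sg mw w1.
  have j12 := intbleD j1 j2; have j13 := intbleD j12 j3; have j14 := intbleD j13 j4.
  have j15 := intbleD j14 j5.
  have i12 := intbleD i1 i2; have i13 := intbleD i12 i3.
  rewrite -(intD j1 j2) -(intD j12 j3) -(intD j13 j4) -(intD j14 j5) -(intD j15 j6).
  rewrite /T -(intD i1 i2) -(intD i12 i3) -(intZ _ i13).
  apply/eqP; rewrite -addr_eq0 -(intD (intbleZ _ i13) (intbleD j15 j6)).
  have /eqP := zero; rewrite -subr_eq0 -(intB k1 k2) => /eqP zero'.
  rewrite -[X in _ == X]zero'; apply/eqP; apply: eq_int => z.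
  by rewrite /al /be /ga /a /b /c; ring.
have na := HA1 h h01; have nb := HB1 h h01; have nal := HA h h01; have nbe := HB h h01.
rewrite -/(a _) in na nal; rewrite hT normrN.
have H1 := int_mul3_le L0 sal sg mw w1.
have H2 := int_mul3_le L0 sf sbe mw w1.
have H3 := int_mul3_le Lh20 sf sg mga ga1.
have H4 := int_mul3_le L0 sa sb mw_ w_1.
have H5 := int_mul3_le Lh0 sa sg mc c1.
have H6 := int_mul3_le Lh0 sf sb mc c1.
have := n2_ge0 leb2 f; have := n2_ge0 leb2 g; have := n2_ge0 leb2 a; have := n2_ge0 leb2 b.
have := n2_ge0 leb2 al; have := n2_ge0 leb2 be => be0 al0 b0 a0 g0 f0.
have E1 : L * (n2 al * n2 g) <= L * (A * n2 g) * h ^+ 2.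
  by rewrite -mulrA ler_wpM2l// mulrAC ler_wpM2r.
have E2 : L * (n2 f * n2 be) <= L * (n2 f * B) * h ^+ 2.
  by rewrite -mulrA ler_wpM2l// -mulrA ler_wpM2l.
have E4 : L * (n2 a * n2 b) <= L * (A1 * B1) * h ^+ 2.
  rewrite -mulrA ler_wpM2l//; apply: le_trans (ler_pM a0 b0 na nb) _.
  by rewrite le_eqVlt; apply/orP; left; apply/eqP; ring.
have E5 : L * h * (n2 a * n2 g) <= L * (A1 * n2 g) * h ^+ 2.
  rewrite -mulrA -[leRHS]mulrA ler_wpM2l//.
  rewrite (_ : _ * h ^+ 2 = h * ((A1 * h) * n2 g)); last by ring.
  by rewrite ler_wpM2l ?(ltW h0)// ler_wpM2r.
have E6 : L * h * (n2 f * n2 b) <= L * (n2 f * B1) * h ^+ 2.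
  rewrite -mulrA -[leRHS]mulrA ler_wpM2l//.
  rewrite (_ : _ * h ^+ 2 = h * (n2 f * (B1 * h))); last by ring.
  by rewrite ler_wpM2l ?(ltW h0)// ler_wpM2l.
have E3 : L * h ^+ 2 * (n2 f * n2 g) = L * (n2 f * n2 g) * h ^+ 2 by ring.
rewrite E3 in H3; rewrite /K !mulrDl.
apply: le_trans (ler_normD _ _) (lerD _ (le_trans H6 E6)).
apply: le_trans (ler_normD _ _) (lerD _ (le_trans H5 E5)).
apply: le_trans (ler_normD _ _) (lerD _ (le_trans H4 E4)).
apply: le_trans (ler_normD _ _) (lerD _ H3).
exact: le_trans (ler_normD _ _) (lerD (le_trans H1 E1) (le_trans H2 E2)).
Qed.

End difference_quotients.

(** * The Sobolev embedding *)

Section averages.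
Context (R : realType).
Notation leb1 := (@lebesgue_measure R).
Notation leb2 := (leb2 R).
Local Open Scope ereal_scope.
Implicit Types (phi k : plane R -> \bar R) (e : R * R).

Let I (r : measurableTypeR R) : \bar R := (\1_`[0%R, 1%R] r : R)%:E.

Let mI : measurable_fun setT I.
Proof. by apply/measurable_EFinP; apply: measurable_indic; exact: measurable_itv. Qed.

Let I0 r : 0 <= I r.
Proof. by rewrite lee_fin. Qed.

(** The backward unit average, adjoint to the forward average over r in [0, 1] of z + r e. *)
Definition avg e k z := \int[leb1]_r (k (slide e (- r)%R z) * I r).

Lemma measurable_slide_pair e (s : R -> R) :
  measurable_fun [set: measurableTypeR R] s ->
  measurable_fun setT (fun x : plane R * measurableTypeR R => slide e (s x.2) x.1).
Proof.
move=> ms; have ms2 : measurable_fun setT (fun x : plane R * measurableTypeR R => s x.2).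
  exact: measurableT_comp ms measurable_snd.
apply/measurable_fun_pairP; split.
  apply: measurable_funD; first exact: measurableT_comp measurable_fst measurable_fst.
  by apply: measurable_funM.
apply: measurable_funD; first exact: measurableT_comp measurable_snd measurable_fst.
by apply: measurable_funM.
Qed.

Let measurable_slideI e (s : R -> R) phi :
  measurable_fun [set: measurableTypeR R] s -> measurable_fun setT phi ->
  measurable_fun setT (fun x : plane R * measurableTypeR R =>
    phi (slide e (s x.2) x.1) * I x.2).
Proof.
move=> ms mphi; apply: emeasurable_funM; last exact: measurableT_comp mI measurable_snd.
exact: measurableT_comp mphi (measurable_slide_pair e ms).
Qed.

Let mN : measurable_fun [set: measurableTypeR R] (fun r : R => - r)%R.
Proof. exact: measurable_funN. Qed.

Lemma measurable_avg e k : measurable_fun setT k -> (forall z, 0 <= k z) ->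
  measurable_fun setT (avg e k).
Proof.
move=> mk k0; apply: (leb2_tonelli_measurableF (measurable_slideI e mN mk)) => z.
by rewrite mule_ge0.
Qed.

Lemma avg_ge0 e k z : (forall z, 0 <= k z) -> 0 <= avg e k z.
Proof. by move=> k0; apply: integral_ge0 => r _; rewrite mule_ge0. Qed.

Lemma int_avg e phi k : measurable_fun setT phi -> (forall z, 0 <= phi z) ->
  measurable_fun setT k -> (forall z, 0 <= k z) ->
  \int[leb1]_r (\int[leb2]_z (phi (slide e r z) * k z) * I r) =
  \int[leb2]_z (phi z * avg e k z).
Proof.
move=> mphi phi0 mk k0.
pose F (x : plane R * measurableTypeR R) := phi x.1 * (k (slide e (- x.2)%R x.1) * I x.2).
have mF : measurable_fun setT F.
  apply: emeasurable_funM; first exact: measurableT_comp mphi measurable_fst.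
  exact: measurable_slideI.
have F0 x : 0 <= F x by rewrite /F !mule_ge0.
transitivity (\int[leb1]_r \int[leb2]_z F (z, r)).
  apply: eq_integral => r _.
  rewrite -(mp_ge0_integral (mp_slide e (- r)%R)); last 2 first.
    apply: emeasurable_funM => //.
    exact: measurableT_comp mphi (mp_slide e r).1.
    by move=> z; rewrite mule_ge0.
  rewrite -ge0_integralZr//; last 2 first.
    apply: emeasurable_funM.
      exact: (measurableT_comp (measurableT_comp mphi (mp_slide e r).1) (mp_slide e (- r)%R).1).
    exact: measurableT_comp mk (mp_slide e (- r)%R).1.
    by move=> z _; rewrite mule_ge0.
  by apply: eq_integral => z _; rewrite slideN /F/= muleA.
rewrite -(leb2_tonelli mF F0); apply: eq_integral => z _.
rewrite /F/= ge0_integralZl//.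
- apply: emeasurable_funM => //.
  have := measurableT_comp (measurable_slide_pair e mN) (pair1_measurable z).
  by move=> /(measurableT_comp mk).
- by move=> r _; rewrite mule_ge0.
Qed.

Lemma int_segment_avg e phi k : measurable_fun setT phi -> (forall z, 0 <= phi z) ->
  measurable_fun setT k -> (forall z, 0 <= k z) ->
  \int[leb2]_z (\int[leb1]_r (phi (slide e r z) * I r) * k z) =
  \int[leb2]_z (phi z * avg e k z).
Proof.
move=> mphi phi0 mk k0; rewrite -int_avg//.
have mid : measurable_fun [set: measurableTypeR R] (fun r : R => r) by exact: measurable_id.
pose F (x : plane R * measurableTypeR R) := phi (slide e x.2 x.1) * I x.2 * k x.1.
have mF : measurable_fun setT F.
  apply: emeasurable_funM; first exact: (measurable_slideI e mid mphi).
  exact: measurableT_comp mk measurable_fst.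
have F0 x : 0 <= F x by rewrite /F !mule_ge0.
transitivity (\int[leb2]_z \int[leb1]_r F (z, r)).
  apply: eq_integral => z _; rewrite /F/= ge0_integralZr//.
  - apply: emeasurable_funM => //.
    have := measurableT_comp (measurable_slide_pair e mid) (pair1_measurable z).
    by move=> /(measurableT_comp mphi).
  - by move=> r _; rewrite mule_ge0.
rewrite (leb2_tonelli mF F0); apply: eq_integral => r _.
rewrite /F/= -ge0_integralZr//.
- by apply: eq_integral => z _; rewrite muleAC.
- apply: emeasurable_funM => //; exact: measurableT_comp mphi (mp_slide e r).1.
- by move=> z _; rewrite mule_ge0.
Qed.

Lemma int_itv01 (c : \bar R) : 0 <= c -> \int[leb1]_r (c * I r) = c.
Proof.
move=> c0; rewrite ge0_integralZl// integral_indic//= ?setIT//.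
by rewrite lebesgue_measure_itv/= lte_fin ltr01 sube0 mule1.
Qed.

(** The double average is the integral of [k] over the unit square z - [0, 1]^2; the reflection w
    |-> z - w turns the full integral into one over the same variables. *)
Lemma avg_avg_le k z : measurable_fun setT k -> (forall z, 0 <= k z) ->
  avg (@ey R) (avg (@ex R) k) z <= \int[leb2]_z k z.
Proof.
move=> mk k0.
have I1 r : I r <= 1 by rewrite lee_fin indicE lern1 leq_b1.
have mpz := reflect2_measure_preserving z.
rewrite -(mp_ge0_integral mpz mk k0).
have mkz : measurable_fun setT (fun w : plane R => k (z.1 - w.1, z.2 - w.2)%R).
  exact: measurableT_comp mk mpz.1.
rewrite [leRHS](@fubini_tonelli2 _ _ _ _ _ leb1 leb1 _ mkz)//=.
apply: ge0_le_integral => //.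
- by move=> q _; rewrite mule_ge0// avg_ge0.
- have mz := measurableT_comp (measurable_slide_pair (@ey R) mN) (pair1_measurable z).
  apply: emeasurable_funM => //.
  exact: (measurableT_comp (measurable_avg (@ex R) mk k0) mz).
- exact: (@measurable_fun_fubini_tonelli_G _ _ _ _ _ leb1 _ mkz).
move=> q _; apply: (@le_trans _ _ (avg (@ex R) k (slide (@ey R) (- q) z))).
  by rewrite -[leRHS]mule1 lee_pmul// avg_ge0.
apply: ge0_le_integral => //.
- by move=> r _; rewrite mule_ge0.
- exact: (measurableT_comp (measurable_slideI (@ex R) mN mk) (pair1_measurable (slide (@ey R) (- q) z))).
- exact: (measurableT_comp mkz (measurable_pair2 q)).
- move=> r _; rewrite -[leRHS]mule1 lee_pmul// /slide/shift2/=.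
  by rewrite !mulr1 !mulr0 !addr0.
Qed.

(** For 0 < r <= 1, f(z) is f(z + r e) minus the integral of g over the segment of length r, so
    f(z)^2 is at most twice f(z + r e)^2 plus the unit average of g^2. Integrating against [k],
    averaging over r in [0, 1] and passing to the adjoint moves both averages onto [k]. *)
Lemma int_sqr_avg_le e (f g : plane R -> R) k :
  sqint leb2 f -> sqint leb2 g -> segment_formula e f g ->
  measurable_fun setT k -> (forall z, 0 <= k z) ->
  \int[leb2]_z ((f z ^+ 2)%:E * k z) <=
  2%:E * (\int[leb2]_z ((f z ^+ 2)%:E * avg e k z) +
          \int[leb2]_z ((g z ^+ 2)%:E * avg e k z)).
Proof.
move=> sf sg fg mk k0.
have [mf mg] : measurable_fun setT f /\ measurable_fun setT g.
  by case: sf sg => ? _ [].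
have mf2 : measurable_fun setT (fun z => (f z ^+ 2)%:E) by exact/measurable_EFinP/measurable_funX.
have mg2 : measurable_fun setT (fun z => (g z ^+ 2)%:E) by exact/measurable_EFinP/measurable_funX.
have f20 z : 0 <= (f z ^+ 2)%:E by rewrite lee_fin sqr_ge0.
have g20 z : 0 <= (g z ^+ 2)%:E by rewrite lee_fin sqr_ge0.
have mid : measurable_fun [set: measurableTypeR R] (fun r : R => r) by exact: measurable_id.
pose Q z := \int[leb1]_r ((g (slide e r z) ^+ 2)%:E * I r).
have mQ : measurable_fun setT Q.
  apply: (leb2_tonelli_measurableF (measurable_slideI e mid mg2)) => z.
  by rewrite mule_ge0.
have Q0 z : 0 <= Q z by apply: integral_ge0 => r _; rewrite mule_ge0.
set X := \int[leb2]_z ((f z ^+ 2)%:E * k z).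
have X0 : 0 <= X by apply: integral_ge0 => z _; rewrite mule_ge0.
pose Y r := \int[leb2]_z ((f (slide e r z) ^+ 2)%:E * k z).
have Y0 r : 0 <= Y r by apply: integral_ge0 => z _; rewrite mule_ge0.
pose Z := \int[leb2]_z (Q z * k z).
have Z0 : 0 <= Z by apply: integral_ge0 => z _; rewrite mule_ge0.
have mfs r : measurable_fun setT (fun z => (f (slide e r z) ^+ 2)%:E).
  exact: measurableT_comp mf2 (mp_slide e r).1.
have XY r : (0 <= r <= 1)%R -> X <= 2%:E * (Y r + Z).
  move=> /andP[]; rewrite le_eqVlt => /predU1P[<- _|r0 r1].
    have -> : Y 0%R = X.
      by apply: eq_integral => -[x y] _; rewrite /slide/shift2/= !mul0r !addr0.
    rewrite -[leLHS]mul1e lee_pmul//; first by rewrite lee_fin ler1n.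
    by rewrite leeDl.
  rewrite /Y /Z -ge0_integralD//; last 4 first.
    by move=> z _; rewrite mule_ge0.
    exact: emeasurable_funM.
    by move=> z _; rewrite mule_ge0.
    exact: emeasurable_funM.
  rewrite -ge0_integralZl//; last 2 first.
    by apply: emeasurable_funD; exact: emeasurable_funM.
    by move=> z _; rewrite adde_ge0// mule_ge0.
  apply: ae_ge0_le_integral => //.
  - by move=> z _; rewrite mule_ge0.
  - exact: emeasurable_funM.
  - by move=> z _; rewrite mule_ge0// adde_ge0// mule_ge0.
  - by apply: measurable_funeM; apply: emeasurable_funD; exact: emeasurable_funM.
  - apply: filterS (fg r r0) => z fz _; rewrite -ge0_muleDl// muleA lee_pmul//.
    apply: (@le_trans _ _ (2%:E * ((f (slide e r z) ^+ 2)%:E +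
        (segint r (shifted e g) z ^+ 2)%:E))).
      rewrite -fz -EFinD -EFinM lee_fin.
      (* With F = f(z + r e), the difference 2 (F^2 + (F - f)^2) - f^2 is (2 F - f)^2. *)
      by have := sqr_ge0 (2 * f (slide e r z) - f z); nra.
    rewrite lee_pmul// ?adde_ge0 ?lee_fin ?sqr_ge0// leeD//.
    apply: le_trans (sqr_segint_le z r0 (measurable_shifted e mg)) _.
    rewrite -[leRHS]mul1e lee_pmul//; first by rewrite lee_fin ltW.
    + by apply: integral_ge0 => s _; rewrite lee_fin sqr_ge0.
    + apply: ge0_le_integral => //.
      * by move=> s _; rewrite lee_fin sqr_ge0.
      * apply/measurable_EFinP/measurable_funX.
        exact: (measurableT_comp (measurable_cut r (measurable_shifted e mg)) (pair1_measurable z)).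
      * exact: (measurableT_comp (measurable_slideI e mid mg2) (pair1_measurable z)).
      * move=> s _; rewrite /cut/shifted/= /I -EFinM lee_fin exprMn ler_wpM2l ?sqr_ge0//.
        rewrite !indicE -natrX ler_nat.
        case: (boolP (s \in _)) => // /set_mem; rewrite /= in_itv/= => /andP[s0 sr].
        by rewrite mem_set//= in_itv/= s0 (le_trans sr).
have mY : measurable_fun setT Y.
  apply: (@leb2_tonelli_measurableG _ (fun x => (f (slide e x.2 x.1) ^+ 2)%:E * k x.1)).
    apply: emeasurable_funM; last exact: measurableT_comp mk measurable_fst.
    exact: measurableT_comp mf2 (measurable_slide_pair e mid).
  by move=> x; rewrite mule_ge0.
have mYI : measurable_fun setT (fun r => Y r * I r) by exact: emeasurable_funM.
have mZI : measurable_fun setT (fun r => Z * I r) by exact: emeasurable_funM.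
rewrite -(int_itv01 X0).
apply: (@le_trans _ _ (\int[leb1]_r (2%:E * (Y r * I r + Z * I r)))).
  apply: ge0_le_integral => //.
  - by move=> r _; rewrite mule_ge0.
  - exact: emeasurable_funM.
  - by apply: measurable_funeM; exact: emeasurable_funD.
  - move=> r _; rewrite -ge0_muleDl// muleA /I indicE.
    case: (boolP (r \in _)) => /= [/set_mem|_]; last by rewrite !mule0.
    by rewrite /= in_itv/= => r01; rewrite !mule1; exact: XY.
rewrite ge0_integralZl//; last 2 first.
  exact: emeasurable_funD.
  by move=> r _; rewrite adde_ge0// mule_ge0.
rewrite lee_pmul//; first by apply: integral_ge0 => r _; rewrite adde_ge0// mule_ge0.
rewrite ge0_integralD//; last 2 first.
  by move=> r _; rewrite mule_ge0.
  by move=> r _; rewrite mule_ge0.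
rewrite int_itv01// leeD//.
  by rewrite -int_avg.
by rewrite -int_segment_avg.
Qed.

(* Dual argument: averaging along [e] gives
   \int f^2 k <= 2 \int (f^2 + f_e^2) avg e k; apply it in x, then in y, with [k]
   the indicator of the set where the bound fails, using avg (avg k) <= \int k. *)
Lemma sobolev_sup (u ux uy uxy : plane R -> R) :
  sqint leb2 u -> sqint leb2 ux -> sqint leb2 uy -> sqint leb2 uxy ->
  segment_formula (@ex R) u ux -> segment_formula (@ey R) u uy ->
  segment_formula (@ey R) ux uxy ->
  {ae leb2, forall z, (u z ^+ 2 <= 4 * (n2 leb2 u ^+ 2 + n2 leb2 ux ^+ 2 +
    (n2 leb2 uy ^+ 2 + n2 leb2 uxy ^+ 2)))%R}.
Proof.
move=> su sux suy suxy hux huy huxy; set C := (4 * _)%R.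
have mu : measurable_fun setT u by case: su.
have mu2 : measurable_fun setT (fun z => (u z ^+ 2)%:E) by exact/measurable_EFinP/measurable_funX.
have C0 : (0 <= C)%R by rewrite /C mulr_ge0// !addr_ge0 ?sqr_ge0.
have nE (f : plane R -> R) : sqint leb2 f -> \int[leb2]_z (f z ^+ 2)%:E = (n2 leb2 f ^+ 2)%:E.
  by move=> sf; rewrite sqr_n2 EFin_Rintegral//; exact: intble_sqr.
have key k : measurable_fun setT k -> (forall z, 0 <= k z) ->
    \int[leb2]_z ((u z ^+ 2)%:E * k z) <= C%:E * \int[leb2]_z k z.
  move=> mk k0; have mA := measurable_avg (@ex R) mk k0.
  have A0 z : 0 <= avg (@ex R) k z by exact: avg_ge0.
  have B0 z : 0 <= avg (@ey R) (avg (@ex R) k) z by exact: avg_ge0.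
  have bound (f : plane R -> R) : sqint leb2 f ->
      \int[leb2]_z ((f z ^+ 2)%:E * avg (@ey R) (avg (@ex R) k) z) <=
      (n2 leb2 f ^+ 2)%:E * \int[leb2]_z k z.
    move=> sf; rewrite -nE// -ge0_integralZr//; last 3 first.
      by apply/measurable_EFinP/measurable_funX; case: sf.
      by move=> z _; rewrite lee_fin sqr_ge0.
      exact: integral_ge0.
    have mf2 : measurable_fun setT (fun z => (f z ^+ 2)%:E).
      by apply/measurable_EFinP/measurable_funX; case: sf.
    apply: ge0_le_integral => //.
    - by move=> z _; rewrite mule_ge0// lee_fin sqr_ge0.
    - by apply: emeasurable_funM => //; exact: measurable_avg.
    - exact: emeasurable_funM.
    - move=> z _; rewrite lee_pmul ?lee_fin ?sqr_ge0//; exact: avg_avg_le.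
  have h1 := int_sqr_avg_le su sux hux mk k0.
  have h2 := int_sqr_avg_le su suy huy mA A0.
  have h3 := int_sqr_avg_le sux suxy huxy mA A0.
  have [b1 b2 b3 b4] := And4 (bound _ su) (bound _ suy) (bound _ sux) (bound _ suxy).
  have K0 : 0 <= \int[leb2]_z k z by exact: integral_ge0.
  have twoge : 0 <= 2%:E :> \bar R by [].
  apply: le_trans h1 _; apply: le_trans (lee_wpmul2l twoge (leeD h2 h3)) _.
  apply: (le_trans (lee_wpmul2l twoge (leeD (lee_wpmul2l twoge (leeD b1 b2))
     (lee_wpmul2l twoge (leeD b3 b4))))).
  rewrite -!ge0_muleDl ?adde_ge0 ?lee_fin ?sqr_ge0// -!EFinD !muleA -!EFinM.
  rewrite -ge0_muleDl ?lee_fin ?mulr_ge0 ?addr_ge0 ?sqr_ge0//.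
  rewrite muleA -!EFinD -EFinM lee_wpmul2r// lee_fin /C.
  by rewrite le_eqVlt; apply/orP; left; apply/eqP; ring.
pose B := [set z | (C < u z ^+ 2)%R].
have mB : measurable B.
  rewrite -[X in measurable X]setTI (_ : B = (fun z => u z ^+ 2)%R @^-1` `]C, +oo[).
    by apply: (measurable_funX 2 mu) => //; exact: measurable_itv.
  by apply/seteqP; split=> z /=; rewrite in_itv/= andbT.
pose k z : \bar R := (\1_B z : R)%:E.
have mk : measurable_fun setT k by exact/measurable_EFinP/measurable_indic.
have k0 z : 0 <= k z by rewrite lee_fin.
(* [p] is the excess of u^2 over C, so u^2 k = p + C k. The integral of u^2 k is finite since u is
   in L^2, so C times the integral of [k] cancels in [key], leaving a nonpositive integral of
   [p]. *)
pose p z : \bar R := (Num.max (u z ^+ 2 - C) 0)%:E.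
have mp : measurable_fun setT p.
  apply/measurable_EFinP; apply: measurable_maxr => //.
  by apply: measurable_funB => //; exact: measurable_funX.
have p0 z : 0 <= p z by rewrite lee_fin le_max lexx orbT.
have pE z : (u z ^+ 2)%:E * k z = p z + C%:E * k z.
  rewrite /k /p indicE -!EFinM -EFinD; congr (_%:E).
  case: (boolP (z \in B)) => [/set_mem|]; first by rewrite /B/= => h;
    rewrite max_l ?subr_ge0 ?(ltW h)//; ring.
  by rewrite notin_setE /B/= => /negP; rewrite -leNgt => h; rewrite max_r ?subr_le0//; ring.
have iuk : \int[leb2]_z ((u z ^+ 2)%:E * k z) < +oo.
  case: su => _; apply: le_lt_trans; apply: ge0_le_integral => //.
  - by move=> z _; rewrite mule_ge0// lee_fin sqr_ge0.
  - exact: emeasurable_funM.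
  - move=> z _; rewrite -[leRHS]mule1 lee_wpmul2l ?lee_fin ?sqr_ge0//.
have := key k mk k0.
have CE : \int[leb2]_z (C%:E * k z) = C%:E * \int[leb2]_z k z by rewrite ge0_integralZl.
have split_int : \int[leb2]_z ((u z ^+ 2)%:E * k z) = \int[leb2]_z p z + C%:E * \int[leb2]_z k z.
  rewrite -CE -ge0_integralD//; first by apply: eq_integral => z _.
  - by move=> z _; rewrite mule_ge0.
  - exact: measurable_funeM.
have Cfin : C%:E * \int[leb2]_z k z \is a fin_num.
  rewrite ge0_fin_numE ?mule_ge0 ?integral_ge0//.
  by apply: le_lt_trans iuk; rewrite split_int leeDr// integral_ge0.
rewrite split_int -[leRHS]add0e leeD2rE// => ip.
have : \int[leb2]_z `|p z| = 0.
  under eq_integral do rewrite gee0_abs//.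
  by apply/eqP; rewrite eq_le ip integral_ge0.
move/(ae_eq_integral_abs _ measurableT mp); apply: filterS => z /(_ Logic.I) /= [].
by move=> /max_idPr; rewrite subr_le0.
Qed.

End averages.

(** * Exponential weights and the energy inequality *)

Section logistic.
Context (R : realType).
Implicit Types (x y t L eps : R) (F : R -> R) (q : {poly R}).

Lemma is_derive_lipschitz F F' L : (forall x, is_derive x 1 F (F' x)) ->
  (forall x, `|F' x| <= L) -> forall x y, `|F y - F x| <= L * `|y - x|.
Proof.
move=> dF F'L; suff wlog_le x y : x <= y -> `|F y - F x| <= L * `|y - x|.
  move=> x y; have [/wlog_le//|/ltW /wlog_le] := leP x y.
  by rewrite distrC [`|x - y|]distrC.
move=> xy; have cF : {within `[x, y], continuous F}.
  apply: continuous_subspaceT => t; apply/differentiable_continuous/derivable1_diffP.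
  by have [] := dF t.
have [c _ ->] := MVT_segment xy (fun t _ => dF t) cF.
by rewrite normrM ler_wpM2r.
Qed.

Lemma is_derive_taylor F F' F'' L : (forall x, is_derive x 1 F (F' x)) ->
  (forall x, is_derive x 1 F' (F'' x)) -> (forall x, `|F'' x| <= L) ->
  forall x t, `|F (x + t) - F x - t * F' x| <= L * t ^+ 2.
Proof.
move=> dF dF' F''L x t.
have L0 : 0 <= L by exact: le_trans (normr_ge0 _) (F''L 0).
have [c ct E] : exists2 c, `|c - x| <= `|t| & F (x + t) - F x = F' c * t.
  have cF : continuous F.
    move=> s; apply/differentiable_continuous/derivable1_diffP.
    by have [] := dF s.
  have [t0|/ltW t0] := leP 0 t.
    have xt : x <= x + t by rewrite lerDl.
    have [c] := MVT_segment xt (fun s _ => dF s) (continuous_subspaceT cF).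
    rewrite in_itv/= => /andP[xc cxt] ->; exists c; last by congr (_ * _); ring.
    by rewrite !ger0_norm ?subr_ge0// lerBlDl.
  have xt : x + t <= x by rewrite gerDl.
  have [c] := MVT_segment xt (fun s _ => dF s) (continuous_subspaceT cF).
  rewrite in_itv/= => /andP[xc cxt] E; exists c; last first.
    by rewrite -[LHS]opprB E; ring.
  by rewrite distrC (ger0_norm (_ : 0 <= x - c)) ?subr_ge0// ler0_norm//; lra.
rewrite E (_ : _ - _ = (F' c - F' x) * t); last by ring.
rewrite normrM -[t ^+ 2]real_normK ?num_real// expr2 mulrA.
rewrite ler_wpM2r//; apply: le_trans (is_derive_lipschitz dF' F''L _ _) _.
by rewrite ler_wpM2l.
Qed.

(* A bounded regularisation of [expR], with [P' = P - eps P^2]. *)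
Definition logistic eps x := expR x / (1 + eps * expR x).

Lemma logistic_den eps x : 0 < eps -> 0 < 1 + eps * expR x.
Proof. by move=> e0; rewrite addr_gt0// mulr_gt0// expR_gt0. Qed.

Lemma logistic_gt0 eps x : 0 < eps -> 0 < logistic eps x.
Proof. by move=> e0; rewrite divr_gt0 ?expR_gt0// logistic_den. Qed.

Lemma logistic_le eps x : 0 < eps -> eps * logistic eps x <= 1.
Proof.
move=> e0; rewrite /logistic mulrA ler_pdivrMr ?logistic_den// mul1r.
by rewrite lerDr.
Qed.

Lemma logistic_le_expR eps x : 0 < eps -> logistic eps x <= expR x.
Proof.
move=> e0; rewrite /logistic ler_pdivrMr ?logistic_den// mulrDr mulr1 lerDl.
by rewrite !mulr_ge0 ?expR_ge0// ltW.
Qed.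

(* [(q \o P)' = (logistic_deriv eps q) \o P]. *)
Definition logistic_deriv eps q : {poly R} := q^`() * ('X - eps *: 'X^2).

Lemma is_derive_logistic eps x : 0 < eps ->
  is_derive x 1 (logistic eps) (logistic eps x - eps * logistic eps x ^+ 2).
Proof.
move=> e0; have D0 := logistic_den x e0.
have dD : is_derive x 1 (fun t => 1 + eps * expR t) (0 + (0 * expR x + eps * expR x)).
  exact: (is_deriveD_fun (is_derive_cst (1 : R) x 1)
    (is_deriveM_fun (is_derive_cst eps x 1) (is_derive_expR x))).
have dV := @is_deriveV _ (fun t => 1 + eps * expR t) x _ 1 (lt0r_neq0 D0) dD.
have dL := is_deriveM_fun (is_derive_expR x) dV.
apply: is_derive_eq dL _.
rewrite /logistic /GRing.scale/= mul0r !add0r.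
by field; rewrite lt0r_neq0.
Qed.

Lemma is_derive_poly_logistic eps q x : 0 < eps ->
  is_derive x 1 (fun t => q.[logistic eps t])
    (logistic_deriv eps q).[logistic eps x].
Proof.
move=> e0; have H := is_derive_comp_fun (is_derive_logistic x e0)
  (is_derive_poly q (logistic eps x)).
apply: is_derive_eq H _.
by rewrite /logistic_deriv hornerM hornerD hornerN hornerZ hornerX hornerXn.
Qed.

Lemma poly_logistic_bounded eps q : 0 < eps ->
  exists2 L : R, 0 <= L & forall x, `|q.[logistic eps x]| <= L.
Proof.
move=> e0; elim/poly_ind: q => [|q c [L L0 HL]].
  by exists 0 => // x; rewrite horner0 normr0.
exists (L * eps^-1 + `|c|) => [|x].
  by rewrite addr_ge0// mulr_ge0// invr_ge0 ltW.
rewrite hornerD hornerM hornerX hornerC (le_trans (ler_normD _ _))// lerD2r normrM.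
apply: ler_pM => //.
rewrite (gtr0_norm (logistic_gt0 x e0)) -[X in _ <= X]mul1r.
by rewrite ler_pdivlMr// mulrC logistic_le.
Qed.

Variables (eps a b : R).
Hypothesis eps0 : 0 < eps.

Definition phase (z : plane R) : R := a * z.1 + b * z.2.
Definition slope (e : R * R) : R := a * e.1 + b * e.2.

Lemma phase_slide e (h : R) z : phase (slide e h z) = phase z + h * slope e.
Proof. by rewrite /phase /slope /slide /shift2/=; ring. Qed.

Lemma measurable_phase : measurable_fun setT phase.
Proof.
by apply: measurable_funD; apply: measurable_funM.
Qed.

Definition logistic_poly n : {poly R} := iter n (logistic_deriv eps) 'X.

(** [c] times the [n]-th derivative of P at the phase. Differentiating along [e] raises [n] by one
    and multiplies [c] by the slope, so the family is closed under integration by parts. *)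
Definition weight (n : nat) (c : R) (z : plane R) : R :=
  c * (logistic_poly n).[logistic eps (phase z)].

Lemma good_weight_weight e n c :
  good_weight e (weight n c) (weight n.+1 (c * slope e)).
Proof.
have dq m x := is_derive_poly_logistic (logistic_poly m) x eps0.
have measurable_weight m d : measurable_fun setT (weight m d).
  apply: measurable_funM => //.
  have cW : continuous (fun x => (logistic_poly m).[logistic eps x]).
    move=> x; apply/differentiable_continuous/derivable1_diffP.
    by have [] := dq m x.
  exact: (measurableT_comp (continuous_measurable_fun cW) measurable_phase).
have [L0 L00 HL0] := poly_logistic_bounded (logistic_poly n) eps0.
have [L1 L10 HL1] := poly_logistic_bounded (logistic_poly n.+1) eps0.
have [L2 L20 HL2] := poly_logistic_bounded (logistic_poly n.+2) eps0.
pose k := `|slope e|; have k0 : 0 <= k by exact: normr_ge0.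
have c0 := normr_ge0 c.
(* Up to the factor |c|, the three summands bound the weight and its first two derivatives along
   [e]; the mean value theorem gives the rest. *)
split => //; exists (`|c| * (L0 + L1 * k + L2 * k ^+ 2)).
  by rewrite mulr_ge0// !addr_ge0// mulr_ge0// exprn_ge0.
have kL1 : 0 <= L1 * k by exact: mulr_ge0.
have kL2 : 0 <= L2 * k ^+ 2 by rewrite mulr_ge0// exprn_ge0.
split.
- by move=> z; rewrite /weight normrM ler_wpM2l// (le_trans (HL0 _))// -addrA lerDl addr_ge0.
- move=> z; rewrite /weight !normrM -mulrA ler_wpM2l// -/k mulrC.
  by rewrite (le_trans (ler_wpM2r k0 (HL1 _)))//; lra.
- move=> h z /andP[h0 h1]; rewrite /weight -mulrBr normrM -mulrA ler_wpM2l//.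
  rewrite phase_slide (le_trans (is_derive_lipschitz (dq n) HL1 _ _))//.
  rewrite addrAC subrr add0r normrM (gtr0_norm h0) -/k mulrCA mulrC ler_wpM2r ?(ltW h0)//.
  by lra.
- move=> h z /andP[h0 h1]; 
  have -> : weight n c (slide e h z) - weight n c z - h * weight n.+1 (c * slope e) z =
     c * ((logistic_poly n).[logistic eps (phase z + h * slope e)] -
     (logistic_poly n).[logistic eps (phase z)] - h * slope e * (logistic_poly n.+1).[logistic eps (phase z)]).
    by rewrite /weight phase_slide; ring.
  rewrite normrM -[X in _ <= X]mulrA ler_wpM2l//.
  rewrite (le_trans (is_derive_taylor (dq n) (dq n.+1) HL2 _ _))//.
  rewrite exprMn -[slope e ^+ 2]real_normK ?num_real// -/k mulrCA mulrC ler_wpM2r ?exprn_ge0 ?(ltW h0)//.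
  by lra.
Qed.

Lemma weight0E c z : weight 0 c z = c * logistic eps (phase z).
Proof. by rewrite /weight /= hornerX. Qed.

Lemma weight1E c z : let P := logistic eps (phase z) in
  weight 1 c z = c * (P * (1 - eps * P)).
Proof.
rewrite /weight /logistic_poly/= /logistic_deriv derivX mul1r.
by rewrite hornerD hornerN hornerZ hornerX hornerXn; ring.
Qed.

(** Written in v = eps P, which lies in [0, 1], so that P''' is P times a polynomial in v and can be
    compared with P uniformly in [eps]. *)
Lemma weight3E c z : let P := logistic eps (phase z) in let v := eps * P in
  weight 3 c z = c * (P * (1 - v) * (1 - 6 * v + 6 * v ^+ 2)).
Proof.
rewrite /weight /logistic_poly/= /logistic_deriv derivX mul1r; congr (_ * _).
rewrite !(mul1r, mulr1, derivM, derivB, derivD, derivZ, derivX, derivXn, derivC, derivMn) /=.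
rewrite !(hornerM, hornerD, hornerN, hornerZ, hornerX, hornerXn, hornerC, hornerMn) /=.
ring.
Qed.

End logistic.

(** * Multipliers bounded almost everywhere *)

Section bounded_multipliers.
Context (R : realType).
Notation leb2 := (leb2 R).
Notation n2 := (n2 leb2).
Notation sqint := (sqint leb2).
Notation intble := (intble leb2).
Implicit Types (f g p q w : plane R -> R) (e : R * R) (h M : R).

(** Truncation turns an almost everywhere bound by M into an everywhere bound, at the price of a
    change on a null set. *)
Definition clip M (x : R) := Num.max (- M) (Num.min M x).

Lemma abs_clip M x : 0 <= M -> `|clip M x| <= M.
Proof.
move=> M0; rewrite ler_norml /clip le_max lexx/= ge_max ge_min lexx/= andbT; lra.
Qed.

Lemma clip_id M x : `|x| <= M -> clip M x = x.
Proof. by rewrite ler_norml /clip => /andP[Mx xM]; rewrite min_r// max_r. Qed.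

Lemma measurable_clip M f : measurable_fun setT f ->
  measurable_fun setT (fun z => clip M (f z)).
Proof. by move=> mf; apply: measurable_maxr => //; exact: measurable_minr. Qed.

Lemma sqint_ae_bounded_mull w f M : 0 <= M -> measurable_fun setT w ->
  {ae leb2, forall z, `|w z| <= M} -> sqint f ->
  sqint (fun z => w z * f z) /\ n2 (fun z => w z * f z) <= M * n2 f.
Proof.
move=> M0 mw wM sf; have mc := measurable_clip M mw.
have cM z : `|clip M (w z)| <= M by exact: abs_clip.
have sc := sqint_bounded_mull mc cM sf.
have E : {ae leb2, forall z, clip M (w z) * f z = w z * f z}.
  by apply: filterS wM => z /clip_id ->.
have mwf : measurable_fun setT (fun z => w z * f z).
  by apply: measurable_funM => //; case: sf.
split; first exact: ae_eq_sqint E sc.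
rewrite -(ae_eq_n2 _ mwf E); last by case: sc.
exact: n2_bounded_mull.
Qed.

Lemma ae_slide e h (P : plane R -> Prop) : {ae leb2, forall z, P z} ->
  {ae leb2, forall z, P (slide e h z)}.
Proof.
have mpS := mp_slide e h; move=> [N [mN N0 HN]]; exists (slide e h @^-1` N); split.
- by rewrite -[X in measurable X]setTI; apply: mpS.1.
- by rewrite mpS.2.
- by move=> z nz; exact: HN.
Qed.

(** With F = f(z + h e), the remainder F^2 - f^2 - 2 h f f' is (F + f)(F - f - h f') + h f' (F - f).
    The sup bounds on f and f' make both terms O(h^2) in L^2. *)
Lemma sderiv_sqr e f f' M : sqint f -> sqint f' -> 0 <= M ->
  {ae leb2, forall z, `|f z| <= M} -> {ae leb2, forall z, `|f' z| <= M} ->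
  sderiv e f f' -> sderiv e (fun z => f z * f z) (fun z => 2 * (f z * f' z)).
Proof.
move=> sf sf' M0 fM f'M sd; have [C C0 HC] := sd.
have [L L0 HL] := sderiv_lipschitz sf sf' sd.
exists (2 * M * C + M * L) => [|h h01].
  by rewrite addr_ge0// !mulr_ge0.
have /andP[h0 h1] := h01.
have sfh := sqint_slide e h sf.
have mf : measurable_fun setT f by case: sf.
have mf' : measurable_fun setT f' by case: sf'.
have mfh : measurable_fun setT (fun z => f (slide e h z)) by case: sfh.
have sD : sqint (fun z => f (slide e h z) - f z) by exact: sqintB.
have sR : sqint (fun z => f (slide e h z) - f z - h * f' z).
  by apply: sqintB => //; exact: sqintZ.
have [s1 n1] : sqint (fun z => (f (slide e h z) + f z) * (f (slide e h z) - f z - h * f' z)) /\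
    n2 (fun z => (f (slide e h z) + f z) * (f (slide e h z) - f z - h * f' z)) <=
    2 * M * n2 (fun z => f (slide e h z) - f z - h * f' z).
  apply: sqint_ae_bounded_mull => //; first by rewrite mulr_ge0.
    exact: measurable_funD.
  apply: filterS2 (ae_slide e h fM) fM => z a b.
  by rewrite (le_trans (ler_normD _ _))// mulrDl !mul1r lerD.
have [s2 n2'] := sqint_ae_bounded_mull M0 mf' f'M sD.
rewrite (_ : (fun z => _) = (fun z => (f (slide e h z) + f z) * (f (slide e h z) - f z - h * f' z)
   + h * (f' z * (f (slide e h z) - f z)))); last first.
  by apply/funext => z; ring.
rewrite (le_trans (n2D s1 (sqintZ h s2)))// n2Z// gtr0_norm// mulrDl lerD//.
  by rewrite (le_trans n1)// -[leRHS]mulrA ler_wpM2l ?mulr_ge0 ?HC.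
rewrite (le_trans (ler_wpM2l (ltW h0) n2'))//.
have := HL h h01; have := n2_ge0 leb2 (fun z => f (slide e h z) - f z).
move: (n2 _) => N N0 NL.
rewrite (_ : _ * h ^+ 2 = h * (M * (L * h))); last by ring.
by rewrite ler_wpM2l ?(ltW h0)// ler_wpM2l.
Qed.

Lemma ae_le_int f g : intble f -> intble g -> {ae leb2, forall z, f z <= g z} ->
  \int[leb2]_z f z <= \int[leb2]_z g z.
Proof.
move=> sf sg fg.
have mM : measurable_fun setT (fun z => Num.max (f z) (g z)).
  by apply: measurable_maxr; [exact: intble_measurable sf|exact: intble_measurable sg].
have E : {ae leb2, forall z, Num.max (f z) (g z) = g z}.
  by apply: filterS fg => z /max_r.
rewrite -(ae_eq_int mM (intble_measurable sg) E).
apply: le_int => //; last by move=> z; rewrite le_max lexx.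
apply: (le_intble mM _ (intbleD (intble_abs sf) (intble_abs sg))) => z.
rewrite [leRHS]ger0_norm ?addr_ge0//; case: (leP (f z)) => _.
  by rewrite lerDr.
by rewrite lerDl.
Qed.

End bounded_multipliers.

(** * The weighted energy identity and inequality *)

Section energy.
Context (R : realType).
Notation leb2 := (leb2 R).
Notation n2 := (n2 leb2).
Notation sqint := (sqint leb2).
Notation intble := (intble leb2).

(** [D a b] stands for the derivative of order (a, b). Its links to the next orders are kept as
    increment formulas, the only form in which they are used. *)
Definition sobolev_family (m : nat) (D : nat -> nat -> plane R -> R) :=
  [/\ forall a b, (a + b <= m)%N -> sqint (D a b),
      forall a b, (a + b < m)%N -> segment_formula (@ex R) (D a b) (D a.+1 b) &
      forall a b, (a + b < m)%N -> segment_formula (@ey R) (D a b) (D a b.+1)].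

Variables (D : nat -> nat -> plane R -> R) (M : R).
Hypotheses (HD : sobolev_family 4 D) (M0 : 0 <= M).
Hypotheses (DM : {ae leb2, forall z, `|D 0 0 z| <= M})
  (DxM : {ae leb2, forall z, `|D 1 0 z| <= M}).

Let sD a b : (a + b <= 4)%N -> sqint (D a b).
Proof. by case: HD => + _ _; exact. Qed.

(** A rate for the difference quotients of [D a b] costs two further derivatives. Order 4 therefore
    allows differentiation of orders up to 2, just enough to reach u_xxx and u_xyy. *)
Let sx a b : (a + b <= 2)%N -> sderiv (@ex R) (D a b) (D a.+1 b).
Proof.
case: HD => H1 H2 _ ab; apply: (@segment_formula_sderiv _ _ _ _ (D a.+2 b)).
- by apply: H1; rewrite (leq_trans ab).
- by apply: H1; rewrite addSn (leq_ltn_trans ab).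
- by apply: H1; rewrite !addSn.
- by apply: H2; rewrite (leq_ltn_trans ab).
- by apply: H2; rewrite addSn ltnS (leq_ltn_trans ab).
Qed.

Let sy a b : (a + b <= 2)%N -> sderiv (@ey R) (D a b) (D a b.+1).
Proof.
case: HD => H1 _ H2 ab; apply: (@segment_formula_sderiv _ _ _ _ (D a b.+2)).
- by apply: H1; rewrite (leq_trans ab).
- by apply: H1; rewrite addnS (leq_ltn_trans ab).
- by apply: H1; rewrite !addnS.
- by apply: H2; rewrite (leq_ltn_trans ab).
- by apply: H2; rewrite addnS ltnS (leq_ltn_trans ab).
Qed.

Variables (eps A B : R).
Hypothesis eps0 : 0 < eps.
Notation W := (weight eps A B).

Let gx n c : good_weight (@ex R) (W n c) (W n.+1 (c * A)).
Proof.
have := good_weight_weight A B eps0 (@ex R) n c.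
by rewrite /slope /= mulr1 mulr0 addr0.
Qed.

Let gy n c : good_weight (@ey R) (W n c) (W n.+1 (c * B)).
Proof.
have := good_weight_weight A B eps0 (@ey R) n c.
by rewrite /slope /= mulr1 mulr0 add0r.
Qed.

Notation J p q w := (\int[leb2]_z (p z * q z * w z)).

Let JC (p q w : plane R -> R) : J p q w = J q p w.
Proof. by apply: eq_int => z; ring. Qed.

(** Derivatives are moved off the third order factors until only squares of u, products of first
    derivatives and the cube of u remain. *)
Lemma energy_identity :
  2 * (J (D 3 0) (D 0 0) (W 0 1) + J (D 1 2) (D 0 0) (W 0 1)
       + J (fun z => D 0 0 z * D 1 0 z) (D 0 0) (W 0 1)) =
  3 * J (D 1 0) (D 1 0) (W 1 A) + J (D 0 1) (D 0 1) (W 1 A)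
  + 2 * J (D 1 0) (D 0 1) (W 1 B)
  - J (D 0 0) (D 0 0) (W 3 (A ^+ 3)) - J (D 0 0) (D 0 0) (W 3 (A * B ^+ 2))
  - 2 / 3 * J (fun z => D 0 0 z * D 0 0 z) (D 0 0) (W 1 A).
Proof.
have IX a b a' b' n c : (a + b <= 2)%N -> (a' + b' <= 2)%N ->
    J (D a.+1 b) (D a' b') (W n c) + J (D a b) (D a'.+1 b') (W n c)
    + J (D a b) (D a' b') (W n.+1 (c * A)) = 0.
  move=> ab ab'; apply: weighted_by_parts (gx n c); try exact: sx.
  - by apply: sD; rewrite (leq_trans ab).
  - by apply: sD; rewrite addSn (leq_ltn_trans ab).
  - by apply: sD; rewrite (leq_trans ab').
  - by apply: sD; rewrite addSn (leq_ltn_trans ab').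
have IY a b a' b' n c : (a + b <= 2)%N -> (a' + b' <= 2)%N ->
    J (D a b.+1) (D a' b') (W n c) + J (D a b) (D a' b'.+1) (W n c)
    + J (D a b) (D a' b') (W n.+1 (c * B)) = 0.
  move=> ab ab'; apply: weighted_by_parts (gy n c); try exact: sy.
  - by apply: sD; rewrite (leq_trans ab).
  - by apply: sD; rewrite addnS (leq_ltn_trans ab).
  - by apply: sD; rewrite (leq_trans ab').
  - by apply: sD; rewrite addnS (leq_ltn_trans ab').
(* [e1] to [e4] reduce the u_xxx term and [e5] to [e8] the u_xyy term, derivatives passing to the
   weight one at a time. *)
have e1 := IX 2 0 0 0 0%N 1 isT isT.
have e2 := IX 1 0 1 0 0%N 1 isT isT.
have e3 := IX 1 0 0 0 1%N A isT isT.
have e4 := IX 0 0 0 0 2%N (A * A) isT isT.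
have e5 := IY 1 1 0 0 0%N 1 isT isT.
have e6 := IX 0 1 0 1 0%N 1 isT isT.
have e7 := IX 0 1 0 0 1%N B isT isT.
have e8 := IY 0 0 0 0 2%N (B * A) isT isT.
have [su sux] := (sD (isT : (0 + 0 <= 4)%N), sD (isT : (1 + 0 <= 4)%N)).
have [mu mux] : measurable_fun setT (D 0 0) /\ measurable_fun setT (D 1 0).
  by case: su sux => ? _ [].
have [suu _] := sqint_ae_bounded_mull M0 mu DM su.
have [suux _] := sqint_ae_bounded_mull M0 mu DM sux.
(* With (u^2)_x = 2 u u_x, this says that three times the integral of u^2 u_x w is minus the
   integral of u^3 w_x, whence the coefficient 2/3. *)
have e9 : J (fun z => 2 * (D 0 0 z * D 1 0 z)) (D 0 0) (W 0 1) +
    J (fun z => D 0 0 z * D 0 0 z) (D 1 0) (W 0 1) +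
    J (fun z => D 0 0 z * D 0 0 z) (D 0 0) (W 1 (1 * A)) = 0.
  apply: weighted_by_parts (gx 0%N 1) => //.
  - exact: sqintZ.
  - exact: (sderiv_sqr su sux M0 DM DxM (sx (isT : (0 + 0 <= 2)%N))).
  - exact: (sx (isT : (0 + 0 <= 2)%N)).
have [mw _ [L L0 [wL _ _ _]]] := gx 0%N 1.
have e9a : J (fun z => 2 * (D 0 0 z * D 1 0 z)) (D 0 0) (W 0 1) =
    2 * J (fun z => D 0 0 z * D 1 0 z) (D 0 0) (W 0 1).
  rewrite -intZ; last exact: intble_mul3 wL.
  by apply: eq_int => z; ring.
have e9b : J (fun z => D 0 0 z * D 0 0 z) (D 1 0) (W 0 1) =
    J (fun z => D 0 0 z * D 1 0 z) (D 0 0) (W 0 1).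
  by apply: eq_int => z; ring.
rewrite !mul1r in e1 e2 e5 e6 e9.
rewrite (_ : A * A * A = A ^+ 3) in e4; last by ring.
rewrite (_ : B * A * B = A * B ^+ 2) in e8; last by ring.
have c1 := JC (D 1 0) (D 2 0) (W 0 1); have c2 := JC (D 0 0) (D 1 0) (W 2 (A * A)).
have c3 := JC (D 0 1) (D 1 1) (W 0 1); have c4 := JC (D 0 1) (D 1 0) (W 1 B).
have c5 := JC (D 0 0) (D 0 1) (W 2 (B * A)).
rewrite e9a e9b in e9.
rewrite c1 in e2; rewrite c2 in e4; rewrite c3 in e6; rewrite c4 in e7; rewrite c5 in e8.
move: e1 e2 e3 e4 e5 e6 e7 e8 e9; clear.
do ![move: (Rintegral _ _ _) => ?]; lra.
Qed.

(* |A| = |B| = c, hence 3 X^2 + Y^2 + 2 s t X Y >= 0 absorbs the gradient terms. *)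
Lemma energy_inequality (s t c : R) : s ^+ 2 = 1 -> t ^+ 2 = 1 -> 0 < c ->
  A = s * c -> B = t * c ->
  - s * (2 * (J (D 3 0) (D 0 0) (W 0 1) + J (D 1 2) (D 0 0) (W 0 1)
       + J (fun z => D 0 0 z * D 1 0 z) (D 0 0) (W 0 1))) <=
  (2 * c ^+ 3 + 2 / 3 * c * M) * J (D 0 0) (D 0 0) (W 0 1).
Proof.
move=> s2 t2 c0 EA EB; rewrite energy_identity.
have [su sux suy] := And3 (sD (isT : (0 + 0 <= 4)%N)) (sD (isT : (1 + 0 <= 4)%N))
  (sD (isT : (0 + 1 <= 4)%N)).
have mu : measurable_fun setT (D 0 0) by case: su.
have [suu _] := sqint_ae_bounded_mull M0 mu DM su.
have iW p q n d : sqint p -> sqint q -> intble (fun z => p z * q z * W n d z).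
  move=> sp sq; have [mw _ [L L0 [wL _ _ _]]] := gx n d.
  exact: intble_mul3 wL.
have P0 z : 0 < logistic eps (phase A B z) by exact: logistic_gt0.
have vP z := logistic_le (phase A B z) eps0.
have T1 : 0 <= s * (3 * J (D 1 0) (D 1 0) (W 1 A) + J (D 0 1) (D 0 1) (W 1 A)
    + 2 * J (D 1 0) (D 0 1) (W 1 B)).
  have i1 := iW _ _ 1%N A sux sux; have i2 := iW _ _ 1%N A suy suy.
  have i3 := iW _ _ 1%N B sux suy.
  rewrite -(intZ 3 i1) -(intZ 2 i3) -intD//; last exact: intbleZ.
  rewrite -intD; [|by apply: intbleD => //; exact: intbleZ|exact: intbleZ].
  rewrite -intZ; last first.
    by apply: intbleD; [apply: intbleD => //; exact: intbleZ|exact: intbleZ].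
  apply: Rintegral_ge0 => z _; rewrite !weight1E /=.
  move: (vP z) (P0 z); move: (logistic _ _) => P v1 p0; rewrite EA EB.
  set p := D 1 0 z; set q := D 0 1 z.
  (* A sum of squares times c P' >= 0; the middle coefficient vanishes because s^2 = t^2. *)
  rewrite (_ : _ * _ = c * (P * (1 - eps * P)) *
    (2 * s ^+ 2 * p ^+ 2 + (s ^+ 2 - t ^+ 2) * q ^+ 2 + (s * p + t * q) ^+ 2)); last by ring.
  apply: mulr_ge0; first by rewrite !mulr_ge0 ?subr_ge0 ?(ltW c0) ?(ltW p0).
  by rewrite s2 t2 subrr mul0r addr0 mulr1 addr_ge0 ?sqr_ge0// mulr_ge0 ?sqr_ge0.
have T2 : s * (J (D 0 0) (D 0 0) (W 3 (A ^+ 3)) + J (D 0 0) (D 0 0) (W 3 (A * B ^+ 2))) <=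
    2 * c ^+ 3 * J (D 0 0) (D 0 0) (W 0 1).
  have i1 := iW _ _ 3%N (A ^+ 3) su su; have i2 := iW _ _ 3%N (A * B ^+ 2) su su.
  have i3 := iW _ _ 0%N 1 su su.
  rewrite -intD// -intZ; last exact: intbleD.
  rewrite -intZ//; apply: le_int => [||z]; [exact/intbleZ/intbleD|exact: intbleZ|].
  rewrite !weight3E weight0E /=.
  move: (vP z) (P0 z); move: (logistic _ _) => P v1 p0; rewrite EA EB; set p := D 0 0 z.
  (* Both s A^3 and s A B^2 equal c^3 > 0, so an upper bound for P''' suffices: (1 - v)(1 - 6 v + 6
     v^2) <= 1 for v >= 0. *)
  rewrite (_ : s * _ = 2 * c ^+ 3 * (p ^+ 2 * P) * ((s ^+ 2) * (s ^+ 2 + t ^+ 2) / 2 *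
    ((1 - eps * P) * (1 - 6 * (eps * P) + 6 * (eps * P) ^+ 2)))); last by field.
  rewrite (_ : _ * (_ * (1 * P)) = 2 * c ^+ 3 * (p ^+ 2 * P) * 1); last by ring.
  have c3 : 0 <= c ^+ 3 by rewrite exprn_ge0// ltW.
  apply: ler_wpM2l; first by
    apply: mulr_ge0; [exact: mulr_ge0|apply: mulr_ge0; [exact: sqr_ge0|exact: ltW]].
  have v0 : 0 <= eps * P by rewrite mulr_ge0// ltW.
  rewrite s2 t2 mul1r -[1 + 1]/(2%:R) divff// mul1r.
  rewrite -subr_ge0; move: (eps * P) v0 v1 => v v0 v1.
  rewrite (_ : _ - _ = v * (6 * (v - 1) ^+ 2 + 1)); last by ring.
  by rewrite mulr_ge0// addr_ge0// mulr_ge0// sqr_ge0.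
have T3 : s * J (fun z => D 0 0 z * D 0 0 z) (D 0 0) (W 1 A) <=
    c * M * J (D 0 0) (D 0 0) (W 0 1).
  have i1 := iW _ _ 1%N A suu su; have i3 := iW _ _ 0%N 1 su su.
  rewrite -intZ// -intZ//; apply: ae_le_int; [exact: intbleZ|exact: intbleZ|].
  apply: filterS DM => z; rewrite weight1E weight0E ler_norml /= => /andP[].
  move: (vP z) (P0 z); move: (logistic _ _) => P v1 p0; rewrite EA; set p := D 0 0 z => pM Mp.
  rewrite (_ : s * _ = c * (p ^+ 2 * P) * (s ^+ 2 * p * (1 - eps * P))); last by ring.
  rewrite (_ : _ * (_ * (1 * P)) = c * (p ^+ 2 * P) * M); last by ring.
  apply: ler_wpM2l.
    by apply: mulr_ge0; [exact: ltW|apply: mulr_ge0; [exact: sqr_ge0|exact: ltW]].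
  have v0 : 0 <= eps * P by rewrite mulr_ge0// ltW.
  rewrite s2 mul1r; move: (eps * P) v0 v1 => v v0 v1; nra.
have E (x1 x2 x3 x4 x5 x6 : R) : - s * (3 * x1 + x2 + 2 * x3 - x4 - x5 - 2 / 3 * x6) =
    - (s * (3 * x1 + x2 + 2 * x3)) + s * (x4 + x5) + 2 / 3 * (s * x6) by field.
rewrite E [X in _ <= X]mulrDl; apply: lerD.
  by rewrite -[X in _ <= X]add0r; apply: lerD => //; rewrite oppr_le0.
have H : 0 <= 2 / 3 :> R by rewrite divr_ge0.
by have := ler_wpM2l H T3; rewrite !mulrA.
Qed.

End energy.

(** * Gronwall's inequality in both time directions *)

Section gronwall.
Context (R : realType).
Implicit Types (E : R -> R) (s K t : R).

(** Increments stay in [0, 1], so the derivative is one-sided at the endpoints and values of E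
    outside the interval are not consulted. *)
Definition has_derivative_within E t d := forall eps, 0 < eps ->
  exists2 del, 0 < del & forall t', 0 <= t' <= 1 -> `|t' - t| < del ->
    `|E t' - E t - (t' - t) * d| <= eps * `|t' - t|.

Lemma has_derivative_within_continuous E :
  (forall t, 0 <= t <= 1 -> exists d, has_derivative_within E t d) ->
  {within `[0, 1], continuous E}.
Proof.
move=> dE; apply/subspace_continuousP => t /=; rewrite in_itv/= => t01.
have [d Hd] := dE t t01; apply/cvgrPdist_le => e e0.
have [del del0 Hdel] := Hd 1 ltr01.
pose r := Num.min del (e / (1 + `|d|)).
have D0 : 0 < 1 + `|d| by rewrite ltr_pwDl.
have r0 : 0 < r by rewrite lt_min del0 divr_gt0.
rewrite near_withinE; near=> t'; rewrite /= in_itv/= => t'01.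
have tt' : `|t' - t| < r by near: t'; near do rewrite distrC; exact: cvgr_dist_lt.
move: tt'; rewrite lt_min ltr_pdivlMr// => /andP[tdel te].
have H := Hdel t' t'01 tdel; rewrite mul1r in H.
suff : `|E t - E t'| <= e by [].
rewrite distrC (le_trans _ (ltW te))// (_ : E t' - E t = (E t' - E t - (t' - t) * d) + (t' - t) * d); last by ring.
by rewrite (le_trans (ler_normD _ _))// mulrDr mulr1 lerD// normrM.
Unshelve. all: by end_near. Qed.

Lemma has_derivative_within_is_derive E t d : 0 < t < 1 ->
  has_derivative_within E t d -> is_derive t 1 E d.
Proof.
move=> /andP[t0 t1] Hd.
have cv : h^-1 *: (E (h *: (1 : R) + t) - E t) @[h --> 0^'] --> d.
  apply/cvgrPdist_le => e e0; have [del del0 Hdel] := Hd e e0.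
  near=> h; have h0 : h != 0 by near: h; exact: nbhs_dnbhs_neq.
  have hd : `|h| < Num.min del (Num.min t (1 - t)).
    by near: h; apply: dnbhs0_lt; rewrite !lt_min del0 t0 subr_gt0 t1.
  move: hd; rewrite !lt_min => /and3P[hdel ht h1t].
  have := Hdel (h *: 1 + t); rewrite /GRing.scale/= mulr1 addrK => H.
  have H' : `|E (h + t) - E t - h * d| <= e * `|h|.
    apply: H => //; move: ht h1t; rewrite !ltr_norml; lra.
  rewrite distrC -(@ler_pM2r _ `|h|) ?normr_gt0// -normrM.
  by rewrite mulrBl mulrAC mulVf// mul1r [d * h]mulrC.
split; first by apply/cvg_ex; exists d.
exact/cvg_lim.
Unshelve. all: by end_near.
Qed.

(** F(r) = E(r) e^(-s K r) satisfies s F' <= 0 inside the interval. For s = 1 it is nonincreasing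
    and is compared with r = 0, for s = -1 nondecreasing and compared with r = 1. *)
Lemma gronwall E s K : (s = 1 \/ s = -1) -> 0 <= K -> (forall t, 0 <= E t) ->
  (forall t, 0 <= t <= 1 ->
    exists2 d, has_derivative_within E t d & s * d <= K * E t) ->
  forall t, 0 <= t <= 1 -> E t <= expR K * (if s == 1 then E 0 else E 1).
Proof.
move=> s1 K0 E0 HE t t01.
have cE : {within `[0, 1], continuous E}.
  by apply: has_derivative_within_continuous => r /HE [d dd _]; exists d.
have ss : s * s = 1 by case: s1 => ->; rewrite ?mulr1// mulrNN mulr1.
pose c := - s * K.
pose F r := E r * expR (c * r).
have dexp (r : R) : is_derive r 1 (fun r : R => expR (c * r)) (expR (c * r) * c).
  have := is_derive_comp_fun (is_derive_affine c 0 r) (is_derive_expR (c * r + 0)).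
  by under [X in is_derive _ _ X _]eq_fun do rewrite addr0; rewrite addr0.
have cF : {within `[0, 1], continuous F}.
  rewrite (_ : F = E \* (fun r => expR (c * r)))// => r; apply: cvgM; first exact: cE.
  apply: (@continuous_subspaceT _ _ _ (fun r => expR (c * r))) => q;
    apply/differentiable_continuous/derivable1_diffP.
  by have [] := dexp q.
have dF (r : R) : 0 < r < 1 -> exists2 d, is_derive r 1 F d & s * d <= 0.
  move=> /andP[r0 r1]; have [|d dd sd] := HE r; first by rewrite !ltW.
  have dE : is_derive r 1 E d by apply: has_derivative_within_is_derive => //; rewrite r0.
  exists (d * expR (c * r) + E r * (expR (c * r) * c)).
    exact: is_deriveM_fun.
  rewrite (_ : s * _ = (s * d + (s * c) * E r) * expR (c * r)); last by ring.
  by rewrite pmulr_lle0 ?expR_gt0// /c mulNr mulrN mulrA ss mul1r mulNr subr_le0.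
have derF (r : R) : r \in `]0, 1[ -> derivable F r 1.
  by rewrite in_itv/= => /dF [d [? _] _].
have derF1 r : r \in `]0, 1[ -> s * derive1 F r <= 0.
  by rewrite in_itv/= => /dF [d dd]; rewrite derive1E (@derive_val _ _ _ _ _ _ _ dd).
have /andP[t0 t1] := t01.
have eF r : E r = F r * expR (s * K * r).
  by rewrite /F /c -mulrA -expRD !mulNr addNr expR0 mulr1.
case: s1 => s1; rewrite s1 ?eqxx.
  have Ft : F t <= F 0.
    apply: (@ler0_derive1_nincr _ F 0 1) => // r /derF1.
    by rewrite s1 mul1r.
  rewrite eF s1 mul1r mulrC; apply: (@le_trans _ _ (expR (K * t) * F 0)).
    by rewrite ler_wpM2l ?expR_ge0.
  rewrite /F mulr0 expR0 mulr1 ler_wpM2r// ler_expR ler_piMr//.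
have -> : (-1 == 1 :> R) = false by apply/negbTE; rewrite lt_eqF// ltrN10// ltr01.
have Ft : F t <= F 1.
  apply: (@ger0_derive1_ndecr _ F 0 1) => // r /derF1.
  by rewrite s1 mulN1r oppr_le0.
rewrite eF s1 mulrC; apply: (@le_trans _ _ (expR (-1 * K * t) * F 1)).
  by rewrite ler_wpM2l ?expR_ge0.
have F1 : F 1 = expR K * E 1 by rewrite /F /c s1 opprK mul1r mulr1 mulrC.
rewrite F1 ler_piMl ?mulr_ge0 ?expR_ge0// expR_le1.
by rewrite mulN1r mulNr oppr_le0 mulr_ge0.
Qed.

End gronwall.

(** * Weighted bounds for a derivative from weighted bounds for the function *)

Section interpolation.
Context (R : realType).
Notation leb2 := (leb2 R).
Notation n2 := (n2 leb2).
Notation sqint := (sqint leb2).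
Notation intble := (intble leb2).
Implicit Types (f g k : plane R -> R) (e : R * R) (h a b eps : R).

Lemma abs_expR_sub1 (t : R) : `|expR t - 1| <= `|t| * expR `|t|.
Proof.
have [t0|t0] := leP 0 t.
  have t1 : 1 <= expR t by rewrite -[X in X <= _]expR0 ler_expR.
  rewrite (ger0_norm t0) ger0_norm ?subr_ge0//.
  have := expR_ge1Dx (- t); rewrite expRN => H.
  have e0 := expR_gt0 t; have := mulVf (lt0r_neq0 e0).
  have : 0 <= (expR t) * ((expR t)^-1 - (1 - t)).
    by rewrite mulr_ge0 ?(ltW e0)// subr_ge0.
  by move: (expR t)^-1 => v; nra.
have H := expR_ge1Dx t; have : expR t <= 1 by rewrite expR_le1 ltW.
move=> e1; rewrite ler0_norm ?subr_le0// (ltr0_norm t0) opprB.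
have : 1 <= expR (- t) by rewrite -expR0 ler_expR oppr_ge0 ltW.
nra.
Qed.

(** The increment is exactly (e^t - 1) P(x) / (1 + eps e^(x + t)). The relative variation of P is
    thus controlled by that of the exponential, uniformly in [eps]. *)
Lemma logistic_shift eps x t : 0 < eps ->
  `|logistic eps (x + t) - logistic eps x| <= `|expR t - 1| * logistic eps x.
Proof.
move=> e0; have D1 := logistic_den x e0; have D2 := logistic_den (x + t) e0.
rewrite /logistic in D2 *; rewrite expRD in D2 *.
have -> : expR x * expR t / (1 + eps * (expR x * expR t)) - expR x / (1 + eps * expR x) =
  (expR t - 1) * (expR x / (1 + eps * expR x)) / (1 + eps * (expR x * expR t)).
  by field; rewrite !lt0r_neq0.
rewrite normrM normrM -[leRHS]mulr1 [`|expR x / _|]ger0_norm; last first.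
  by rewrite divr_ge0 ?expR_ge0// ltW.
apply: ler_wpM2l; first by rewrite mulr_ge0// divr_ge0 ?expR_ge0// ltW.
rewrite ger0_norm ?invr_ge0 ?(ltW D2)// invf_le1// lerDl.
by rewrite !mulr_ge0 ?expR_ge0// ltW.
Qed.

(** Bounds |e^(h s) - 1| / |h| for 0 < |h| <= 1, where s is the slope of the phase along [e]. *)
Definition slope_const a b e := `|slope a b e| * expR `|slope a b e|.

(** Summation by parts on difference quotients, with the weight and [g] shifted by - h e. The
    increments of the weight are bounded relative to the weight, so [eps] appears on the right only
    inside the norm of the weighted [f]. *)
Lemma weighted_interpolation e a b eps f g k : 0 < eps ->
  sqint f -> sqint g -> sqint k ->
  segment_formula e f g -> segment_formula e g k ->
  \int[leb2]_z (g z * g z * logistic eps (phase a b z)) <=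
  ((1 + slope_const a b e) * n2 k + slope_const a b e * n2 g) *
    n2 (fun z => logistic eps (phase a b z) * f z).
Proof.
move=> e0 sf sg sk fg gk; set w := fun z => logistic eps (phase a b z).
set c := slope_const a b e.
have [C C0 HC] := segment_formula_sderiv sf sg sk fg gk.
have c0 : 0 <= c by rewrite mulr_ge0// expR_ge0.
have wE : weight eps a b 0 1 = w by apply/funext => z; rewrite weight0E mul1r.
have := good_weight_weight a b e0 e 0 1; rewrite wE => -[mw _ [L L0 [wL _ _ _]]].
have mf : measurable_fun setT f by case: sf.
have mg : measurable_fun setT g by case: sg.
have w0 z : 0 < w z by exact: logistic_gt0.
have swf : sqint (fun z => w z * f z) := sqint_bounded_mull mw wL sf.
have swg : sqint (fun z => w z * g z) := sqint_bounded_mull mw wL sg.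
set N := n2 (fun z => w z * f z); have N0 : 0 <= N by exact: n2_ge0.
have i1 := intble_mul3 sg sg mw wL.
set I1 := \int[leb2]_z (g z * g z * w z).
apply/ler_addgt0Pl => d d0.
(* [K2] depends on [eps] but enters with a factor h; choosing h with h K2 <= d, for arbitrary d > 0,
   removes it. *)
pose K2 := C * n2 (fun z => w z * g z).
have K20 : 0 <= K2 by rewrite mulr_ge0// n2_ge0.
pose h := Num.min 1 (d / (K2 + 1)).
have K21 : 0 < K2 + 1 by rewrite ltr_wpDl.
have h0 : 0 < h by rewrite lt_min ltr01 divr_gt0.
have h1 : h <= 1 by rewrite ge_min lexx.
have hd : h * K2 <= d.
  apply: (@le_trans _ _ (h * (K2 + 1))); first by rewrite ler_wpM2l ?(ltW h0)// lerDl.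
  by rewrite -ler_pdivlMr// ge_min lexx orbT.
pose wm z := w (slide e (- h) z); pose gm z := g (slide e (- h) z).
have shift_w z : `|wm z - w z| <= h * c * w z.
  rewrite /wm /w phase_slide (le_trans (logistic_shift _ _ e0))// ler_wpM2r ?(ltW (w0 z))//.
  rewrite (le_trans (abs_expR_sub1 _))// mulNr normrN normrM (gtr0_norm h0) -mulrA.
  rewrite ler_wpM2l ?(ltW h0)// ler_wpM2l// ler_expR ler_piMl//.
have wm_le z : `|wm z| <= (1 + c) * w z.
  have := shift_w z; have : h * c * w z <= c * w z.
    by rewrite ler_wpM2r ?(ltW (w0 z))// ler_piMl.
  have := ler_normD (wm z - w z) (w z); rewrite subrK (gtr0_norm (w0 z)).
  rewrite mulrDl mul1r; lra.
have mwm : measurable_fun setT wm := mp_measurable (mp_slide e (- h)) mw.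
have sgm : sqint gm := sqint_slide e (- h) sg.
have sDg : sqint (fun z => gm z - g z) by exact: sqintB.
have swmf : sqint (fun z => wm z * f z).
  by apply: sqint_bounded_mull sf => // z; exact: wL.
have nwmf : n2 (fun z => wm z * f z) <= (1 + c) * N.
  rewrite -[1 + c]ger0_norm ?addr_ge0// -n2Z//; apply: le_n2; first by case: swmf.
    exact: sqintZ.
  move=> z; rewrite mulrA normrM [X in _ <= X]normrM ler_wpM2r//.
  by rewrite (le_trans (wm_le z))// ler_norm.
have mdw : measurable_fun setT (fun z => (wm z - w z) * f z).
  by apply: measurable_funM => //; exact: measurable_funB.
have sdwf : sqint (fun z => (wm z - w z) * f z).
  have := sqintB swmf swf; congr sqint; apply/funext => z; ring.
have ndwf : n2 (fun z => (wm z - w z) * f z) <= h * c * N.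
  have hc0 : 0 <= h * c by rewrite mulr_ge0// ltW.
  rewrite -[h * c]ger0_norm// -n2Z//; apply: le_n2 => //; first exact: sqintZ.
  move=> z; rewrite mulrA normrM [X in _ <= X]normrM ler_wpM2r//.
  by rewrite (le_trans (shift_w z))// ler_norm.
have nDg : n2 (fun z => gm z - g z) <= h * n2 k.
  rewrite -(mp_n2 (mp_slide e h) (_ : measurable_fun setT (fun z => gm z - g z)));
    last by case: sDg.
  rewrite -n2N (_ : (fun z => _) = (fun z => g (slide e h z) - g z)); last first.
    apply/funext => z; rewrite opprB /gm; congr (_ - g _).
    by case: z => x y; rewrite /slide/shift2/= !mulNr !addrK.
  exact: n2_slide_sub.
have sR : sqint (fun z => f (slide e h z) - f z - h * g z).
  apply: sqintB; last exact: sqintZ.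
  by apply: sqintB => //; exact: sqint_slide.
(* Translation turns f(z + h e) w g into f times the shifted w g; the change of w g is then split
   into an increment of g times the shifted w, and g times an increment of w. *)
have main : h * I1 = - (\int[leb2]_z ((f (slide e h z) - f z - h * g z) * (w z * g z)))
   + ((\int[leb2]_z ((gm z - g z) * (wm z * f z))) +
      (\int[leb2]_z (g z * ((wm z - w z) * f z)))).
  have j1 := intbleM sR swg; have j2 := intbleM sDg swmf; have j3 := intbleM sg sdwf.
  have mwg : measurable_fun setT (fun z => w z * g z) by case: swg.
  have sl := int_slide_mul e h mf mwg.
  have sfh := sqint_slide e h sf.
  have k1 := intbleM sfh swg; have k2 := intbleM sf (sqint_slide e (- h) swg).
  rewrite -(intD j2 j3) -(intZ h i1).
  rewrite [RHS]addrC; apply/eqP; rewrite -subr_eq0 opprB addrA -(intD (intbleZ h i1) j1).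
  rewrite -(intB (intbleD (intbleZ h i1) j1) (intbleD j2 j3)).
  move/eqP: sl; rewrite -subr_eq0 -(intB k1 k2) => /eqP <-; apply/eqP; apply: eq_int => z.
  by rewrite /gm /wm; ring.
rewrite -(@ler_pM2l _ h)// main.
have b1 := cauchy_schwarz sR swg; have b2 := cauchy_schwarz sDg swmf.
have b3 := cauchy_schwarz sg sdwf.
have h01 : 0 < h <= 1 by rewrite h0.
have b1' : n2 (fun z => f (slide e h z) - f z - h * g z) * n2 (fun z => w z * g z) <= h * d.
  apply: (@le_trans _ _ (C * h ^+ 2 * n2 (fun z => w z * g z))).
    by rewrite ler_wpM2r ?n2_ge0// HC.
  have -> : C * h ^+ 2 * n2 (fun z => w z * g z) = h * (h * K2).
    by rewrite /K2; move: (n2 _) => N'; ring.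
  by rewrite ler_wpM2l// ltW.
have b2' : n2 (fun z => gm z - g z) * n2 (fun z => wm z * f z) <= h * ((1 + c) * n2 k * N).
  apply: le_trans (ler_pM (n2_ge0 _ _) (n2_ge0 _ _) nDg nwmf) _.
  by rewrite le_eqVlt; apply/orP; left; apply/eqP; ring.
have b3' : n2 g * n2 (fun z => (wm z - w z) * f z) <= h * (c * n2 g * N).
  apply: le_trans (ler_wpM2l (n2_ge0 _ _) ndwf) _.
  by rewrite le_eqVlt; apply/orP; left; apply/eqP; ring.
rewrite (_ : h * _ = h * d + (h * ((1 + c) * n2 k * N) + h * (c * n2 g * N))); last by ring.
apply: lerD; first by rewrite (le_trans _ b1')// (le_trans _ b1)// -normrN ler_norm.
apply: lerD.
  exact: le_trans (le_trans (ler_norm _) b2) b2'.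
exact: le_trans (le_trans (ler_norm _) b3) b3'.
Qed.

Definition wint a b f : \bar R := (\int[leb2]_z (f z ^+ 2 * expR (phase a b z))%:E)%E.

Lemma measurable_expR_phase a b : measurable_fun setT (fun z => expR (phase a b z)).
Proof.
exact: (measurableT_comp (continuous_measurable_fun (@continuous_expR R)) (measurable_phase a b)).
Qed.

Lemma measurable_wint a b f : measurable_fun setT f ->
  measurable_fun setT (fun z => (f z ^+ 2 * expR (phase a b z))%:E).
Proof.
move=> mf; apply/measurable_EFinP; apply: measurable_funM; first exact: measurable_funX.
exact: measurable_expR_phase.
Qed.

Lemma wint_fun_ge0 a b f z : (0 <= (f z ^+ 2 * expR (phase a b z))%:E)%E.
Proof. by rewrite lee_fin mulr_ge0 ?sqr_ge0 ?expR_ge0. Qed.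

Lemma measurable_logistic_phase a b eps : 0 < eps ->
  measurable_fun setT (fun z => logistic eps (phase a b z)).
Proof.
move=> e0; have cW : continuous (logistic eps).
  move=> x; apply/differentiable_continuous/derivable1_diffP.
  by have [] := is_derive_logistic x e0.
exact: (measurableT_comp (continuous_measurable_fun cW) (measurable_phase a b)).
Qed.

Lemma logistic_bounded eps x : 0 < eps -> `|logistic eps x| <= eps^-1.
Proof.
move=> e0; rewrite gtr0_norm ?logistic_gt0// -[leRHS]mul1r ler_pdivlMr// mulrC.
exact: logistic_le.
Qed.

Lemma int_logistic_le a b eps f (K : R) : 0 < eps -> sqint f ->
  (wint a b f <= K%:E)%E ->
  \int[leb2]_z (f z * f z * logistic eps (phase a b z)) <= K.
Proof.
move=> e0 sf fK; have mf : measurable_fun setT f by case: sf.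
have mw := measurable_logistic_phase a b e0.
have i := intble_mul3 sf sf mw (fun z => logistic_bounded (phase a b z) e0).
rewrite -lee_fin EFin_Rintegral//; apply: le_trans fK; apply: ge0_le_integral => //.
- by move=> z _; rewrite lee_fin mulr_ge0 -?expr2 ?sqr_ge0 ?(ltW (logistic_gt0 _ e0)).
- by apply/measurable_EFinP; exact: (intble_measurable i).
- exact: measurable_wint.
- by move=> z _; rewrite lee_fin expr2 ler_wpM2l -?expr2 ?sqr_ge0// logistic_le_expR.
Qed.

Lemma n2_logistic_le a b eps f (B : R) : 0 < eps -> 0 <= B -> sqint f ->
  (wint (2 * a) (2 * b) f <= (B ^+ 2)%:E)%E ->
  n2 (fun z => logistic eps (phase a b z) * f z) <= B.
Proof.
move=> e0 B0 sf fB; have mf : measurable_fun setT f by case: sf.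
have mw := measurable_logistic_phase a b e0.
have sw := sqint_bounded_mull mw (fun z => logistic_bounded (phase a b z) e0) sf.
rewrite -ler_sqr ?nnegrE ?n2_ge0// sqr_n2 -lee_fin EFin_Rintegral; last exact: intble_sqr.
apply: le_trans fB; apply: ge0_le_integral => //.
- by move=> z _; rewrite lee_fin sqr_ge0.
- by apply/measurable_EFinP/measurable_funX; case: sw.
- exact: measurable_wint.
- move=> z _; rewrite lee_fin exprMn mulrC ler_wpM2l ?sqr_ge0//.
  rewrite (_ : phase (2 * a) (2 * b) z = phase a b z + phase a b z);
    last by rewrite /phase; ring.
  rewrite expRD expr2; have := logistic_le_expR (phase a b z) e0.
  by have := ltW (logistic_gt0 (phase a b z) e0) => l0 le; rewrite ler_pM.
Qed.

(** Monotone convergence along eps = 1/(n + 1): the regularised weights increase to the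
    exponential. *)
Lemma wint_le_limit a b f (K : R) : sqint f ->
  (forall eps, 0 < eps -> \int[leb2]_z (f z * f z * logistic eps (phase a b z)) <= K) ->
  (wint a b f <= K%:E)%E.
Proof.
move=> sf H; have mf : measurable_fun setT f by case: sf.
pose F n z := (f z * f z * logistic n.+1%:R^-1 (phase a b z))%:E.
have e0 n : 0 < n.+1%:R^-1 :> R by rewrite invr_gt0.
have i n := intble_mul3 sf sf (measurable_logistic_phase a b (e0 n))
  (fun z => logistic_bounded (phase a b z) (e0 n)).
have cvF : (\int[leb2]_z F n z @[n --> \oo] --> wint a b f)%E.
  have -> : wint a b f = (\int[leb2]_z limn (F ^~ z))%E.
    apply: eq_integral => z _; apply/esym/cvg_lim => //.
    apply: cvg_EFin; first exact: nearW.
    apply: cvgM; first exact: cvg_cst.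
    have -> : expR (phase a b z) = expR (phase a b z) / (1 + 0 * expR (phase a b z)).
      by rewrite mul0r addr0 divr1.
    apply: cvgM; first exact: cvg_cst.
    apply: cvgV; first by rewrite mul0r addr0 oner_neq0.
    apply: cvgD; first exact: cvg_cst.
    by apply: cvgM; [exact: cvg_harmonic|exact: cvg_cst].
  apply: cvg_monotone_convergence => //.
  - by move=> n; apply/measurable_EFinP; exact: (intble_measurable (i n)).
  - move=> n z _; rewrite lee_fin mulr_ge0 -?expr2 ?sqr_ge0//.
    exact/ltW/logistic_gt0.
  - move=> z _ n m nm; rewrite lee_fin ler_wpM2l -?expr2 ?sqr_ge0//.
    rewrite /logistic ler_wpM2l ?expR_ge0// lef_pV2 ?posrE ?logistic_den//.
    rewrite lerD2l ler_wpM2r ?expR_ge0// lef_pV2 ?posrE ?ltr0n//.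
    by rewrite ler_nat.
have <- : limn (fun n => \int[leb2]_z F n z)%E = wint a b f by exact/cvg_lim.
apply: lime_le; first by apply/cvg_ex; exists (wint a b f).
apply: nearW => n; have := H _ (e0 n); rewrite -lee_fin EFin_Rintegral//.
Qed.

(* Cauchy-Schwarz puts the whole weight on [f], whence the doubled exponents. *)
Lemma wint_interpolation e a b f g k (B : R) : 0 <= B ->
  sqint f -> sqint g -> sqint k ->
  segment_formula e f g -> segment_formula e g k ->
  (wint (2 * a) (2 * b) f <= (B ^+ 2)%:E)%E ->
  (wint a b g <= (((1 + slope_const a b e) * n2 k + slope_const a b e * n2 g) * B)%:E)%E.
Proof.
move=> B0 sf sg sk fg gk fB; apply: wint_le_limit => // eps e0.
apply: le_trans (weighted_interpolation a b e0 sf sg sk fg gk) _.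
have c0 : 0 <= slope_const a b e by rewrite mulr_ge0// expR_ge0.
rewrite ler_wpM2l ?n2_logistic_le//.
by rewrite addr_ge0// mulr_ge0 ?n2_ge0// addr_ge0.
Qed.

End interpolation.

(** * Uniqueness and linearity of weak derivatives *)

Section weak_derivative_theory.
Context (R : realType).
Notation leb2 := (leb2 R).
Implicit Types (f g : plane R -> R) (phi : R * R -> R).

(** An open set is the union of the boxes with rational corners that it contains. *)
Lemma open_measurable2 (U : set (R * R)) : open U ->
  measurable (U : set (plane R)).
Proof.
move=> oU.
pose box (q : (rat * rat) * (rat * rat)) : set (plane R) :=
  `]ratr q.1.1, ratr q.1.2[ `*` `]ratr q.2.1, ratr q.2.2[.
pose inU q := box q `<=` U.
suff -> : U = \bigcup_q (if `[< inU q >] then box q else set0).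
  apply: (@countable_bigcupT_measurable _ (plane R)) => // q.
  by case: ifP => // _; apply: measurableX; exact: measurable_itv.
apply/seteqP; split => [[x y] Uxy|[x y] [q _]]; last by case: asboolP => // qU /qU.
have /nbhs_ballP[e/= e0 eU] : nbhs (x, y) U by exact: open_nbhs_nbhs.
have [a ax] : exists a : rat, ratr a \in `]x - e, x[ by apply: rat_in_itvoo; lra.
have [b xb] : exists b : rat, ratr b \in `]x, x + e[ by apply: rat_in_itvoo; lra.
have [c cy] : exists c : rat, ratr c \in `]y - e, y[ by apply: rat_in_itvoo; lra.
have [d yd] : exists d : rat, ratr d \in `]y, y + e[ by apply: rat_in_itvoo; lra.
move: ax xb cy yd; rewrite !in_itv/= => /andP[a1 a2] /andP[b1 b2] /andP[c1 c2] /andP[d1 d2].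
exists ((a, b), (c, d)) => //; rewrite asboolT; last first.
  move=> [p q] [] /=; rewrite !in_itv/= => /andP[p1 p2] /andP[q1 q2].
  apply: eU; split; rewrite /= /ball/= ltr_distlC; apply/andP; split; lra.
by split; rewrite /= in_itv/=; apply/andP.
Qed.

Lemma closed_measurable2 (K : set (R * R)) : closed K ->
  measurable (K : set (plane R)).
Proof.
move=> cK; rewrite -(setCK K); apply: (@measurableC _ (plane R)).
exact: open_measurable2 (closed_openC cK).
Qed.

Lemma continuous_measurable2 (phi : R * R -> R) : continuous phi ->
  measurable_fun [set: plane R] phi.
Proof.
move=> cphi; apply: (measurability _ (RGenOpens.measurableE R)) => _ [_ [a [b ->]] <-].
rewrite setTI; apply: open_measurable2.
by move/continuousP: cphi; apply; exact: interval_open.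
Qed.

Lemma derive_near0 (psi : R * R -> R) (v z : R * R) :
  (\forall y \near z, psi y = 0) -> 'D_v psi z = 0.
Proof.
by move=> H; rewrite (near_eq_derive (g := cst 0))// derive_cst.
Qed.

Lemma pderiv_near0 a b (phi : R * R -> R) (z : R * R) :
  (\forall y \near z, phi y = 0) -> \forall y \near z, pderiv a b phi y = 0.
Proof.
have H (v : R * R) n (psi : R * R -> R) : (\forall y \near z, psi y = 0) ->
    \forall y \near z, iter n (fun psi z => 'D_v psi z) psi y = 0.
  move=> h; elim: n => //= n IH.
  by move/nbhs_interior : IH; apply: filterS => y; exact: derive_near0.
by move=> /(H (0, 1) b) /(H (1, 0) a).
Qed.

Lemma pderiv_support a b phi z :
  ~ closure [set z | phi z != 0] z -> pderiv a b phi z = 0.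
Proof.
move=> nz; apply: (@nbhs_singleton _ z [set y | pderiv a b phi y = 0]).
apply: pderiv_near0.
have : nbhs z (~` closure [set z | phi z != 0]).
  by apply: open_nbhs_nbhs; split => //; exact/closed_openC/closed_closure.
apply: filterS => y; apply: contra_notP => /eqP H; exact: subset_closure.
Qed.

(** Derivatives of a test function are bounded and vanish off its compact support, where [f] is
    integrable. *)
Lemma intble_test a b f phi : loc_integrable f -> test_function phi ->
  intble leb2 (fun z => f z * pderiv a b phi z).
Proof.
move=> [mf lf] [dphi cK]; set K := closure _ in cK.
have cphi : continuous (pderiv a b phi).
  by move=> z; exact: differentiable_continuous.
have mphi := continuous_measurable2 cphi.
have [N [_ HN]] := compact_bounded (continuous_compact (continuous_subspaceT cphi) cK).
have bphi z : K z -> `|pderiv a b phi z| <= `|N| + 1.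
  move=> Kz; apply: (HN (`|N| + 1)); first by rewrite (le_lt_trans (ler_norm _))// ltrDl.
  by exists z.
have mK : measurable (K : set (plane R)) by apply: closed_measurable2; exact: closed_closure.
have iK : intble leb2 (f \_ K).
  rewrite /intble -restrict_EFin -integrable_mkcond//; apply/integrableP; split.
    by apply/measurable_EFinP; apply: measurable_funS mf.
  exact: lf.
have := intbleZ (`|N| + 1) iK; apply: le_intble; first exact: measurable_funM.
move=> z; rewrite patchE; case: ifPn => [|nK].
  rewrite inE => /bphi h; rewrite !normrM mulrC ler_wpM2r//.
  by apply: le_trans h _; exact: ler_norm.
rewrite (pderiv_support a b) ?mulr0 ?normr0 ?normr_ge0 //.
by move: nK; rewrite notin_setE.
Qed.

Lemma loc_integrableB f g : loc_integrable f -> loc_integrable g ->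
  loc_integrable (fun z => f z - g z).
Proof.
move=> [mf lf] [mg lg]; split=> [|K cK]; first exact: measurable_funB.
have mK : measurable (K : set (plane R)).
  exact: closed_measurable2 (compact_closed (@norm_hausdorff R (R * R)%type) cK).
have H (h : plane R -> R) : measurable_fun setT h ->
    (\int[leb2]_(z in K) `|(h z)%:E| < +oo)%E -> leb2.-integrable K (EFin \o h).
  move=> mh hK; apply/integrableP; split => //.
  by apply/measurable_EFinP; exact: measurable_funS mh.
by have /integrableP[] := integrableB mK (H _ mf (lf K cK)) (H _ mg (lg K cK)).
Qed.

Lemma is_wderivB a b f f' g g' : is_wderiv a b f g -> is_wderiv a b f' g' ->
  is_wderiv a b (fun z => f z - f' z) (fun z => g z - g' z).
Proof.
move=> [lf lg fg] [lf' lg' fg']; split => [||phi tphi]; try exact: loc_integrableB.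
under eq_int do rewrite mulrBl; under [in RHS]eq_int do rewrite mulrBl.
rewrite !intB; first by rewrite fg// fg'// mulrBr.
- exact: (@intble_test 0 0).
- exact: (@intble_test 0 0).
- exact: intble_test.
- exact: intble_test.
Qed.

Lemma is_wderiv_wderiv a b f : (exists g, is_wderiv a b f g) ->
  is_wderiv a b f (wderiv a b f).
Proof. by move=> /xgetPex; exact. Qed.

(** Tensor products are test functions, and they separate square-integrable functions by
    [tensor_ae0]. *)
Lemma is_wderiv_unique a b f g g' : is_wderiv a b f g -> is_wderiv a b f g' ->
  sqint leb2 g -> sqint leb2 g' -> {ae leb2, forall z, g z = g' z}.
Proof.
move=> [_ lg fg] [_ lg' fg'] sg sg'.
suff : {ae leb2, forall z, g z - g' z = 0}.
  by apply: filterS => z /eqP; rewrite subr_eq0 => /eqP.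
apply: tensor_ae0 => [|p q bp bq]; first exact: sqintB.
have tT := test_function_tensor bp bq.
under eq_int do rewrite mulrBl.
rewrite intB; [|exact: (@intble_test 0 0)..].
have := fg' _ tT; rewrite fg// => /(congr1 ( *%R ((-1) ^+ (a + b)))).
by rewrite !mulrA -expr2 sqrr_sign !mul1r => ->; rewrite subrr.
Qed.

Lemma is_wderiv00 f : loc_integrable f -> is_wderiv 0 0 f f.
Proof. by move=> lf; split => // phi _; rewrite expr0 mul1r. Qed.

(** [g] and [h] are both defined by testing [f]. Using p(x) q(y) for [h] and p'(x) q(y) for [g],
    both reduce to the integral of [f] against the derivative of order (a + 1, b), with opposite
    signs. *)
Lemma tderiv_wderiv_x a b f g h : is_wderiv a b f g -> is_wderiv a.+1 b f h ->
  tderiv (ex R) g h.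
Proof.
move=> [_ _ fg] [_ _ fh] p q bp bq.
have [[sp _] [sq _]] := (bp, bq).
under eq_int do rewrite /= mul1r mul0r addr0.
have := fg _ (test_function_tensor (bump_derive1 bp) bq).
have := fh _ (test_function_tensor bp bq).
rewrite !pderiv_tensor//; last exact: smooth_derive1.
rewrite iterSr => -> /(congr1 ( *%R ((-1) ^+ (a + b)))).
rewrite !mulrA -expr2 sqrr_sign mul1r => <-.
by rewrite addSn exprS mulN1r mulrN -expr2 sqrr_sign mulN1r.
Qed.

Lemma tderiv_wderiv_y a b f g h : is_wderiv a b f g -> is_wderiv a b.+1 f h ->
  tderiv (ey R) g h.
Proof.
move=> [_ _ fg] [_ _ fh] p q bp bq.
have [[sp _] [sq _]] := (bp, bq).
under eq_int do rewrite /= mul1r mul0r add0r.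
have := fg _ (test_function_tensor bp (bump_derive1 bq)).
have := fh _ (test_function_tensor bp bq).
rewrite !pderiv_tensor//; last exact: smooth_derive1.
rewrite iterSr => -> /(congr1 ( *%R ((-1) ^+ (a + b)))).
rewrite !mulrA -expr2 sqrr_sign mul1r => <-.
by rewrite addnS exprS mulN1r mulrN -expr2 sqrr_sign mulN1r.
Qed.

Lemma L2_sqint f : L2 (cst 1) f <-> sqint leb2 f.
Proof.
have E : (\int[leb2]_z (`|f z| ^+ 2 * cst 1 z)%:E = \int[leb2]_z (f z ^+ 2)%:E)%E.
  by apply: eq_integral => z _; rewrite mulr1 -normrX ger0_norm ?sqr_ge0.
by rewrite /L2 /sqint E.
Qed.

Lemma L2norm_n2 f : sqint leb2 f -> L2norm (cst 1) f = (n2 leb2 f)%:E.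
Proof.
move=> sf; rewrite /L2norm.
under eq_integral => z _ do rewrite mulr1 -normrX ger0_norm ?sqr_ge0//.
rewrite -EFin_Rintegral; last exact: intble_sqr.
by rewrite poweR_EFin powR12_sqrt// int_sqr_ge0.
Qed.

Lemma L2norm_le_Sobolev_norm k w f a b : (a + b <= k)%N ->
  (L2norm w (wderiv a b f) <= Sobolev_norm k w f)%E.
Proof.
move=> abk; have ak : (a < k.+1)%N by rewrite ltnS (leq_trans _ abk)// leq_addr.
have bk : (b < k.+1)%N by rewrite ltnS (leq_trans _ abk)// leq_addl.
rewrite /Sobolev_norm (bigD1 (Ordinal ak))//= (bigD1 (Ordinal bk))//= -addeA.
rewrite leeDl//; apply: adde_ge0; first by apply: sume_ge0 => i _; exact: poweR_ge0.
by apply: sume_ge0 => i _; apply: sume_ge0 => j _; exact: poweR_ge0.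
Qed.

Lemma Sobolev_family k f : Sobolev k (cst 1) f ->
  sobolev_family k (fun a b => wderiv a b f).
Proof.
move=> Sf.
have wd a b : (a + b <= k)%N -> is_wderiv a b f (wderiv a b f).
  by move=> /Sf[/is_wderiv_wderiv].
have sd a b : (a + b <= k)%N -> sqint leb2 (wderiv a b f).
  by move=> /Sf[_ /L2_sqint].
split=> [|a b abk|a b abk]; first exact: sd.
  have abk' : (a.+1 + b <= k)%N by rewrite addSn.
  apply: tderiv_segment_x; [exact: sd (ltnW abk)|exact: sd|].
  exact: tderiv_wderiv_x (wd _ _ (ltnW abk)) (wd _ _ abk').
have abk' : (a + b.+1 <= k)%N by rewrite addnS.
apply: tderiv_segment_y; [exact: sd (ltnW abk)|exact: sd|].
exact: tderiv_wderiv_y (wd _ _ (ltnW abk)) (wd _ _ abk').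
Qed.

Lemma wderiv00 k f : Sobolev k (cst 1) f -> sqint leb2 f ->
  {ae leb2, forall z, wderiv 0 0 f z = f z}.
Proof.
move=> /(_ 0 0 isT)[/is_wderiv_wderiv wf /L2_sqint sD] sf.
by apply: (is_wderiv_unique wf _ sD sf); case: wf => lf _ _; exact: is_wderiv00.
Qed.

(** Representatives are chosen separately for f, g and f - g, so linearity of [wderiv] holds almost
    everywhere only, by uniqueness; the triangle inequality then applies. *)
Lemma le_n2_wderivB k f g a b : (a + b <= k)%N ->
  Sobolev k (cst 1) f -> Sobolev k (cst 1) g ->
  (Sobolev_norm k (cst 1%R) (f \- g)%R <= 1)%E ->
  n2 leb2 (wderiv a b f) <= n2 leb2 (wderiv a b g) + 1.
Proof.
move=> abk /(_ _ _ abk)[/is_wderiv_wderiv wf /L2_sqint sf].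
move=> /(_ _ _ abk)[/is_wderiv_wderiv wg /L2_sqint sg] S1.
have wfg := is_wderivB wf wg.
have wD : is_wderiv a b (f \- g) (wderiv a b (f \- g)).
  by apply: is_wderiv_wderiv; eexists; exact: wfg.
have D1 := le_trans (L2norm_le_Sobolev_norm (cst 1) (f \- g) abk) S1.
(* Read off the finite norm: an infinite integral would make [L2norm] infinite, against [D1]. *)
have sD : sqint leb2 (wderiv a b (f \- g)).
  have [[mD _] [_ [mD' _] _]] := (sf, wD).
  apply/L2_sqint; split => //; rewrite ltey; apply/eqP => oo.
  by move: D1; rewrite /L2norm oo poweRyr// invr_eq0.
have E := is_wderiv_unique wD wfg sD (sqintB sf sg).
move: D1; rewrite L2norm_n2// lee_fin => D1.
have -> : n2 leb2 (wderiv a b f) =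
    n2 leb2 (fun z => wderiv a b g z + (wderiv a b f z - wderiv a b g z)).
  by congr n2; apply/funext => z; rewrite addrC subrK.
apply: le_trans (n2D sg (sqintB sf sg)) _; rewrite lerD2l.
rewrite -(ae_eq_n2 _ _ E)//; first by case: sD.
by case: (sqintB sf sg).
Qed.

(** Compactness of [0, 1] turns local upper bounds into one that is eventually valid as M tends to
    infinity. *)
Lemma bounded_itv01 (F : R -> R) :
  (forall t : R, t \in `[0, 1] ->
    \forall s \near within `[0, 1] (nbhs t), F s <= F t + 1) ->
  exists M : R, forall t : R, t \in `[0, 1] -> F t <= M.
Proof.
move=> H.
have /compact_near_coveringP := @segment_compact R 0 1.
move=> /(_ R +oo (fun (M t : R) => t \in `[0, 1] -> F t <= M) _) [].
  move=> t t01; have := H t t01; rewrite /within/= => Ht.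
  exists ([set s | s \in `[0, 1] -> F s <= F t + 1], [set M | F t + 1 <= M]) => /=.
    by split=> //; apply: nbhs_pinfty_ge; rewrite num_real.
  by move=> [s M] /= [Fs FM] s01; exact: le_trans (Fs s01) FM.
move=> M [_ HM]; exists (M + 1) => t t01.
by apply: (HM (M + 1)) => //; rewrite ltrDl.
Qed.

Lemma wderiv_uniform_bound k (u : R -> plane R -> R) a b : (a + b <= k)%N ->
  C0_Sobolev k u ->
  exists M : R, forall t, t \in `[0, 1] -> n2 leb2 (wderiv a b (u t)) <= M.
Proof.
move=> abk [Su Cu]; apply: bounded_itv01 => t t01.
have V : nbhs (0 : \bar R)%E [set x | (x <= 1)%E].
  apply: (@filterS _ _ _ [set x | (x < 1%:E)%E]) => [x /ltW//|].
  by apply: open_nbhs_nbhs; split; [exact: open_ereal_lt_ereal|rewrite /= lte_fin].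
have := Cu t t01 _ V; rewrite ?nbhs_simpl /= => h.
apply: (filterS2 _ _ h (withinT _ _)) => s h1 s01.
by apply: (le_n2_wderivB abk (Su s s01) (Su t t01)).
Qed.

End weak_derivative_theory.

(** * Time derivative of the weighted energy *)

Section differentiation_of_the_energy.
Context (R : realType).
Notation leb2 := (leb2 R).
Notation n2 := (n2 leb2).
Notation sqint := (sqint leb2).
Notation intble := (intble leb2).
Implicit Types (p q r w : plane R -> R).

Lemma L2norm_cvg0 (v : R -> plane R -> R) (F : set_system R) :
  Filter F -> (forall s : R, s \in `[0, 1] -> sqint (v s)) ->
  (L2norm (cst 1) (v s) @[s --> within `[0, 1] F] --> 0%E) ->
  forall eta : R, 0 < eta ->
  \forall s \near F, s \in `[0, 1] -> n2 (v s) <= eta.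
Proof.
move=> FF sv cv eta eta0.
have V : nbhs (0 : \bar R)%E [set x | (x <= eta%:E)%E].
  apply: (@filterS _ _ _ [set x | (x < eta%:E)%E]) => [x /ltW//|].
  by apply: open_nbhs_nbhs; split; [exact: open_ereal_lt_ereal|rewrite /= lte_fin].
have H : F _ := cv _ V; apply: (@filterS _ F FF _ _ _ H) => s h s01.
by have := h s01; rewrite /= (L2norm_n2 (sv s s01)) lee_fin.
Qed.

(** Here p = u(t), f = u(s), h = s - t, r is the time derivative and q the error of the difference
    quotient. The error terms of the expanded square are 2 h times the integral of p q w and h^2
    times that of (r + q)^2 w. *)
Lemma energy_increment f p r q w (h C eta : R) :
  (forall z, f z = p z + h * (r z + q z)) ->
  sqint p -> sqint r -> sqint q -> measurable_fun setT w ->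
  0 <= C -> (forall z, `|w z| <= C) -> 0 <= eta <= 1 -> n2 q <= eta -> `|h| <= eta ->
  `|\int[leb2]_z (f z * f z * w z) - \int[leb2]_z (p z * p z * w z)
    - h * (2 * \int[leb2]_z (r z * p z * w z))| <=
  `|h| * (eta * (C * (2 * n2 p + (n2 r + 1) ^+ 2))).
Proof.
move=> fE sp sr sq mw C0 wC /andP[e0 e1] qe he.
pose g z := r z + q z; have sg : sqint g by exact: sqintD.
have i f1 f2 : sqint f1 -> sqint f2 -> intble (fun z => f1 z * f2 z * w z).
  by move=> s1 s2; exact: intble_mul3 s1 s2 mw wC.
have b f1 f2 : sqint f1 -> sqint f2 ->
    `|\int[leb2]_z (f1 z * f2 z * w z)| <= C * (n2 f1 * n2 f2).
  by move=> s1 s2; exact: (int_mul3_le C0 s1 s2 mw wC).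
have -> : \int[leb2]_z (f z * f z * w z) = \int[leb2]_z (p z * p z * w z) +
    (2 * h * (\int[leb2]_z (p z * r z * w z) + \int[leb2]_z (p z * q z * w z)) +
     h ^+ 2 * \int[leb2]_z (g z * g z * w z)).
  rewrite -intD ?i// -!intZ ?i//; last by apply: intbleD; exact: i.
  rewrite -intD; [|by apply/intbleZ/intbleD; exact: i|by apply/intbleZ/i].
  rewrite -intD; [|exact: i|apply: intbleD; apply: intbleZ; [apply: intbleD|]; exact: i].
  by apply: eq_int => z; rewrite fE /g; ring.
have -> : \int[leb2]_z (r z * p z * w z) = \int[leb2]_z (p z * r z * w z).
  by apply: eq_int => z; rewrite (mulrC (r z)).
have b1 := b _ _ sp sq; have b2 := b _ _ sg sg.
set I1 := (X in `|X| <= _) in b1; set I2 := (X in `|X| <= _) in b2.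
set P := Rintegral _ _ _; set Q := Rintegral _ _ _.
rewrite (_ : _ - _ - _ = h * (2 * I1 + h * I2)); last by rewrite /I1 /I2; ring.
rewrite normrM ler_wpM2l// (le_trans (ler_normD _ _))// !normrM.
rewrite (ger0_norm (ler0n _ 2)).
have ng : n2 g <= n2 r + 1.
  by apply: le_trans (n2D sr sq) _; rewrite lerD2l (le_trans qe).
have H1 : 2 * `|I1| <= eta * (C * (2 * n2 p)).
  rewrite (_ : eta * _ = 2 * (C * (n2 p * eta))); last by ring.
  by rewrite ler_wpM2l// (le_trans b1)// ler_wpM2l// ler_wpM2l// n2_ge0.
have H2 : `|h| * `|I2| <= eta * (C * (n2 r + 1) ^+ 2).
  apply: ler_pM => //; apply: le_trans b2 _; rewrite -expr2 ler_wpM2l//.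
  by rewrite ler_sqr ?nnegrE ?addr_ge0 ?n2_ge0.
lra.
Qed.

Lemma energy_derivative (u : R -> plane R -> R) (r : plane R -> R) w (t C : R) :
  measurable_fun setT w -> (forall z, `|w z| <= C) -> t \in `[0, 1] ->
  (forall s : R, s \in `[0, 1] -> sqint (u s)) -> sqint r ->
  (L2norm (cst 1) (fun z => (s - t)^-1 * (u s z - u t z) - r z)
     @[s --> within `[0, 1] t^'] --> 0%E) ->
  has_derivative_within (fun s => \int[leb2]_z (u s z * u s z * w z)) t
    (2 * \int[leb2]_z (r z * u t z * w z)).
Proof.
move=> mw wC t01 su sr cv eps eps0.
have C0 : 0 <= C by apply: le_trans (wC (0, 0)).
set Z := C * (2 * n2 (u t) + (n2 r + 1) ^+ 2).
have Z0 : 0 <= Z by rewrite mulr_ge0// addr_ge0 ?sqr_ge0// mulr_ge0 ?n2_ge0.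
pose eta := Num.min 1 (eps / (Z + 1)).
have eta0 : 0 < eta by rewrite lt_min ltr01 divr_gt0// ltr_wpDl.
have eta1 : eta <= 1 by rewrite ge_min lexx.
have etaZ : eta * Z <= eps.
  have : eta * (Z + 1) <= eps by rewrite -ler_pdivlMr ?ltr_wpDl// ge_min lexx orbT.
  by apply: le_trans; rewrite ler_wpM2l ?(ltW eta0)// lerDl.
pose v s z := (s - t)^-1 * (u s z - u t z) - r z.
have sv (s : R) : s \in `[0, 1] -> sqint (v s).
  by move=> s01; apply: sqintB => //; apply/sqintZ/sqintB; exact: su.
have : nbhs t (fun s => s != t -> s \in `[0, 1] -> n2 (v s) <= eta).
  exact: (@L2norm_cvg0 v _ _ sv cv _ eta0).
move=> /nbhs_ballP[del /= del0 Hdel].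
exists (Num.min del eta) => [|s s01]; first by rewrite lt_min eta0 andbT.
rewrite lt_min => /andP[sdel seta].
have [->|st] := eqVneq s t; first by rewrite !subrr mul0r subrr normr0 mulr0.
have s01' : s \in `[0, 1] by rewrite in_itv.
have st0 : s - t != 0 by rewrite subr_eq0.
have Hq : n2 (v s) <= eta.
  by apply: Hdel => //; rewrite /ball/= distrC.
have usE z : u s z = u t z + (s - t) * (r z + v s z).
  by rewrite /v; field.
have eta01 : 0 <= eta <= 1 by rewrite (ltW eta0) eta1.
apply: le_trans (energy_increment usE (su _ t01) sr (sv _ s01') mw C0 wC eta01 Hq (ltW seta)) _.
by rewrite mulrC ler_wpM2r.
Qed.

End differentiation_of_the_energy.

(** * Propagation of decay *)

Section propagation_of_decay.
Context (R : realType).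
Notation leb2 := (leb2 R).
Notation n2 := (n2 leb2).
Notation sqint := (sqint leb2).
Notation intble := (intble leb2).
Implicit Types (u : R -> plane R -> R) (D : nat -> nat -> plane R -> R).

Lemma wderiv_bound k u : C0_Sobolev k u ->
  exists2 B : R, 0 <= B & forall a b, (a + b <= k)%N ->
    forall t, t \in `[0, 1] -> n2 (wderiv a b (u t)) <= B.
Proof.
move=> Cu.
have H (p : nat * nat) : exists M : R, (p.1 + p.2 <= k)%N ->
    forall t, t \in `[0, 1] -> n2 (wderiv p.1 p.2 (u t)) <= M.
  have [pk|//] := boolP (p.1 + p.2 <= k)%N; last by exists 0.
  by have [M HM] := wderiv_uniform_bound pk Cu; exists M.
have [M HM] := choice H.
exists (\sum_(a < k.+1) \sum_(b < k.+1) `|M (a : nat, b : nat)|).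
  by apply: sumr_ge0 => a _; apply: sumr_ge0.
move=> a b abk t t01; apply: le_trans (HM (a, b) abk t t01) _.
have ak : (a < k.+1)%N by rewrite ltnS (leq_trans _ abk)// leq_addr.
have bk : (b < k.+1)%N by rewrite ltnS (leq_trans _ abk)// leq_addl.
rewrite (bigD1 (Ordinal ak))//= (bigD1 (Ordinal bk))//= -addrA.
apply: le_trans (ler_norm _) _; rewrite lerDl addr_ge0//.
  exact: sumr_ge0.
by apply: sumr_ge0 => i _; apply: sumr_ge0.
Qed.

(** [sobolev_sup] bounds the square by 4 times a sum of four squares, each at most B^2. The mixed
    derivative among them accounts for the two extra orders. *)
Lemma sobolev_family_sup D m (B : R) a b : sobolev_family m D -> 0 <= B ->
  (forall a b, (a + b <= m)%N -> n2 (D a b) <= B) -> (a + b + 2 <= m)%N ->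
  {ae leb2, forall z, `|D a b z| <= 4 * B}.
Proof.
move=> [sD xD yD] B0 DB abm.
have h0 : (a + b < m)%N by apply: leq_trans abm; rewrite addn2 ltnS leqnSn.
have h1 : (a.+1 + b < m)%N by rewrite addSn -addn2.
have hx : (a.+1 + b <= m)%N by exact: ltnW.
have hy : (a + b.+1 <= m)%N by rewrite addnS.
have hxy : (a.+1 + b.+1 <= m)%N by rewrite addSn addnS -addn2.
have := sobolev_sup (sD _ _ (ltnW h0)) (sD _ _ hx) (sD _ _ hy) (sD _ _ hxy)
  (xD _ _ h0) (yD _ _ h0) (yD _ _ h1).
apply: filterS => z zB; rewrite -ler_sqr ?nnegrE ?mulr_ge0// real_normK ?num_real//.
have sq i j : (i + j <= m)%N -> n2 (D i j) ^+ 2 <= B ^+ 2.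
  by move=> ij; rewrite ler_sqr ?nnegrE ?n2_ge0 ?DB.
have := sq _ _ (ltnW h0); have := sq _ _ hx; have := sq _ _ hy; have := sq _ _ hxy.
lra.
Qed.

(** For each [eps] the regularised energy obeys Gronwall's inequality and is controlled at the time
    where decay is known, since P <= e^v; the limit in [eps] is taken at the end, at a fixed
    time. *)
Lemma wint_propagation u (s t c K0 : R) : (s = 1 \/ s = -1) -> t ^+ 2 = 1 -> 0 < c ->
  ZK_solution u ->
  (wint (s * c) (t * c) (u (if s == 1 then 0 else 1)%R) <= K0%:E)%E ->
  exists K : R, forall r, r \in `[0, 1] -> (wint (s * c) (t * c) (u r) <= K%:E)%E.
Proof.
move=> s1 t2 c0 [Cu [ut [[Lu [Lut _] dut] ZK]]] HK0.
have [B B0 HB] := wderiv_bound Cu.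
have su (r : R) : r \in `[0, 1] -> sqint (u r) by move=> /Lu /L2_sqint.
pose M := 4 * B; have M0 : 0 <= M by rewrite mulr_ge0.
(* The constant of [energy_inequality], fixed before [eps], so that the bound survives the limit. *)
pose K := 2 * c ^+ 3 + 2 / 3 * c * M.
have K_ge0 : 0 <= K by rewrite addr_ge0 ?mulr_ge0 ?exprn_ge0 ?divr_ge0// ltW.
have s2 : s ^+ 2 = 1 by case: s1 => ->; rewrite ?expr1n// sqrrN expr1n.
exists (expR K * K0) => r r01; apply: wint_le_limit => [|eps e0]; first exact: su.
pose w z := logistic eps (phase (s * c) (t * c) z).
have mw : measurable_fun setT w by exact: measurable_logistic_phase.
have wC z : `|w z| <= eps^-1 by exact: logistic_bounded.
pose E r := \int[leb2]_z (u r z * u r z * w z).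
have E_ge0 r' : 0 <= E r'.
  apply: Rintegral_ge0 => z _; rewrite mulr_ge0// ?logistic_ge0//.
    by rewrite -expr2 sqr_ge0.
  by rewrite ltW// logistic_gt0.
have dE r' : 0 <= r' <= 1 -> exists2 d, has_derivative_within E r' d & s * d <= K * E r'.
  move=> h; have r'01 : r' \in `[0, 1] by rewrite in_itv.
  have sut : sqint (ut r') by apply/L2_sqint; exact: Lut.
  exists (2 * \int[leb2]_z (ut r' z * u r' z * w z)).
    exact: (energy_derivative mw wC r'01 su sut (dut r' r'01)).
  have [Su _] := Cu; have {}Su := Su _ r'01.
  have fD := Sobolev_family Su; pose D a b := wderiv a b (u r').
  have sD a b : (a + b <= 4)%N -> sqint (D a b) by case: fD => + _ _; exact.
  have DM a b : (a + b + 2 <= 4)%N -> {ae leb2, forall z, `|D a b z| <= M}.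
    by apply: sobolev_family_sup fD B0 _ => i j ij; exact: HB.
  have D0 := wderiv00 Su (su _ r'01).
  have mu : measurable_fun setT (u r') by case: (su _ r'01).
  have mD a b : (a + b <= 4)%N -> measurable_fun setT (D a b) by move=> /sD[].
  have := energy_inequality fD M0 (DM 0 0 isT) (DM 1 0 isT) e0 s2 t2 c0 erefl erefl.
  have w0 : weight eps (s * c) (t * c) 0 1 = w by apply/funext => z; rewrite weight0E mul1r.
  rewrite w0 -/K.
  (* The energy is built on u itself, the inequality on the chosen representative
     [wderiv 0 0 (u r')]; they agree almost everywhere. *)
  have -> : E r' = \int[leb2]_z (D 0 0 z * D 0 0 z * w z).
    apply: ae_eq_int.
    - by apply: measurable_funM => //; exact: measurable_funM.
    - by apply: measurable_funM => //; apply: measurable_funM; exact: mD.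
    - by apply: filterS D0 => z; rewrite /D => ->.
  apply: le_trans.
  have i p q : sqint p -> sqint q -> intble (fun z => p z * q z * w z).
    by move=> sp sq; exact: intble_mul3 sp sq mw wC.
  have s00 := sD 0 0 isT.
  have [s3 _] := sqint_ae_bounded_mull M0 (mD 0 0 isT) (DM 0 0 isT) (sD 1 0 isT).
  have i1 := i _ _ (sD 3 0 isT) s00.
  have i2 := i _ _ (sD 1 2 isT) s00.
  have i3 := i _ _ s3 s00.
  (* The equation replaces the time derivative almost everywhere, and the representative replaces
     u. *)
  have -> : \int[leb2]_z (ut r' z * u r' z * w z) = - \int[leb2]_z
      ((D 3 0 z * D 0 0 z * w z) + (D 1 2 z * D 0 0 z * w z) + (D 0 0 z * D 1 0 z) * D 0 0 z * w z).
    rewrite -mulN1r -intZ; last by apply: intbleD; [apply: intbleD|].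
    apply: ae_eq_int.
    - by apply: measurable_funM => //; apply: measurable_funM => //; case: sut.
    - apply: measurable_funM => //; apply: measurable_funD; [apply: measurable_funD|];
      apply: measurable_funM => //; repeat (apply: measurable_funM); exact: mD.
    - apply: filterS2 D0 (ZK _ r'01) => z; rewrite /D => -> H.
      move/eqP: H; rewrite -!addrA addr_eq0 => /eqP ->.
      move: (wderiv 3 0 _ z) (wderiv 1 2 _ z) (wderiv 1 0 _ z) (u r' z) (w z); clear;
        intros; ring.
  rewrite intD//; last exact: intbleD.
  rewrite intD//.
  by rewrite !mulrN mulNr.
have := gronwall s1 K_ge0 E_ge0 dE.
have r01' : 0 <= r <= 1 by move: r01; rewrite in_itv.
move=> /(_ r r01') /le_trans; apply; rewrite ler_wpM2l ?expR_ge0//.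
have -> : (if s == 1 then E 0 else E 1) = E (if s == 1 then 0 else 1) by case: ifP.
by apply: int_logistic_le => //; apply: su; case: ifP => _; rewrite in_itv/= ?lexx ?ler01.
Qed.

(** Every exponent c is included, so that the class is stable under differentiation although each
    step uses the exponent 2 c. *)
Definition decays (F : R -> plane R -> R) : Prop := forall s t c : R,
  (s = 1 \/ s = -1) -> (t = 1 \/ t = -1) -> 0 < c ->
  exists K : R, forall r, r \in `[0, 1] -> (wint (s * c) (t * c) (F r) <= K%:E)%E.

(** [F], [G], [H] are a function and its first two derivatives along [e]. The unweighted bound B is
    uniform in time, and so is the constant of the interpolation. *)
Lemma decays_segment e (F G H : R -> plane R -> R) (B : R) :
  (forall r : R, r \in `[0, 1] -> [/\ sqint (F r), sqint (G r) & sqint (H r)]) ->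
  (forall r : R, r \in `[0, 1] ->
    segment_formula e (F r) (G r) /\ segment_formula e (G r) (H r)) ->
  (forall r : R, r \in `[0, 1] -> n2 (G r) <= B /\ n2 (H r) <= B) ->
  decays F -> decays G.
Proof.
move=> sq sg nB dF s t c s1 t1 c0.
have [K HK] := dF s t (2 * c) s1 t1 (mulr_gt0 (ltr0Sn _ 1) c0).
pose b := slope_const (s * c) (t * c) e.
have b0 : 0 <= b by rewrite mulr_ge0// expR_ge0.
(* |K| + 1 serves as the root required by [wint_interpolation], since (|K| + 1)^2 >= K whatever the
   sign of K. *)
exists (((1 + b) * B + b * B) * (`|K| + 1)) => r r01.
have [sF sG sH] := sq r r01; have [FG GH] := sg r r01; have [GB HB] := nB r r01.
have K1 : 0 <= `|K| + 1 by rewrite addr_ge0.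
apply: (le_trans (wint_interpolation K1 sF sG sH FG GH _)); last first.
  by rewrite lee_fin ler_wpM2r// lerD// ler_wpM2l// addr_ge0.
rewrite (mulrCA 2 s) (mulrCA 2 t) (le_trans (HK r r01))// lee_fin.
by have := ler_norm K; move: `|K| (normr_ge0 K) => k k0 Kk; nra.
Qed.

Lemma decays_ae_eq (F G : R -> plane R -> R) :
  (forall r : R, r \in `[0, 1] -> measurable_fun setT (F r) /\ measurable_fun setT (G r)) ->
  (forall r : R, r \in `[0, 1] -> {ae leb2, forall z, G r z = F r z}) ->
  decays F -> decays G.
Proof.
move=> mFG FG dF s t c s1 t1 c0; have [K HK] := dF s t c s1 t1 c0.
exists K => r r01; have [mF mG] := mFG r r01; apply: le_trans (HK r r01).
rewrite le_eqVlt; apply/orP; left; apply/eqP; rewrite /wint.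
apply: ae_eq_integral => //; try exact: measurable_wint.
by apply: filterS (FG r r01) => z -> _.
Qed.

(** Derivatives in y come before those in x. Each step uses the next derivative in unweighted L^2,
    so order 3 is the last one within reach of H^4. *)
Lemma decays_wderiv u : C0_Sobolev 4 u -> (forall r : R, r \in `[0, 1] -> sqint (u r)) ->
  decays u -> forall a b, (a + b <= 3)%N -> decays (fun r => wderiv a b (u r)).
Proof.
move=> Cu su du; have [B _ HB] := wderiv_bound Cu; have [Su _] := Cu.
have fam (r : R) : r \in `[0, 1] -> sobolev_family 4 (fun a b => wderiv a b (u r)).
  by move=> /Su/Sobolev_family.
have y0 b : (b <= 3)%N -> decays (fun r => wderiv 0 b (u r)).
  elim: b => [_|b IH b3].
    apply: decays_ae_eq du => r r01; last exact: wderiv00 (Su _ r01) (su _ r01).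
    by have [sD _ _] := fam r r01; case: (su r r01) (sD 0 0 isT) => + _ [].
  apply: (@decays_segment (ey R) _ _ (fun r => wderiv 0 b.+2 (u r)) B _ _ _ (IH (ltnW b3)));
    move=> r r01; have [sD _ yD] := fam r r01.
  - by split; apply: sD; rewrite add0n// ltnW// ltnW.
  - by split; apply: yD; rewrite add0n// ltnW.
  - by split; apply: HB; rewrite // add0n ltnW.
elim=> [|a IH] b ab; first exact: y0.
have ab' : (a + b <= 3)%N by rewrite ltnW.
apply: (@decays_segment (ex R) _ _ (fun r => wderiv a.+2 b (u r)) B _ _ _ (IH b ab'));
  move=> r r01; have [sD xD _] := fam r r01.
- by split; apply: sD; rewrite ?addSn// ltnW// ltnW.
- by split; apply: xD; rewrite ?addSn// ltnW.
- by split; apply: HB; rewrite ?addSn// ltnW.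
Qed.

Lemma int_abs_weight_le (f : plane R -> R) (c : R) : measurable_fun setT f ->
  (\int[leb2]_z (`|f z| ^+ 2 * (expR (c * `|z.1|) * expR (c * `|z.2|)))%:E <=
   (wint (1 * c) (1 * c) f + wint (1 * c) (-1 * c) f) +
   (wint (-1 * c) (1 * c) f + wint (-1 * c) (-1 * c) f))%E.
Proof.
move=> mf; rewrite /wint -!ge0_integralD//; try exact: measurable_wint;
  try (by move=> z _; rewrite ?adde_ge0// wint_fun_ge0);
  try (by apply: emeasurable_funD; exact: measurable_wint).
apply: ge0_le_integral => //.
- apply/measurable_EFinP; apply: measurable_funM.
    by apply: measurable_funX; exact: measurableT_comp.
  have H (g : plane R -> R) : measurable_fun setT g ->
      measurable_fun setT (fun z => expR (c * `|g z|)).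
    move=> mg; apply: (measurableT_comp (continuous_measurable_fun (@continuous_expR R))).
    by apply: measurable_funM => //; exact: measurableT_comp.
  by apply: measurable_funM; apply: H.
- by apply: emeasurable_funD; apply: emeasurable_funD; exact: measurable_wint.
move=> z _; rewrite -!EFinD lee_fin real_normK ?num_real// -!mulrDr ler_wpM2l ?sqr_ge0//.
rewrite -expRD /phase.
have := expR_ge0 (1 * c * z.1 + 1 * c * z.2); have := expR_ge0 (1 * c * z.1 + -1 * c * z.2).
have := expR_ge0 (-1 * c * z.1 + 1 * c * z.2); have := expR_ge0 (-1 * c * z.1 + -1 * c * z.2).
have E1 : `|z.1| = 1 * z.1 \/ `|z.1| = -1 * z.1.
  by case: (ger0P z.1) => _; [left; rewrite mul1r|right; rewrite mulN1r].
have E2 : `|z.2| = 1 * z.2 \/ `|z.2| = -1 * z.2.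
  by case: (ger0P z.2) => _; [left; rewrite mul1r|right; rewrite mulN1r].
by case: E1 => ->; case: E2 => ->; rewrite !mulrA !(mulrC c); lra.
Qed.

Lemma decays_initial (f : plane R -> R) (s t beta : R) : (t = 1 \/ t = -1) -> 0 < beta ->
  L2 (fun z => expR (s * (2 * beta) * z.1) * expR (2 * beta * `|z.2|)) f ->
  exists K : R, (wint (s * (2 * beta)) (t * (2 * beta)) f <= K%:E)%E.
Proof.
move=> t1 b0 [mf Hf].
suff H : (wint (s * (2 * beta)) (t * (2 * beta)) f < +oo)%E.
  exists (fine (wint (s * (2 * beta)) (t * (2 * beta)) f)).
  rewrite fineK// ge0_fin_numE//; apply: integral_ge0 => z _; exact: wint_fun_ge0.
apply: le_lt_trans Hf; apply: ge0_le_integral => //.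
- by move=> z _; exact: wint_fun_ge0.
- exact: measurable_wint.
- apply/measurable_EFinP; apply: measurable_funM.
    by apply: measurable_funX; exact: measurableT_comp.
  apply: measurable_funM; apply: (measurableT_comp (continuous_measurable_fun (@continuous_expR R))).
    exact: measurable_funM.
  by apply: measurable_funM => //; exact: measurableT_comp.
move=> z _; rewrite lee_fin real_normK ?num_real// ler_wpM2l ?sqr_ge0//.
rewrite -expRD ler_expR /phase lerD2l mulrAC mulrC ler_wpM2l ?mulr_ge0 ?(ltW b0)//.
by case: t1 => ->; rewrite ?mul1r ?mulN1r ?ler_norm// -normrN ler_norm.
Qed.

End propagation_of_decay.

Theorem theorem3 (R : realType) (u : R -> plane R -> R) :
  ZK_solution u ->
  (forall beta : R, 0 < beta ->
    L2 (fun z => expR (2 * beta * z.1) * expR (2 * beta * `|z.2|)) (u 0) /\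
    L2 (fun z => expR (- 2 * beta * z.1) * expR (2 * beta * `|z.2|)) (u 1)) ->
  forall beta : R, 0 < beta ->
    bounded_Sobolev 3
      (fun z => expR (2 * beta * `|z.1|) * expR (2 * beta * `|z.2|)) u.
Proof.
move=> uZK init.
have du : decays u.
  move=> s t c s1 t1 c0.
  (* The assumed weights have exponent 2 beta, so exponent c corresponds to beta = c / 2. *)
  have c20 : 0 < c / 2 by rewrite divr_gt0.
  have t2 : t ^+ 2 = 1 by case: t1 => ->; rewrite ?expr1n// sqrrN expr1n.
  suff [K0 HK0] : exists K0 : R,
      (wint (s * c) (t * c) (u (if s == 1 then 0 else 1)%R) <= K0%:E)%E.
    exact: wint_propagation s1 t2 c0 uZK HK0.
  have [I0 I1] := init _ c20.
  have -> : c = 2 * (c / 2) by field.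
  apply: decays_initial => //; case: s1 => ->; first by rewrite eqxx mul1r.
  rewrite (_ : (-1 == 1 :> R) = false); last by apply/negP => /eqP; lra.
  by rewrite mulNr mul1r -mulNr.
have [Cu [ut [[Lu _ _] _]]] := uZK.
have su (r : R) : r \in `[0, 1] -> sqint (leb2 R) (u r) by move=> /Lu /L2_sqint.
have dD := decays_wderiv Cu su du.
move=> beta b0; pose w (z : plane R) := expR (2 * beta * `|z.1|) * expR (2 * beta * `|z.2|).
have c0 : 0 < 2 * beta by rewrite mulr_gt0.
have [Su _] := Cu.
(* Stated for all pairs, with the order condition inside the existential, so that [choice] yields
   one family of constants independent of time. *)
have HK (p : nat * nat) : exists K : R, (p.1 + p.2 <= 3)%N -> forall r, r \in `[0, 1] ->
    (\int[leb2 R]_z (`|wderiv p.1 p.2 (u r) z| ^+ 2 * w z)%:E <= K%:E)%E.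
  have [p3|//] := boolP (p.1 + p.2 <= 3)%N; last by exists 0.
  have d := dD p.1 p.2 p3.
  have [K1 H1] := d 1 1 _ (or_introl erefl) (or_introl erefl) c0.
  have [K2 H2] := d 1 (-1) _ (or_introl erefl) (or_intror erefl) c0.
  have [K3 H3] := d (-1) 1 _ (or_intror erefl) (or_introl erefl) c0.
  have [K4 H4] := d (-1) (-1) _ (or_intror erefl) (or_intror erefl) c0.
  exists ((K1 + K2) + (K3 + K4)) => _ r r01.
  have [_ [mD _]] := Su r r01 p.1 p.2 (leqW p3).
  apply: le_trans (int_abs_weight_le (2 * beta) mD) _.
  by rewrite 3!EFinD; apply: leeD; apply: leeD; auto.
have [K {}HK] := choice HK.
split=> [r r01 a b ab|].
  have [ex [mD _]] := Su r r01 a b (leqW ab); split => //; split => //.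
  by apply: le_lt_trans (HK (a, b) ab r r01) _; rewrite ltry.
exists (\sum_(a < 4) \sum_(b < 4 | (a + b <= 3)%N) (K (a : nat, b : nat)) `^ 2^-1) => r r01.
rewrite /Sobolev_norm -sumEFin; apply: lee_sum => a _.
rewrite -sumEFin; apply: lee_sum => b ab.
have I_ge0 : (0 <= \int[leb2 R]_z (`|wderiv a b (u r) z| ^+ 2 * w z)%:E)%E.
  by apply: integral_ge0 => z _; rewrite lee_fin !mulr_ge0 ?expR_ge0// sqr_ge0.
have IK := HK (a : nat, b : nat) ab r r01.
rewrite -poweR_EFin; apply: gt0_ler_poweR => //; rewrite in_itv/= ?leey ?andbT//.
exact: le_trans I_ge0 IK.
Qed.
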